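(* Let $(M^n,g)$ be an oriented connected Riemannian manifold with a $\mathrm{Spin}^T$ structure, let $(A,B)$ be a connection on the associated principal $S^1\times S^1$-bundle $P_{S^1\times S^1}$, and let $\mathbb{S}$ be the spinor bundle with Dirac operator $D$ and Laplace operator $\Delta$. Let $s$ be the scalar curvature of $(M,g)$ and let $dA=\Omega^A$ and $dB=\Omega^B$ be the imaginary-valued curvature $2$-forms of the connection $(A,B)$. Then for every spinor field $\psi\in\Gamma(\mathbb{S})$, $$D^2\psi=\Delta\psi+\frac{s}{4}\psi+\frac12 dA\cdot\psi+dB\cdot\psi.$$
   Context: Group and representation. $\mathrm{Spin}^T(n)=(\mathrm{Spin}(n)\times S^1\times S^1)/\{(1,1,1),(-1,-1,-1)\}$, with elements $[g,z_1,z_2]$. Let $\lambda:\mathrm{Spin}(n)\to SO(n)$, $\lambda(g)v=gvg^{-1}$, be the two-fold covering; put $\lambda^T([g,z_1,z_2])=\lambda(g)$ and $l([g,z_1,z_2])=(z_1^2,z_1z_2)\in S^1\times S^1$. Let $\Delta_n$ be the complex spinor module of the complex Clifford algebra $\mathbb{C}l_n$ (of dimension $2^{\lfloor n/2\rfloor}$), with Clifford convention $v\cdot v=-|v|^2$, and $\kappa$ the spin representation of $\mathrm{Spin}(n)$ on $\Delta_n$. The spinor representation of $\mathrm{Spin}^T(n)$ on $\Delta_n$ is $\kappa^T[g,z_1,z_2]\psi=z_1^2z_2\kappa(g)\psi$. $\mathrm{Spin}^T$ structure. Let $P_{SO(n)}\to M$ be the bundle of positively oriented orthonormal frames. A $\mathrm{Spin}^T$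 structure on $(M^n,g)$ is a principal $\mathrm{Spin}^T(n)$-bundle $P_{\mathrm{Spin}^T(n)}\to M$ with a smooth bundle map $\Lambda:P_{\mathrm{Spin}^T(n)}\to P_{SO(n)}$ satisfying $\Lambda(pg)=\Lambda(p)\lambda^T(g)$. Put $P_{S^1\times S^1}=P_{\mathrm{Spin}^T(n)}/\mathrm{Spin}(n)$, a principal $S^1\times S^1$-bundle via $l$; there is a two-fold covering $\Pi:P_{\mathrm{Spin}^T(n)}\to P_{SO(n)}\times P_{S^1\times S^1}$ (fibre product over $M$). The spinor bundle is $\mathbb{S}=P_{\mathrm{Spin}^T(n)}\times_{\kappa^T}\Delta_n$, and $TM$ acts on it by Clifford multiplication. Connection. Fix a connection $(A,B)$ on $P_{S^1\times S^1}$, $A$ and $B$ being $i\mathbb{R}$-valued. Together with the Levi-Civita connection $\nabla$ it induces, via $\Pi$, a connection on $P_{\mathrm{Spin}^T(n)}$ and hence a covariant derivative $\widetilde{\nabla}:\Gamma(\mathbb{S})\to\Gamma(T^*M\otimes\mathbb{S})$. Locally, for an oriented orthonormal frame $e=(e_1,\dots,e_n)$ and a local section $\sigma$ of $P_{S^1\times S^1}$ over an open $U\subset M$, with local connection forms $A^\sigma,B^\sigma:TU\to i\mathbb{R}$ (pull-backs by $\sigma$), and in the trivialization of $\mathbb{S}$ given by a lift of $e\times\sigma$ to $P_{\mathrm{Spin}^T(n)}$ (so that $\psi:U\to\Delta_n$), $$\widetilde{\nabla}_X\psi=d\psi(X)+\tfrac12\sum_{i<j}g(\nabla_Xe_i,e_j)e_ie_j\psi+\tfrac12A^\sigma(X)\psi+B^\sigma(X)\psi.$$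 Operators. $D:\Gamma(\mathbb{S})\to\Gamma(\mathbb{S})$ is $\widetilde{\nabla}$ followed by Clifford multiplication; locally $D\psi=\sum_{i=1}^n e_i\cdot\widetilde{\nabla}_{e_i}\psi$ for any local orthonormal frame $\{e_1,\dots,e_n\}$. The Laplace operator on spinors is $$\Delta\psi=-\sum_{i=1}^n\left(\widetilde{\nabla}_{e_i}\widetilde{\nabla}_{e_i}\psi+\mathrm{div}(e_i)\widetilde{\nabla}_{e_i}\psi\right).$$ The forms $dA,dB$ are regarded as $i\mathbb{R}$-valued $2$-forms on $M$ (locally $dA^\sigma$, $dB^\sigma$). A $2$-form $\omega$ acts on spinors by $\omega\cdot\psi=\sum_{i<j}\omega(e_i,e_j)e_i\cdot e_j\cdot\psi$. The scalar curvature $s$ has the usual sign (positive on round spheres). *)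

(* Defs.v *)
(* Analytic notions for functions valued in [R[i]] are taken through real and
   imaginary parts. *)
From mathcomp Require Import all_boot all_order all_algebra complex.
From mathcomp Require Import boolp classical_sets functions reals.
From mathcomp Require Import topology normedtype derive.

Set Implicit Arguments.
Unset Strict Implicit.
Unset Printing Implicit Defensive.

Import Order.TTheory GRing.Theory Num.Theory numFieldNormedType.Exports.

Local Open Scope classical_set_scope.
Local Open Scope complex_scope.
Local Open Scope ring_scope.

Section SmoothManifold.
Context {R : realType} {n : nat}.

Definition partial (i : 'I_n) (h : 'rV[R]_n -> R) : 'rV[R]_n -> R :=
  fun a => 'D_(delta_mx 0 i) h a.

(* C^infinity on an open [W]: every iterated partial derivative, of any order
   (including 0), is differentiable at every point of [W]. *)
Definition smooth_Rn (W : set 'rV[R]_n) (h : 'rV[R]_n -> R) : Prop :=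
  forall (s : seq 'I_n) a, W a -> differentiable (foldr partial h s) a.

Record oriented_manifold (M : topologicalType) := OrientedManifold {
  chart : Type;
  dom : chart -> set M;
  coord : chart -> M -> 'rV[R]_n;
  param : chart -> 'rV[R]_n -> M;
  dom_open : forall c, open (dom c);
  img_open : forall c, open (coord c @` dom c);
  coordK : forall c x, dom c x -> param c (coord c x) = x;
  coord_continuous : forall c x, dom c x -> {for x, continuous (coord c)};
  param_continuous : forall c a, (coord c @` dom c) a ->
    {for a, continuous (param c)};
  transition_smooth : forall c c' i,
    smooth_Rn (coord c @` (dom c `&` dom c'))
              (fun a => coord c' (param c a) 0 i);
  transition_oriented : forall c c' x, dom c x -> dom c' x ->
    0 < \det (\matrix_(i < n, j < n)
                partial i (fun a => coord c' (param c a) 0 j) (coord c x));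
  chart_at : M -> chart;
  chart_atP : forall x, dom (chart_at x) x;
  manifold_hausdorff : hausdorff_space M;
  manifold_second_countable : @second_countable M }.

End SmoothManifold.

Arguments oriented_manifold R n M : clear implicits.

Section Calculus.
Context {R : realType} {n : nat} {M : topologicalType}.
Variable mM : oriented_manifold R n M.

Definition smooth_on (V : set M) (f : M -> R) : Prop :=
  forall c : chart mM,
    smooth_Rn (coord c @` (V `&` dom c)) (fun a => f (param c a)).

Definition csmooth_on (V : set M) (f : M -> R[i]) : Prop :=
  smooth_on V (fun y => complex.Re (f y)) /\
  smooth_on V (fun y => complex.Im (f y)).

(* The tangent space at [x] is ['rV[R]_n], a row vector [v] standing for
   [\sum_i v_i d/dx_i] in the coordinates of the chart [chart_at mM x];
   a vector field is a function [M -> 'rV[R]_n] (only its values on some open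
   set matter for a local field).  [tder x v f] is the derivative of [f] at
   [x] in the direction [v]. *)
Definition tder (x : M) (v : 'rV[R]_n) (f : M -> R) : R :=
  \sum_i v 0 i * partial i (fun a => f (param (chart_at mM x) a))
                           (coord (chart_at mM x) x).

Definition ctder (x : M) (v : 'rV[R]_n) (f : M -> R[i]) : R[i] :=
  tder x v (fun y => complex.Re (f y)) +i* tder x v (fun y => complex.Im (f y)).

Definition mxtder p q (x : M) (v : 'rV[R]_n) (F : M -> 'M[R[i]]_(p, q)) :
    'M[R[i]]_(p, q) :=
  \matrix_(i, j) ctder x v (fun y => F y i j).

Definition smooth_vf (V : set M) (X : M -> 'rV[R]_n) : Prop :=
  forall W f, open W -> W `<=` V -> smooth_on W f ->
    smooth_on W (fun y => tder y (X y) f).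

(* The coordinate field d/dx_k of the chart [c], expressed at each point [y]
   in the basis given by [chart_at mM y]. *)
Definition coord_vf (c : chart mM) (k : 'I_n) (y : M) : 'rV[R]_n :=
  \row_j partial k (fun a => coord (chart_at mM y) (param c a) 0 j)
                   (coord c y).

Definition lie (X Y : M -> 'rV[R]_n) (x : M) : 'rV[R]_n :=
  \row_j (tder x (X x)
            (fun y => tder y (Y y) (fun z => coord (chart_at mM x) z 0 j))
        - tder x (Y x)
            (fun y => tder y (X y) (fun z => coord (chart_at mM x) z 0 j))).

(* Complex-valued 1-forms: [alpha x] is the covector at [x], with components
   in the basis dual to that of the tangent space. *)
Definition fapp (alpha : M -> 'rV[R[i]]_n) (x : M) (v : 'rV[R]_n) : R[i] :=
  \sum_k (v 0 k)%:C * alpha x 0 k.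

Definition smooth_form (V : set M) (alpha : M -> 'rV[R[i]]_n) : Prop :=
  forall W X, open W -> W `<=` V -> smooth_vf W X ->
    csmooth_on W (fun y => fapp alpha y (X y)).

Definition dform (alpha : M -> 'rV[R[i]]_n) (X Y : M -> 'rV[R]_n) (x : M) :
    R[i] :=
  ctder x (X x) (fun y => fapp alpha y (Y y))
  - ctder x (Y x) (fun y => fapp alpha y (X y))
  - fapp alpha x (lie X Y x).

Definition dlog (w : M -> R[i]) (x : M) : 'rV[R[i]]_n :=
  \row_k ((w x)^-1 * ctder x (delta_mx 0 k) w).

Definition inner (G : M -> 'M[R]_n) (x : M) (u v : 'rV[R]_n) : R :=
  (u *m G x *m v^T) 0 0.

Record riemannian_metric := RiemannianMetric {
  gram : M -> 'M[R]_n;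
  gram_sym : forall x, (gram x)^T = gram x;
  gram_posdef : forall x v, v != 0 -> 0 < inner gram x v v;
  gram_smooth : forall V X Y, open V -> smooth_vf V X -> smooth_vf V Y ->
    smooth_on V (fun x => inner gram x (X x) (Y x)) }.

Variable g : riemannian_metric.

(* [g (nabla_X Y, Z)] at [x], by the Koszul formula. *)
Definition koszul (X Y Z : M -> 'rV[R]_n) (x : M) : R :=
  2%:R^-1 *
  ( tder x (X x) (fun y => inner (gram g) y (Y y) (Z y))
  + tder x (Y x) (fun y => inner (gram g) y (X y) (Z y))
  - tder x (Z x) (fun y => inner (gram g) y (X y) (Y y))
  + inner (gram g) x (lie X Y x) (Z x)
  - inner (gram g) x (lie X Z x) (Y x)
  - inner (gram g) x (lie Y Z x) (X x)).

(* The Levi-Civita connection: [nabla X Y x] is the vector [u] with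
   [g (u, d/dx_k) = koszul X Y (d/dx_k) x] for all [k], in the coordinates of
   [chart_at mM x]. *)
Definition nabla (X Y : M -> 'rV[R]_n) (x : M) : 'rV[R]_n :=
  (\row_k koszul X Y (coord_vf (chart_at mM x) k) x) *m invmx (gram g x).

(* Trace of [v |-> nabla_v X]. *)
Definition divergence (X : M -> 'rV[R]_n) (x : M) : R :=
  \sum_k nabla (coord_vf (chart_at mM x) k) X x 0 k.

Definition riem (X Y Z : M -> 'rV[R]_n) (x : M) : 'rV[R]_n :=
  nabla X (nabla Y Z) x - nabla Y (nabla X Z) x - nabla (lie X Y) Z x.

(* [\sum_(i, j) g (Riem (e_i, e_j) e_j, e_i)] for an orthonormal frame,
   written in the coordinate frame of [chart_at mM x]; positive on round
   spheres. *)
Definition scalar_curvature (x : M) : R :=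
  let d := coord_vf (chart_at mM x) in
  let G' := invmx (gram g x) in
  \sum_a \sum_b \sum_k \sum_l
     G' a l * G' b k * inner (gram g) x (riem (d a) (d b) (d k) x) (d l x).

End Calculus.

Section Clifford.
Context {R : realType} {n : nat}.

(* The real Clifford algebra with [v * v = - |v|^2], in the basis
   [e_S = e_(i_1) ... e_(i_k)], [S = {i_1 < ... < i_k}]. *)
Definition cliff_alg := {ffun {set 'I_n} -> R}.

(* [e_A e_B = cl_sign A B e_(A symmetric-difference B)]: one sign for each
   transposition [j < i] and one for each contraction [e_i e_i = -1]. *)
Definition cl_sign (A B : {set 'I_n}) : R :=
  (-1) ^+ #|[set ij : 'I_n * 'I_n |
             [&& ij.1 \in A, ij.2 \in B & (ij.2 <= ij.1)%N]]|.

Definition cl_mul (a b : cliff_alg) : cliff_alg :=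
  [ffun S : {set 'I_n} =>
    \sum_(A : {set 'I_n}) \sum_(B : {set 'I_n} | (A :\: B) :|: (B :\: A) == S)
      cl_sign A B * a A * b B].

Definition cl_one : cliff_alg := [ffun S : {set 'I_n} => (S == finset.set0)%:R].

Definition cl_vec (v : 'rV[R]_n) : cliff_alg :=
  [ffun S : {set 'I_n} => \sum_i v 0 i * (S == [set i]%SET)%:R].

Definition is_spin (a : cliff_alg) : Prop :=
  exists us : seq 'rV[R]_n,
    [/\ ~~ odd (size us),
        (forall u, u \in us -> \sum_i u 0 i ^+ 2 = 1) &
        a = foldr cl_mul cl_one (map cl_vec us)].

(* [lambda a] is the matrix [L] with [a e_j a^-1 = \sum_i L_ij e_i]. *)
Definition lambda (a : cliff_alg) : 'M[R]_n :=
  xget 0 [set L : 'M[R]_n | forall j,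
            cl_mul a (cl_vec (delta_mx 0 j)) = cl_mul (cl_vec (col j L)^T) a].

(* A triple [(a, z1, z2)] represents the element [[a, z1, z2]] of the quotient
   group Spin^T(n); two triples represent the same element iff [spinT_eq]. *)
Definition spinT_rep := (cliff_alg * R[i] * R[i])%type.

Definition is_spinT (t : spinT_rep) : Prop :=
  [/\ is_spin t.1.1, `|t.1.2| = 1 & `|t.2| = 1].

Definition spinT_eq (t t' : spinT_rep) : Prop :=
  t' = t \/ t' = (- t.1.1, - t.1.2, - t.2).

Definition spinT_one : spinT_rep := (cl_one, 1, 1).

Definition spinT_mul (t t' : spinT_rep) : spinT_rep :=
  (cl_mul t.1.1 t'.1.1, t.1.2 * t'.1.2, t.2 * t'.2).

Definition lT (t : spinT_rep) : R[i] * R[i] := (t.1.2 ^+ 2, t.1.2 * t.2).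

Definition spinor_dim : nat := (2 ^ n./2)%N.

(* A module over the complex Clifford algebra of dimension [2^(n/2)], which is
   necessarily irreducible, is given by the action of the generators. *)
Definition clifford_module (gam : 'I_n -> 'M[R[i]]_spinor_dim) : Prop :=
  forall i j, gam i *m gam j + gam j *m gam i
              = if i == j then (- 2%:R)%:M else 0.

Variable gam : 'I_n -> 'M[R[i]]_spinor_dim.

Definition kappa (a : cliff_alg) : 'M[R[i]]_spinor_dim :=
  \sum_(S : {set 'I_n})
     (a S)%:C *: foldr (fun i B => gam i *m B) 1%:M (enum S).

Definition kappaT (t : spinT_rep) : 'M[R[i]]_spinor_dim :=
  (t.1.2 ^+ 2 * t.2) *: kappa t.1.1.

End Clifford.

Arguments cliff_alg R n : clear implicits.
Arguments spinT_rep R n : clear implicits.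
Arguments spinor_dim n : clear implicits.

Section SpinTStructure.
Context {R : realType} {n : nat} {M : topologicalType}.
Context {mM : oriented_manifold R n M}.
Variable g : riemannian_metric mM.

(* A smooth map into Spin^T(n), given through a smooth lift to
   Spin(n) x S^1 x S^1. *)
Definition smooth_spinT (V : set M) (h : M -> spinT_rep R n) : Prop :=
  [/\ forall y, V y -> is_spinT (h y),
      forall S, smooth_on mM V (fun y => (h y).1.1 S),
      csmooth_on mM V (fun y => (h y).1.2) &
      csmooth_on mM V (fun y => (h y).2)].

(* [s' = s h] on [U], with [h : U -> Spin^T(n)] smooth; a smooth lift of [h]
   to the double cover is only required locally. *)
Definition smoothly_related (P : Type) (act : P -> spinT_rep R n -> P)
    (U : set M) (s s' : M -> P) : Prop :=
  forall x, U x -> exists (V : set M) (h : M -> spinT_rep R n),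
    [/\ open_nbhs x V, V `<=` U, smooth_spinT V h &
        forall y, V y -> s' y = act (s y) (h y)].

(* The smooth principal bundle is presented by its right action and an atlas
   of local sections [lsec i] over [ldom i] (that is, of local
   trivializations) with smooth transition functions.  The rows of [frame p]
   are the vectors of the oriented orthonormal frame [Lambda p]. *)
Record spinT_structure := SpinTStructure {
  total_space : Type;
  proj : total_space -> M;
  act : total_space -> spinT_rep R n -> total_space;
  proj_act : forall p t, is_spinT t -> proj (act p t) = proj p;
  act_one : forall p, act p spinT_one = p;
  act_mul : forall p t t', is_spinT t -> is_spinT t' ->
    act (act p t) t' = act p (spinT_mul t t');
  act_free : forall p t t', is_spinT t -> is_spinT t' ->
    act p t = act p t' <-> spinT_eq t t';
  act_trans : forall p q, proj p = proj q ->
    exists2 t, is_spinT t & act p t = q;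
  triv : Type;
  ldom : triv -> set M;
  lsec : triv -> M -> total_space;
  ldom_open : forall i, open (ldom i);
  lsecP : forall i x, ldom i x -> proj (lsec i x) = x;
  lsec_smooth : forall i j,
    smoothly_related act (ldom i `&` ldom j) (lsec i) (lsec j);
  triv_at : M -> triv;
  triv_atP : forall x, ldom (triv_at x) x;
  frame : total_space -> 'M[R]_n;
  frame_orthonormal : forall p,
    frame p *m gram g (proj p) *m (frame p)^T = 1%:M;
  frame_oriented : forall p, 0 < \det (frame p);
  frame_act : forall p t, is_spinT t ->
    frame (act p t) = (lambda t.1.1)^T *m frame p;
  frame_smooth : forall i k,
    smooth_vf mM (ldom i) (fun y => row k (frame (lsec i y))) }.

Variable P : spinT_structure.

Definition smooth_section (U : set M) (s : M -> total_space P) : Prop :=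
  open U /\
  forall i, smoothly_related (act (s:=P)) (U `&` ldom i) (lsec i) s.

(* The quotient of [P] by Spin(n): its points are the Spin(n)-orbits. *)

Definition spin_orbit (p : total_space P) : set (total_space P) :=
  [set q | exists2 a, is_spin a & q = act p (a, 1, 1)].

Definition torus_act (Q : set (total_space P)) (w : R[i] * R[i]) : set (total_space P) :=
  [set q' | exists q t, [/\ Q q, is_spinT t, lT t = w & q' = act q t]].

Definition smooth_torus_section (U : set M) (sigma : M -> set (total_space P)) :
    Prop :=
  open U /\
  forall x, U x -> exists (V : set M) (s : M -> total_space P),
    [/\ open_nbhs x V, V `<=` U, smooth_section V s &
        forall y, V y -> sigma y = spin_orbit (s y)].

(* A connection on the quotient torus bundle, given by the pull-backs
   [locA sigma], [locB sigma] of its connection form by the smooth local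
   sections [sigma].  Taking [w1 = w2 = 1] in the gauge rules shows that they
   depend only on the germ of [sigma]. *)
Record torus_connection := TorusConnection {
  locA : (M -> set (total_space P)) -> M -> 'rV[R[i]]_n;
  locB : (M -> set (total_space P)) -> M -> 'rV[R[i]]_n;
  loc_imaginary : forall U sigma x k, smooth_torus_section U sigma -> U x ->
    complex.Re (locA sigma x 0 k) = 0 /\ complex.Re (locB sigma x 0 k) = 0;
  loc_smooth : forall U sigma, smooth_torus_section U sigma ->
    smooth_form mM U (locA sigma) /\ smooth_form mM U (locB sigma);
  loc_gauge : forall U sigma sigma' w1 w2,
    smooth_torus_section U sigma -> smooth_torus_section U sigma' ->
    csmooth_on mM U w1 -> csmooth_on mM U w2 ->
    (forall y, U y ->
       [/\ `|w1 y| = 1, `|w2 y| = 1 &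
           sigma' y = torus_act (sigma y) (w1 y, w2 y)]) ->
    forall x, U x ->
      locA sigma' x = locA sigma x + dlog mM w1 x /\
      locB sigma' x = locB sigma x + dlog mM w2 x }.

Variable AB : torus_connection.

Definition curvA (X Y : M -> 'rV[R]_n) (x : M) : R[i] :=
  dform mM (locA AB (fun y => spin_orbit (lsec (triv_at P x) y))) X Y x.

Definition curvB (X Y : M -> 'rV[R]_n) (x : M) : R[i] :=
  dform mM (locB AB (fun y => spin_orbit (lsec (triv_at P x) y))) X Y x.

Variable gam : 'I_n -> 'M[R[i]]_(spinor_dim n).

(* Sections of the associated bundle, as equivariant functions on [P]:
   [psi] stands for [x |-> [p, psi p]], [p] over [x]. *)
Record is_spinor_field (psi : total_space P -> 'cV[R[i]]_(spinor_dim n)) : Prop :=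
  IsSpinorField {
  spinor_equivariant : forall p t, is_spinT t ->
    psi (act p t) = invmx (kappaT gam t) *m psi p;
  spinor_smooth : forall i k,
    csmooth_on mM (ldom i) (fun y => psi (lsec i y) k 0) }.

Definition transporter (p q : total_space P) : spinT_rep R n :=
  xget spinT_one [set t | is_spinT t /\ act p t = q].

(* A smooth local section of [P] through [p]. *)
Definition sec_at (p : total_space P) : M -> total_space P :=
  let i := triv_at P (proj p) in
  fun y => act (lsec i y) (transporter (lsec i (proj p)) p).

Definition frame_at (p : total_space P) (k : 'I_n) : M -> 'rV[R]_n :=
  fun y => row k (frame (sec_at p y)).

(* Clifford multiplication by a tangent vector [v] at [proj p]. *)
Definition clifford (p : total_space P) (v : 'rV[R]_n) : 'M[R[i]]_(spinor_dim n) :=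
  \sum_i ((v *m invmx (frame p)) 0 i)%:C *: gam i.

(* The covariant derivative of a spinor field along the vector field [X],
   computed at [p] in the trivialization given by [sec_at p]. *)
Definition spin_nabla (X : M -> 'rV[R]_n)
    (psi : total_space P -> 'cV[R[i]]_(spinor_dim n)) (p : total_space P) :
    'cV[R[i]]_(spinor_dim n) :=
  let x := proj p in
  let e := frame_at p in
  let sigma := fun y => spin_orbit (sec_at p y) in
  mxtder mM x (X x) (fun y => psi (sec_at p y))
  + 2%:R^-1 *: (\sum_(i < n) \sum_(j < n | (i < j)%N)
      (inner (gram g) x (nabla g X (e i) x) (e j x))%:C
        *: (gam i *m gam j *m psi p))
  + (2%:R^-1 * fapp (locA AB sigma) x (X x)) *: psi p
  + fapp (locB AB sigma) x (X x) *: psi p.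

Definition dirac_op (psi : total_space P -> 'cV[R[i]]_(spinor_dim n)) (p : total_space P) :
    'cV[R[i]]_(spinor_dim n) :=
  \sum_i clifford p (frame_at p i (proj p)) *m spin_nabla (frame_at p i) psi p.

Definition spinor_laplacian (psi : total_space P -> 'cV[R[i]]_(spinor_dim n))
    (p : total_space P) : 'cV[R[i]]_(spinor_dim n) :=
  - \sum_i (spin_nabla (frame_at p i) (spin_nabla (frame_at p i) psi) p
            + (divergence g (frame_at p i) (proj p))%:C
                *: spin_nabla (frame_at p i) psi p).

(* The action of a 2-form on spinors; [omega X Y x] is the value at [x] of the
   2-form on the vector fields [X] and [Y]. *)
Definition form2_act (omega : (M -> 'rV[R]_n) -> (M -> 'rV[R]_n) -> M -> R[i])
    (psi : total_space P -> 'cV[R[i]]_(spinor_dim n)) (p : total_space P) :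
    'cV[R[i]]_(spinor_dim n) :=
  let x := proj p in
  let e := frame_at p in
  \sum_(i < n) \sum_(j < n | (i < j)%N)
    omega (e i) (e j) x *: (clifford p (e i x) *m clifford p (e j x) *m psi p).

End SpinTStructure.

(* Main.v *)
(* The covariant derivative of a spinor field does not depend on the local
   section used to trivialize the spinor bundle: two sections through the same
   point differ by a smooth map into Spin^T(n) equal to the unit there, and for
   its spin component [a] the relation [a v = (lambda a v) a] determines the
   derivative of [a] from that of [lambda a].  Both sides can thus be computed in
   one local section.  Clifford multiplication being parallel, [D^2] is the sum
   over [i, j] of [e_i e_j nabla^2_ij]; its symmetric part is the Laplacian and
   its antisymmetric part is half the contraction of the curvature of the spinor
   connection with [e_i e_j].  That curvature consists of [dA / 2 + dB] and of the
   lift of the Riemann tensor, whose contraction is reduced to [s / 4] by the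
   first Bianchi identity. *)
Require Import Defs.
From mathcomp Require Import all_boot all_order all_algebra complex.
From mathcomp Require Import ring lra.
From mathcomp Require Import boolp classical_sets functions reals.
From mathcomp Require Import topology normedtype landau derive.
Require Import Defs.

Set Implicit Arguments.
Unset Strict Implicit.
Unset Printing Implicit Defensive.

Import Order.TTheory GRing.Theory Num.Theory numFieldNormedType.Exports.

Local Open Scope classical_set_scope.
Local Open Scope complex_scope.
Local Open Scope ring_scope.

(** * Smooth functions on open sets of R^n *)

(** Charts, trivializations and frames are chosen point by point: [chart_at], [triv_at] and
    [frame_at] need not vary continuously. In [D^2] the inner operator at a nearby point is
    evaluated with the choices belonging to that point, so it cannot be differentiated before it is
    rewritten in the single section [sec_at p]; the outer operator uses that section by definition.
    Hence both gauge invariance and tensoriality in the direction are needed. The weights of [A] and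
    [B] are dictated by the representation: [lT] is [(z1^2, z1 z2)] and [kappaT] has weight
    [z1^2 z2], and at the unit [1/2 (2 z1') + (z1' + z2') = 2 z1' + z2']. The factor [1/4] of the
    scalar curvature is [1/2] from antisymmetrization, times [1/4] from the normalization of
    [spin_form], times [2] from the Clifford contraction. Dimension zero is set apart: changing the
    sign of a triple requires [-1] in Spin(n), and Spin(0) is reduced to [1]. *)

Lemma near_eq_differentiable (R : realType) (V W : normedModType R)
    (f g : V -> W) (a : V) :
  (\near a, f a = g a) -> differentiable f a -> differentiable g a.
Proof.
move=> fg /diff_locallyP [df_cont fE].
have fga : f a = g a by exact: (nbhs_singleton fg).
have gE : g \o shift a = cst (g a) + 'd f a +o_ 0 id.
  apply/eqaddoP => e e0; have /eqaddoP/(_ _ e0) := fE => fe.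
  have fg0 : \forall h \near (0 : V), f (h + a) = g (h + a).
    by rewrite (near_shift a); near do rewrite /= sub0r subrK.
  near=> h; rewrite !fctE -fga.
  have -> : g (h + a) = f (h + a) by rewrite (near fg0 h).
  near: h; exact: fe.
have dgf := diff_unique df_cont gE.
by apply/diff_locallyP; rewrite dgf.
Unshelve. all: by end_near. Qed.

Section Smooth.
Context {R : realType} {n : nat}.
Implicit Types (W : set 'rV[R]_n) (h k : 'rV[R]_n -> R).

Lemma foldr_partial_eq W h k (s : seq 'I_n) : open W ->
  (forall a, W a -> h a = k a) ->
  forall a, W a -> foldr partial h s a = foldr partial k s a.
Proof.
move=> oW hk; elim: s => [|i s IH] a Wa /=; first exact: hk.
apply: near_eq_derive; apply: filterS (open_nbhs_nbhs (conj oW Wa)).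
by move=> b /IH.
Qed.

Lemma partial_eq W h k i : open W -> (forall a, W a -> h a = k a) ->
  forall a, W a -> partial i h a = partial i k a.
Proof. exact: (@foldr_partial_eq W h k [:: i]). Qed.

Lemma smooth_Rn_differentiable W h a : smooth_Rn W h -> W a ->
  differentiable h a.
Proof. by move=> /(_ [::]) /[apply]. Qed.

Lemma smooth_Rn_partial W h i : smooth_Rn W h -> smooth_Rn W (partial i h).
Proof.
by move=> sh s a Wa; have := sh (rcons s i) a Wa; rewrite foldr_rcons.
Qed.

Lemma smooth_Rn_subset W W' h : W `<=` W' -> smooth_Rn W' h -> smooth_Rn W h.
Proof. by move=> WW sh s a /WW; exact: sh. Qed.

(* Coinduction principle: a class of differentiable functions that is stable
   under partial derivatives consists of smooth functions. *)
Lemma smooth_Rn_coind W (S : ('rV[R]_n -> R) -> Prop) : open W ->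
  (forall h, S h -> (forall a, W a -> differentiable h a) /\
    forall i, exists2 k, S k & forall a, W a -> partial i h a = k a) ->
  forall h, S h -> smooth_Rn W h.
Proof.
(* The list is split at its last entry, the derivative applied first, so that the induction
   hypothesis is used for the member of [S] that represents this derivative. *)
move=> oW SP h Sh s; elim/last_ind: s h Sh => [|s i IH] h Sh a Wa.
  by have [+ _] := SP h Sh; exact.
have [_ /(_ i)[k Sk hk]] := SP h Sh.
rewrite foldr_rcons; apply: near_eq_differentiable (IH k Sk a Wa).
apply: filterS (open_nbhs_nbhs (conj oW Wa)) => b Wb.
by rewrite (foldr_partial_eq _ oW hk).
Qed.

Lemma derive_sum_partial h a v : differentiable h a ->
  'D_v h a = \sum_i v 0 i * partial i h a.
Proof.
move=> dh; rewrite deriveE // {1}[v]row_sum_delta linear_sum.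
apply: eq_bigr => i _; rewrite linearZ /partial deriveE //.
Qed.

Lemma differentiable_rowP (m : nat) (phi : 'rV[R]_n -> 'rV[R]_m) a :
  (forall j, differentiable (fun b => phi b 0 j) a) -> differentiable phi a.
Proof.
move=> dphi.
have -> : phi = \sum_(j < m) (fun b => phi b 0 j *: delta_mx 0 j : 'rV[R]_m).
  apply/funext => b; rewrite fct_sumE; exact: row_sum_delta.
by apply: differentiable_sum => j; apply: differentiableZl.
Qed.

End Smooth.

Lemma coord_diff (R : realType) m (j : 'I_m) (a : 'rV[R]_m) :
  differentiable (fun N : 'rV[R]_m => N 0 j : R) a /\
  'd (fun N : 'rV[R]_m => N 0 j : R) a = (fun N => N 0 j) :> ('rV[R]_m -> R).
Proof.
have @f : {linear 'rV[R]_m -> R}.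
  by exists (fun N : 'rV[R]_m => N 0 j); do 2![eexists]; do ?[constructor];
     rewrite ?mxE// => ? *; rewrite ?mxE//; move=> ?; rewrite !mxE.
have cf : continuous f by exact: matrix_normedtype.coord_continuous.
by split; [exact: (@linear_differentiable _ _ _ f a cf)|exact: (@diff_lin _ _ _ f a cf)].
Qed.

Lemma partial_coord (R : realType) m (i j : 'I_m) (a : 'rV[R]_m) :
  partial i (fun N => N 0 j) a = (j == i)%:R.
Proof.
have [cdif cdE] := coord_diff j a.
by rewrite /partial deriveE // cdE mxE eqxx.
Qed.

Lemma partial_comp (R : realType) (n m : nat) (phi : 'rV[R]_n -> 'rV[R]_m) (h : 'rV[R]_m
  -> R) a i :
  (forall j, differentiable (fun b => phi b 0 j) a) ->
  differentiable h (phi a) ->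
  partial i (h \o phi) a =
    \sum_j partial i (fun b => phi b 0 j) a * partial j h (phi a).
Proof.
move=> dphi dh; have dp := differentiable_rowP dphi.
rewrite /partial deriveE; last exact: differentiable_comp.
rewrite diff_comp //= -(deriveE _ dh) (derive_sum_partial _ dh); apply: eq_bigr => j _.
congr (_ * _); rewrite !deriveE //.
have [cdif cdE] := @coord_diff R m j (phi a).
have -> : (fun b => phi b 0 j) = (fun N : 'rV[R]_m => N 0 j) \o phi by [].
by rewrite (@diff_comp _ _ _ _ phi _ a dp cdif) /= cdE.
Qed.


(* The functions reached from [base], [h \o phi] by sums, products and partial
   derivatives, as a stable class for [smooth_Rn_coind]. *)
Inductive generated (R : realType) n m (W : set 'rV[R]_n) (W' : set 'rV[R]_m)
    (phi : 'rV[R]_n -> 'rV[R]_m) : ('rV[R]_n -> R) -> Prop :=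
| generated_base h : smooth_Rn W h -> generated W W' phi h
| generated_comp h : smooth_Rn W' h -> generated W W' phi (h \o phi)
| generated_add h k : generated W W' phi h -> generated W W' phi k ->
    generated W W' phi (fun a => h a + k a)
| generated_mul h k : generated W W' phi h -> generated W W' phi k ->
    generated W W' phi (fun a => h a * k a).

Section SmoothClosure.
Context {R : realType}.

Lemma partial_cst n (x : R) i : partial i (fun _ : 'rV[R]_n => x) = fun=> 0.
Proof. by apply/funext => a; rewrite /partial derive_cst. Qed.

Lemma smooth_Rn_cst n (W : set 'rV[R]_n) (x : R) : smooth_Rn W (fun=> x).
Proof.
move=> s a _; suff [y ->] : exists y, foldr partial (fun=> x) s = fun=> y :> R.
  exact: differentiable_cst.
elim: s => [|i s [y /= ->]]; first by exists x.
by exists 0; rewrite partial_cst.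
Qed.

Lemma partialD n (h k : 'rV[R]_n -> R) a i : differentiable h a ->
  differentiable k a ->
  partial i (fun b => h b + k b) a = partial i h a + partial i k a.
Proof.
by move=> dh dk; rewrite /partial -deriveD //; exact: diff_derivable.
Qed.

Lemma partialM n (h k : 'rV[R]_n -> R) a i : differentiable h a ->
  differentiable k a ->
  partial i (fun b => h b * k b) a = partial i h a * k a + h a * partial i k a.
Proof.
move=> dh dk; rewrite /partial (deriveM (f := h) (g := k)); last 2 first.
- exact: diff_derivable.
- exact: diff_derivable.
by rewrite addrC /GRing.scale /= mulrC.
Qed.

Lemma generated_cst n m W W' (phi : 'rV[R]_n -> 'rV[R]_m) (x : R) :
  generated W W' phi (fun=> x).
Proof. exact/generated_base/smooth_Rn_cst. Qed.

Lemma generated_sum n m W W' (phi : 'rV[R]_n -> 'rV[R]_m) (I : Type) (r : seq I)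
    (F : I -> 'rV[R]_n -> R) : (forall i, generated W W' phi (F i)) ->
  generated W W' phi (fun a => \sum_(i <- r) F i a).
Proof.
move=> gF; elim: r => [|i r IH].
  by under eq_fun do rewrite big_nil; exact: generated_cst.
by under eq_fun do rewrite big_cons; exact: generated_add.
Qed.

(** The chain rule turns a partial derivative of [h \o phi] into a sum of products, and the Leibniz
    rule produces sums of products again. This is why the class is closed under both operations, and
    why one induction over it gives stability under [partial]. *)
Lemma generated_smooth n m (W : set 'rV[R]_n) (W' : set 'rV[R]_m) phi h :
  open W -> (forall a, W a -> W' (phi a)) ->
  (forall j, smooth_Rn W (fun a => phi a 0 j)) ->
  generated W W' phi h -> smooth_Rn W h.
Proof.
move=> oW WW' sphi; apply: smooth_Rn_coind => // {}h.
have dphi a j : W a -> differentiable (fun b => phi b 0 j) a.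
  exact: smooth_Rn_differentiable.
elim=> {h} [h sh|h sh|h k gh [dh ph] gk [dk pk]|h k gh [dh ph] gk [dk pk]].
- split=> [a|i]; first exact: smooth_Rn_differentiable.
  by exists (partial i h) => //; apply/generated_base/smooth_Rn_partial.
- have dh a : W a -> differentiable h (phi a).
    by move=> /WW'; exact: smooth_Rn_differentiable.
  split=> [a Wa|i].
    apply: differentiable_comp; last exact: dh.
    by apply: differentiable_rowP => j; exact: dphi.
  exists (fun a => \sum_j partial i (fun b => phi b 0 j) a * (partial j h \o phi) a).
    apply: generated_sum => j; apply: generated_mul.
      exact/generated_base/smooth_Rn_partial.
    exact/generated_comp/smooth_Rn_partial.
  by move=> a Wa; rewrite partial_comp //; [move=> j; exact: dphi|exact: dh].
- split=> [a Wa|i].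
    by apply: differentiableD; [exact: dh|exact: dk].
  have [h' gh' hh'] := ph i; have [k' gk' kk'] := pk i.
  exists (fun a => h' a + k' a); first exact: generated_add.
  by move=> a Wa; rewrite partialD ?hh' ?kk' //; [exact: dh|exact: dk].
- split=> [a Wa|i].
    by apply: differentiableM; [exact: dh|exact: dk].
  have [h' gh' hh'] := ph i; have [k' gk' kk'] := pk i.
  exists (fun a => h' a * k a + h a * k' a).
    by apply: generated_add; exact: generated_mul.
  by move=> a Wa; rewrite partialM ?hh' ?kk' //; [exact: dh|exact: dk].
Qed.

Lemma smooth_Rn_comp n m (W : set 'rV[R]_n) (W' : set 'rV[R]_m) phi h :
  open W -> (forall a, W a -> W' (phi a)) ->
  (forall j, smooth_Rn W (fun a => phi a 0 j)) ->
  smooth_Rn W' h -> smooth_Rn W (h \o phi).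
Proof.
by move=> oW WW' sphi sh; apply: generated_smooth WW' sphi _ => //;
  exact: generated_comp.
Qed.

Lemma smooth_Rn_add n (W : set 'rV[R]_n) h k : open W ->
  smooth_Rn W h -> smooth_Rn W k -> smooth_Rn W (fun a => h a + k a).
Proof.
(* No inner map is involved, so the constant map into [R^0] is taken; its smoothness condition
   ranges over an empty index set. *)
move=> oW sh sk; apply: (@generated_smooth _ 0 _ setT (fun=> 0)) => //.
  by case.
by apply: generated_add; exact: generated_base.
Qed.

Lemma smooth_Rn_mul n (W : set 'rV[R]_n) h k : open W ->
  smooth_Rn W h -> smooth_Rn W k -> smooth_Rn W (fun a => h a * k a).
Proof.
move=> oW sh sk; apply: (@generated_smooth _ 0 _ setT (fun=> 0)) => //.
  by case.
by apply: generated_mul; exact: generated_base.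
Qed.

Lemma smooth_Rn_eq n (W : set 'rV[R]_n) h k : open W ->
  (forall a, W a -> h a = k a) -> smooth_Rn W h -> smooth_Rn W k.
Proof.
move=> oW hk sh s a Wa; apply: near_eq_differentiable (sh s a Wa).
apply: filterS (open_nbhs_nbhs (conj oW Wa)) => b Wb.
exact: foldr_partial_eq hk _ Wb.
Qed.

Lemma differentiable_near_linear n (h : 'rV[R]_n -> R) (a : 'rV[R]_n) :
  differentiable h a -> forall e, 0 < e ->
  \forall w \near (0 : 'rV[R]_n), `|h (w + a) - h a - 'd h a w| <= e * `|w|.
Proof.
move=> /diff_locally/eqaddoP dh e e0; have := dh e e0.
by apply: filterS => w; rewrite /= !fctE opprD addrA.
Qed.

(* Mean value theorem for r |-> h (a + r u + t v) - h (a + r u). *)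
Lemma second_difference n (W : set 'rV[R]_n) (h : 'rV[R]_n -> R) a u v :
  open W -> W a -> (forall b, W b -> differentiable h b) ->
  differentiable (fun b => 'D_u h b) a -> forall e, 0 < e ->
  \forall t \near 0^'+, `|h (t *: u + t *: v + a) - h (t *: u + a)
     - h (t *: v + a) + h a - t ^+ 2 * 'D_v (fun b => 'D_u h b) a| <= e * t ^+ 2.
Proof.
move=> oW Wa dh ddh e e0.
(* For [0 <= r, s <= t] the vector [r u + s v] has norm at most [t C]; the summand [1] keeps [C]
   positive when [u = v = 0]. Two first-order errors of size [e / (2 C)] times [t C] then add up to
   [e t]. *)
pose C := `|u| + `|v| + 1.
have C0 : 0 < C by apply: ltr_wpDl => //; rewrite addr_ge0.
have e'0 : 0 < e / (2 * C) by rewrite divr_gt0 // mulr_gt0.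
have near1 := differentiable_near_linear ddh e'0.
have near2 : \forall w \near (0 : 'rV[R]_n), W (w + a).
  have : \forall z \near a, W z by exact: open_nbhs_nbhs.
  rewrite (near_shift 0) /= subr0; exact: filterS.
have /nbhs_ballP[d /= d0 dP] : \forall w \near (0 : 'rV[R]_n),
    `|'D_u h (w + a) - 'D_u h a - 'd (fun b => 'D_u h b) a w| <= e / (2 * C) * `|w|
    /\ W (w + a) by exact: filterI near1 near2.
near=> t.
have t0 : 0 < t by near: t; exact: nbhs_right_gt.
have tC : t * C < d.
  by rewrite -ltr_pdivlMr //; near: t; apply: nbhs_right_lt; rewrite divr_gt0.
have small r s : 0 <= r -> r <= t -> 0 <= s -> s <= t ->
    `|r *: u + s *: v| <= t * C.
  move=> r0 rt s0 st; apply: le_trans (ler_normD _ _) _.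
  rewrite !normrZ !ger0_norm // /C !mulrDr mulr1 -addrA.
  by apply: lerD; [exact: ler_wpM2r|rewrite -[leLHS]addr0 lerD ?ler_wpM2r // ltW].
have inW r s : 0 <= r -> r <= t -> 0 <= s -> s <= t -> W (r *: u + s *: v + a).
  move=> r0 rt s0 st; have [] // := dP (r *: u + s *: v).
  by rewrite -ball_normE /= sub0r normrN (le_lt_trans _ tC) // small.
have est r s : 0 <= r -> r <= t -> 0 <= s -> s <= t ->
    `|'D_u h (r *: u + s *: v + a) - 'D_u h a
      - 'd (fun b => 'D_u h b) a (r *: u + s *: v)| <= e / (2 * C) * (t * C).
  move=> r0 rt s0 st; have [|+ _] := dP (r *: u + s *: v).
    by rewrite -ball_normE /= sub0r normrN (le_lt_trans _ tC) // small.
  by move=> /le_trans; apply; rewrite ler_pM2l // small.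
pose G r := h (r *: u + t *: v + a) - h (r *: u + a).
pose dG r := 'D_u h (r *: u + t *: v + a) - 'D_u h (r *: u + a).
have dline (b : 'rV[R]_n) r : differentiable h (r *: u + b) ->
    is_derive r 1 (fun r => h (r *: u + b)) ('D_u h (r *: u + b)).
  move=> dhb; have lineE : (fun s : R => s^-1 *: (h ((s *: 1 + r) *: u + b)
      - h (r *: u + b))) = (fun s => s^-1 *: (h (s *: u + (r *: u + b)) - h (r *: u + b))).
    by apply/funext => s; rewrite addrA -scalerDl /GRing.scale /= mulr1.
  by apply: DeriveDef; rewrite /derivable /derive /= ?lineE //; exact: diff_derivable.
have Gder r : 0 <= r -> r <= t -> is_derive r 1 G (dG r).
  move=> r0 rt; rewrite /G /dG; apply: is_deriveB.
    under eq_fun do rewrite -addrA; rewrite -addrA; apply: dline.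
    by rewrite addrA; apply/dh/inW => //; exact: ltW.
  apply: dline; have := inW r 0; rewrite scale0r addr0 => inW0.
  by apply/dh/inW0 => //; exact: ltW.
have [r rt GE] : exists2 r, r \in `]0, t[%R & G t - G 0 = dG r * (t - 0).
  apply: MVT => // [r|].
    by rewrite in_itv /= => /andP[r0 rt]; apply: Gder; exact: ltW.
  apply: derivable_within_continuous => r; rewrite in_itv /= => /andP[r0 rt].
  by have [] := Gder r r0 rt.
move: rt; rewrite in_itv /= => /andP[/ltW r0 /ltW rt].
have est1 := est r t r0 rt (ltW t0) (lexx t).
have est2 := est r 0 r0 rt (lexx 0) (ltW t0).
rewrite scale0r addr0 in est2.
have -> : h (t *: u + t *: v + a) - h (t *: u + a) - h (t *: v + a) + h a
    = t * dG r.
  rewrite -[t in RHS]subr0 mulrC -GE /G !scale0r !add0r; ring.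
have -> : e * t ^+ 2 = t * (e / (2 * C) * (t * C) + e / (2 * C) * (t * C)).
  by field; rewrite gt_eqF.
rewrite expr2 -mulrA -mulrBr normrM gtr0_norm // ler_pM2l //.
apply: le_trans (lerD est1 est2); apply: le_trans (ler_normB _ _).
have dvE : 'D_v (fun b => 'D_u h b) a = 'd (fun b => 'D_u h b) a v by exact: deriveE.
rewrite [in leRHS]linearD /= [in X in _ <= `| _ - (X + _) - _|]linearZ /=.
rewrite [X in _ <= `| _ - (_ + X) - _|]linearZ /= [X in _ <= `| _ - (_ - X)|]linearZ /= -dvE.
rewrite le_eqVlt; apply/orP; left; apply/eqP; congr (`| _ |).
rewrite /dG /GRing.scale /=; ring.
Unshelve. all: by end_near. Qed.

(** The second difference along the two axes is one number, whichever direction comes first. For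
    small [t] it lies within [(e / 2) t^2] of [t^2] times either mixed derivative, so these differ
    by at most [e]. *)
Lemma schwarz n (W : set 'rV[R]_n) (h : 'rV[R]_n -> R) a i j :
  open W -> W a -> smooth_Rn W h ->
  partial i (partial j h) a = partial j (partial i h) a.
Proof.
move=> oW Wa sh; have dh b : W b -> differentiable h b.
  exact: smooth_Rn_differentiable.
have dph k : differentiable (fun b => 'D_(delta_mx 0 k) h b) a.
  exact: (smooth_Rn_differentiable (smooth_Rn_partial k sh)).
apply/eqP; rewrite -subr_eq0 -normr_le0; apply/ler_addgt0Pr => e e0.
rewrite add0r; have e20 : 0 < e / 2 by rewrite divr_gt0.
have P1 := second_difference (delta_mx 0 i) oW Wa dh (dph j) e20.
have P2 := second_difference (delta_mx 0 j) oW Wa dh (dph i) e20.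
have P0 : \forall t \near (0 : R)^'+, 0 < t := nbhs_right_gt 0.
have [t [t0 [le1 le2]]] := filter_ex (filterI P0 (filterI P1 P2)).
rewrite -/(partial i (partial j h) a) in le1; rewrite -/(partial j (partial i h) a) in le2.
rewrite [t *: delta_mx 0 j + _]addrC in le1.
set p := partial _ _ _ in le1 *; set q := partial _ _ _ in le2 *.
have t20 := exprn_gt0 2 t0.
rewrite -(ler_pM2l t20) -[X in X * `|_|](gtr0_norm t20) -normrM.
have -> : t ^+ 2 * e = e / 2 * t ^+ 2 + e / 2 * t ^+ 2 by field.
apply: le_trans (lerD le2 le1); apply: le_trans (ler_normB _ _).
rewrite le_eqVlt; apply/orP; left; apply/eqP; congr (`| _ |); ring.
Qed.

End SmoothClosure.

(** * Smooth functions and vector fields on a manifold *)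

Section Calculus.
Context {R : realType} {n : nat} {M : topologicalType}.
Context {mM : oriented_manifold R n M}.
Implicit Types (V W : set M) (c : chart mM) (f g : M -> R) (x y : M).
Implicit Types (X Y Z : M -> 'rV[R]_n).

Lemma open_coord_image c V : open V -> open (coord c @` (V `&` dom c)).
Proof.
move=> oV.
have -> : coord c @` (V `&` dom c) = (coord c @` dom c) `&` (param c @^-1` V).
  apply/seteqP; split=> [_ [x [Vx cx] <-]|_ [[x cx <-]]] /=.
    by split; [exists x|rewrite /= coordK].
  by rewrite coordK // => Vx; exists x.
rewrite openE => a [ca Va].
have near1 : nbhs a (coord c @` dom c) by apply: open_nbhs_nbhs; split => //; exact: img_open.
have near2 : nbhs a (param c @^-1` V).
  exact/(param_continuous ca)/(open_nbhs_nbhs (conj oV Va)).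
exact: (filterI near1 near2).
Qed.

Lemma smooth_on_subset V W f : W `<=` V -> smooth_on mM V f -> smooth_on mM W f.
Proof.
move=> WV sf c; apply: smooth_Rn_subset (sf c) => _ [x [Wx cx] <-].
by exists x => //; split=> //; exact: WV.
Qed.

Lemma smooth_on_eq V f g : open V -> (forall x, V x -> f x = g x) ->
  smooth_on mM V f -> smooth_on mM V g.
Proof.
move=> oV fg sf c; apply: smooth_Rn_eq (sf c); first exact: open_coord_image.
by move=> _ [x [Vx cx] <-]; rewrite coordK //; exact: fg.
Qed.

Lemma smooth_on_cst V (a : R) : smooth_on mM V (fun=> a).
Proof. by move=> c; exact: smooth_Rn_cst. Qed.

Lemma smooth_onD V f g : open V -> smooth_on mM V f -> smooth_on mM V g ->
  smooth_on mM V (fun x => f x + g x).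
Proof.
by move=> oV sf sg c; apply: smooth_Rn_add; [exact: open_coord_image|..].
Qed.

Lemma smooth_onM V f g : open V -> smooth_on mM V f -> smooth_on mM V g ->
  smooth_on mM V (fun x => f x * g x).
Proof.
by move=> oV sf sg c; apply: smooth_Rn_mul; [exact: open_coord_image|..].
Qed.

Lemma smooth_onZ V a f : open V -> smooth_on mM V f ->
  smooth_on mM V (fun x => a * f x).
Proof. by move=> oV; apply: smooth_onM => //; exact: smooth_on_cst. Qed.

Lemma smooth_onN V f : open V -> smooth_on mM V f ->
  smooth_on mM V (fun x => - f x).
Proof.
by move=> oV sf; under eq_fun do rewrite -mulN1r; exact: smooth_onZ.
Qed.

Lemma smooth_onB V f g : open V -> smooth_on mM V f -> smooth_on mM V g ->
  smooth_on mM V (fun x => f x - g x).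
Proof. by move=> oV sf sg; apply: smooth_onD => //; exact: smooth_onN. Qed.

Lemma smooth_on_sum V (I : Type) (r : seq I) (P : pred I) (F : I -> M -> R) :
  open V -> (forall i, P i -> smooth_on mM V (F i)) ->
  smooth_on mM V (fun x => \sum_(i <- r | P i) F i x).
Proof.
move=> oV sF; elim: r => [|i r IH].
  by under eq_fun do rewrite big_nil; exact: smooth_on_cst.
case Pi: (P i); last by under eq_fun do rewrite big_cons Pi.
under eq_fun do rewrite big_cons Pi.
by apply: (smooth_onD oV _ IH); exact: sF.
Qed.

Lemma smooth_on_differentiable V f c y : smooth_on mM V f -> V y -> dom c y ->
  differentiable (fun a => f (param c a)) (coord c y).
Proof.
by move=> sf Vy cy; apply: (smooth_Rn_differentiable (sf c)); exists y.
Qed.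

Lemma smooth_on_coord c k : smooth_on mM (dom c) (fun y => coord c y 0 k).
Proof. by move=> c'; rewrite setIC; exact: transition_smooth. Qed.

Lemma near_param c V y : open V -> V y -> dom c y ->
  \forall a \near coord c y, exists2 z, V z /\ dom c z & a = coord c z.
Proof.
move=> oV Vy cy; have : (coord c @` (V `&` dom c)) (coord c y) by exists y.
move=> /(conj (open_coord_image oV))/open_nbhs_nbhs.
by apply: filterS => _ [z [Vz cz] <-]; exists z.
Qed.

(** [tder] is tied to the chart chosen at the point, and this choice changes arbitrarily from point
    to point. The chain rule through the transition map allows one fixed chart to be used over a
    neighbourhood. *)
Lemma tder_chart c y v f : dom c y ->
  differentiable (fun a => f (param c a)) (coord c y) ->
  tder mM y v f = \sum_k tder mM y v (fun z => coord c z 0 k)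
                    * partial k (fun a => f (param c a)) (coord c y).
Proof.
move=> cy df; set c' := chart_at mM y; have c'y : dom c' y := chart_atP mM y.
pose phi a := coord c (param c' a).
have dphi k : differentiable (fun a => phi a 0 k) (coord c' y).
  exact: (smooth_on_differentiable (smooth_on_coord k) cy c'y).
have phiy : phi (coord c' y) = coord c y by rewrite /phi coordK.
rewrite /tder -/c'.
under eq_bigr => i _.
  rewrite (_ : partial i _ _ =
    \sum_k partial i (fun a => phi a 0 k) (coord c' y)
           * partial k (fun a => f (param c a)) (coord c y)); last first.
    transitivity (partial i ((fun a => f (param c a)) \o phi) (coord c' y)).
      apply: near_eq_derive.
      apply: filterS (near_param (dom_open c) cy c'y) => _ [z [cz c'z] ->] /=.
      by rewrite /phi !coordK.
    by rewrite (@partial_comp _ _ _ phi (fun a => f (param c a))) ?phiy.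
  rewrite mulr_sumr; over.
rewrite exchange_big /=; apply: eq_bigr => k _; rewrite mulr_suml.
by apply: eq_bigr => i _; rewrite mulrA.
Qed.

Lemma tder_coord y v j :
  tder mM y v (fun z => coord (chart_at mM y) z 0 j) = v 0 j.
Proof.
rewrite /tder; set c := chart_at mM y; have cy : dom c y := chart_atP mM y.
have cE i : partial i (fun a => coord c (param c a) 0 j) (coord c y) = (j == i)%:R.
  rewrite -(partial_coord i j (coord c y)).
  apply: (@partial_eq _ _ (coord c @` (setT `&` dom c))); last by exists y.
    exact/open_coord_image/openT.
  by move=> _ [z [_ cz] <-]; rewrite coordK.
rewrite (bigD1 j) //= big1 ?addr0 ?cE ?eqxx ?mulr1 // => i ij.
by rewrite cE eq_sym (negPf ij) mulr0.
Qed.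

Lemma tder_eq V y v f g : open V -> V y -> (forall z, V z -> f z = g z) ->
  tder mM y v f = tder mM y v g.
Proof.
move=> oV Vy fg; rewrite /tder; apply: eq_bigr => i _; congr (_ * _).
apply: near_eq_derive.
apply: filterS (near_param oV Vy (chart_atP mM y)) => _ [z [Vz cz] ->].
by rewrite coordK // fg.
Qed.

Lemma tder_cst y v (a : R) : tder mM y v (fun=> a) = 0.
Proof. by rewrite /tder big1 // => i _; rewrite partial_cst mulr0. Qed.

Lemma tderD V y v f g : smooth_on mM V f -> smooth_on mM V g -> V y ->
  tder mM y v (fun z => f z + g z) = tder mM y v f + tder mM y v g.
Proof.
move=> sf sg Vy; rewrite /tder -big_split; apply: eq_bigr => i _.
rewrite /= -mulrDr partialD //.
- exact: (smooth_on_differentiable sf Vy (chart_atP mM y)).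
- exact: (smooth_on_differentiable sg Vy (chart_atP mM y)).
Qed.

Lemma tderM V y v f g : smooth_on mM V f -> smooth_on mM V g -> V y ->
  tder mM y v (fun z => f z * g z) = tder mM y v f * g y + f y * tder mM y v g.
Proof.
move=> sf sg Vy; rewrite /tder mulr_sumr mulr_suml -big_split.
apply: eq_bigr => i _ /=; rewrite partialM //; last 2 first.
- exact: (smooth_on_differentiable sf Vy (chart_atP mM y)).
- exact: (smooth_on_differentiable sg Vy (chart_atP mM y)).
rewrite coordK; last exact: chart_atP.
by ring.
Qed.

Lemma tderZ V y v a f : smooth_on mM V f -> V y ->
  tder mM y v (fun z => a * f z) = a * tder mM y v f.
Proof.
by move=> sf Vy; rewrite (tderM _ (@smooth_on_cst V a) sf) // tder_cst mul0r add0r.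
Qed.

Lemma tderN V y v f : smooth_on mM V f -> V y ->
  tder mM y v (fun z => - f z) = - tder mM y v f.
Proof.
move=> sf Vy; under eq_fun do rewrite -mulN1r.
by rewrite (tderZ _ _ sf) // mulN1r.
Qed.

Lemma tderB V y v f g : open V -> smooth_on mM V f -> smooth_on mM V g -> V y ->
  tder mM y v (fun z => f z - g z) = tder mM y v f - tder mM y v g.
Proof.
move=> oV sf sg Vy; rewrite (tderD _ sf (smooth_onN oV sg)) //.
by rewrite (tderN _ sg).
Qed.

Lemma tder_sum V y v (I : Type) (r : seq I) (P : pred I) (F : I -> M -> R) :
  open V -> (forall i, P i -> smooth_on mM V (F i)) -> V y ->
  tder mM y v (fun z => \sum_(i <- r | P i) F i z)
  = \sum_(i <- r | P i) tder mM y v (F i).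
Proof.
move=> oV sF Vy; elim: r => [|i r IH].
  by under eq_fun do rewrite big_nil; rewrite tder_cst big_nil.
rewrite big_cons; case Pi: (P i); last by under eq_fun do rewrite big_cons Pi.
under eq_fun do rewrite big_cons Pi.
rewrite (tderD (V := V)) ?IH //; first exact: sF.
exact: smooth_on_sum.
Qed.

Lemma tderDv y v w f : tder mM y (v + w) f = tder mM y v f + tder mM y w f.
Proof.
rewrite /tder -big_split; apply: eq_bigr => i _ /=.
by rewrite mxE mulrDl.
Qed.

Lemma tderZv y a v f : tder mM y (a *: v) f = a * tder mM y v f.
Proof.
rewrite /tder mulr_sumr; apply: eq_bigr => i _ /=.
by rewrite mxE mulrA.
Qed.

Lemma tder0v y f : tder mM y 0 f = 0.
Proof. by rewrite -[0](scale0r 0) tderZv mul0r. Qed.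

Lemma tder_sumv y (I : Type) (r : seq I) (F : I -> 'rV[R]_n) f :
  tder mM y (\sum_(i <- r) F i) f = \sum_(i <- r) tder mM y (F i) f.
Proof.
elim: r => [|i r IH]; first by rewrite !big_nil tder0v.
by rewrite !big_cons tderDv IH.
Qed.

(** The coordinates of the chart at [y] are admissible test functions and return the components of
    the vector. Identities between fields can therefore be proved as identities between
    derivations. *)
Lemma tder_inj V y v w : open V -> V y ->
  (forall W f, open W -> W `<=` V -> W y -> smooth_on mM W f ->
     tder mM y v f = tder mM y w f) -> v = w.
Proof.
move=> oV Vy vw; apply/rowP => j; rewrite -!(tder_coord y).
apply: (vw (V `&` dom (chart_at mM y))).
- exact: openI oV (dom_open _).
- by move=> z [].
- by split=> //; exact: chart_atP.
- by apply: smooth_on_subset (smooth_on_coord j) => z [].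
Qed.

Lemma smooth_vf_subset V W X : W `<=` V -> smooth_vf mM V X -> smooth_vf mM W X.
Proof.
by move=> WV sX U f oU UW; apply: sX => // z /UW /WV.
Qed.

Lemma smooth_vf_eq V X Y : (forall y, V y -> X y = Y y) ->
  smooth_vf mM V X -> smooth_vf mM V Y.
Proof.
move=> XY sX W f oW WV sf; apply: smooth_on_eq oW _ (sX W f oW WV sf).
by move=> y /WV Vy; rewrite XY.
Qed.

Lemma smooth_vf_tder V X f : open V -> smooth_vf mM V X -> smooth_on mM V f ->
  smooth_on mM V (fun y => tder mM y (X y) f).
Proof. by move=> oV sX sf; exact: sX. Qed.

Lemma smooth_vfD V X Y : smooth_vf mM V X -> smooth_vf mM V Y ->
  smooth_vf mM V (fun y => X y + Y y).
Proof.
move=> sX sY W f oW WV sf; rewrite (eq_fun (fun y => tderDv y (X y) (Y y) f)).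
by apply: (smooth_onD oW); [exact: sX|exact: sY].
Qed.

Lemma smooth_vfZ V f X : smooth_on mM V f -> smooth_vf mM V X ->
  smooth_vf mM V (fun y => f y *: X y).
Proof.
move=> sf sX W g oW WV sg; rewrite (eq_fun (fun y => tderZv y (f y) (X y) g)).
by apply: (smooth_onM oW); [exact: smooth_on_subset sf|exact: sX].
Qed.

Lemma smooth_vf0 V : smooth_vf mM V (fun=> 0).
Proof.
by move=> W g oW WV sg; rewrite (eq_fun (fun y => tder0v y g)); exact: smooth_on_cst.
Qed.

Lemma smooth_vf_sum V (I : Type) (r : seq I) (F : I -> M -> 'rV[R]_n) :
  (forall i, smooth_vf mM V (F i)) ->
  smooth_vf mM V (fun x => \sum_(i <- r) F i x).
Proof.
move=> sF; elim: r => [|i r IH].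
  by apply: smooth_vf_eq (@smooth_vf0 V) => y _; rewrite big_nil.
by apply: smooth_vf_eq (smooth_vfD (sF i) IH) => y _; rewrite big_cons.
Qed.

Lemma tder_coord_vf c k y f : dom c y ->
  differentiable (fun a => f (param (chart_at mM y) a)) (coord (chart_at mM y) y) ->
  tder mM y (coord_vf c k y) f = partial k (fun a => f (param c a)) (coord c y).
Proof.
move=> cy df; set c' := chart_at mM y; have c'y : dom c' y := chart_atP mM y.
pose phi a := coord c' (param c a).
have phiy : phi (coord c y) = coord c' y by rewrite /phi coordK.
rewrite /tder; under eq_bigr do rewrite mxE.
transitivity (partial k ((fun a => f (param c' a)) \o phi) (coord c y)).
  by rewrite (@partial_comp _ _ _ phi (fun a => f (param c' a))) ?phiy // => j;
    exact: (smooth_on_differentiable (smooth_on_coord j) c'y cy).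
apply: near_eq_derive.
apply: filterS (near_param (dom_open c') c'y cy) => _ [z [c'z cz] ->] /=.
by rewrite /phi !coordK.
Qed.

Lemma smooth_on_partial W c k f : open W -> W `<=` dom c -> smooth_on mM W f ->
  smooth_on mM W (fun y => partial k (fun a => f (param c a)) (coord c y)).
Proof.
move=> oW Wc sf c'.
apply: (smooth_Rn_comp (phi := fun a => coord c (param c' a))
         _ _ _ (smooth_Rn_partial k (sf c))).
- exact: open_coord_image.
- by move=> _ [y [Wy c'y] <-]; exists y; rewrite ?coordK //; split=> //; exact: Wc.
- by move=> j; exact: (smooth_on_subset Wc (smooth_on_coord j)).
Qed.

Lemma smooth_coord_vf c k : smooth_vf mM (dom c) (coord_vf c k).
Proof.
move=> W f oW Wc sf; apply: smooth_on_eq (smooth_on_partial k oW Wc sf) => // y Wy.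
rewrite tder_coord_vf //; first exact: Wc.
exact: (smooth_on_differentiable sf Wy (chart_atP mM y)).
Qed.

(** [lie] only prescribes the derivatives of the coordinates of one chart. When [f] is written in
    these coordinates, the second partial derivatives of [f] are symmetric by [schwarz] and drop out
    of the commutator; the first-order terms are the components of [lie]. *)
Lemma tder_lie V X Y f y : open V -> V y ->
  smooth_vf mM V X -> smooth_vf mM V Y -> smooth_on mM V f ->
  tder mM y (lie mM X Y y) f = tder mM y (X y) (fun z => tder mM z (Y z) f)
                             - tder mM y (Y y) (fun z => tder mM z (X z) f).
Proof.
move=> oV Vy sX sY sf; set c := chart_at mM y; have cy : dom c y := chart_atP mM y.
pose W := V `&` dom c; have oW : open W by exact: openI oV (dom_open _).
have Wy : W y by [].
have WV : W `<=` V by move=> z [].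
have Wc : W `<=` dom c by move=> z [].
have sfW := smooth_on_subset WV sf.
pose d k z := partial k (fun a => f (param c a)) (coord c z).
have sd k : smooth_on mM W (d k) by exact: smooth_on_partial.
have sk k : smooth_on mM W (fun z => coord c z 0 k).
  exact: smooth_on_subset (smooth_on_coord k).
have expand Z z : W z -> smooth_vf mM V Z -> tder mM z (Z z) f =
    \sum_k tder mM z (Z z) (fun w => coord c w 0 k) * d k z.
  move=> Wz sZ; apply: tder_chart; first exact: Wc.
  exact: (smooth_on_differentiable sfW Wz (Wc _ Wz)).
have sZk Z k : smooth_vf mM V Z ->
    smooth_on mM W (fun z => tder mM z (Z z) (fun w => coord c w 0 k)).
  by move=> sZ; apply: sZ.
have twice Z1 Z2 : smooth_vf mM V Z1 -> smooth_vf mM V Z2 ->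
    tder mM y (Z1 y) (fun z => tder mM z (Z2 z) f) =
    \sum_k tder mM y (Z1 y) (fun z => tder mM z (Z2 z) (fun w => coord c w 0 k)) * d k y
    + \sum_k \sum_l Z2 y 0 k * Z1 y 0 l * partial l (partial k (fun a => f (param c a)))
      (coord c y).
  move=> s1 s2; rewrite (tder_eq _ oW Wy (fun z Wz => expand Z2 z Wz s2)).
  rewrite (tder_sum (V := W)) //; last by move=> k _; apply: (smooth_onM oW) => //; exact: sZk.
  rewrite -big_split; apply: eq_bigr => k _ /=.
  rewrite (tderM (V := W)) //; last exact: sZk.
  congr (_ + _).
  have -> : tder mM y (Z2 y) (fun w => coord c w 0 k) = Z2 y 0 k by exact: tder_coord.
  rewrite (tder_chart (c := c)) //; last exact: (smooth_on_differentiable (sd k)).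
  rewrite mulr_sumr; apply: eq_bigr => l _.
  have -> : tder mM y (Z1 y) (fun w => coord c w 0 l) = Z1 y 0 l by exact: tder_coord.
  have -> : partial l (fun a => d k (param c a)) (coord c y)
          = partial l (partial k (fun a => f (param c a))) (coord c y).
    apply: (@partial_eq _ _ (coord c @` (W `&` dom c))); first exact: open_coord_image.
      by move=> _ [z [Wz cz] <-]; rewrite /d coordK.
    by exists y.
  by rewrite mulrA.
rewrite !twice // opprD addrACA.
rewrite [X in _ = _ + (_ - X)]exchange_big /= [X in _ = _ + X](_ : _ = 0) ?addr0.
  rewrite -sumrB {1}/tder; apply: eq_bigr => k _.
  by rewrite mxE -/c mulrBl.
apply/eqP; rewrite subr_eq0; apply/eqP; apply: eq_bigr => k _; apply: eq_bigr => l _.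
have -> : partial l (partial k (fun a => f (param c a))) (coord c y)
        = partial k (partial l (fun a => f (param c a))) (coord c y).
  apply: (@schwarz _ _ (coord c @` (W `&` dom c))); first exact: open_coord_image.
    by exists y.
  exact: sfW.
by rewrite [X y 0 _ * _]mulrC.
Qed.

End Calculus.

(** * The Clifford algebra and the group Spin(n) *)

Section SymmetricDifference.
Context {T : finType}.
Implicit Types A B C : {set T}.

Definition symdiff A B : {set T} := ((A :\: B) :|: (B :\: A))%SET.

Lemma in_symdiff x A B : (x \in symdiff A B) = (x \in A) (+) (x \in B).
Proof. by rewrite !inE; case: (x \in A); case: (x \in B). Qed.

Lemma symdiffC A B : symdiff A B = symdiff B A.
Proof. by apply/setP => x; rewrite !in_symdiff addbC. Qed.

Lemma symdiffA A B C : symdiff A (symdiff B C) = symdiff (symdiff A B) C.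
Proof. by apply/setP => x; rewrite !in_symdiff addbA. Qed.

Lemma symdiff0 A : symdiff A finset.set0 = A.
Proof. by apply/setP => x; rewrite in_symdiff inE addbF. Qed.

Lemma symdiffxx A : symdiff A A = finset.set0.
Proof. by apply/setP => x; rewrite in_symdiff inE addbb. Qed.

Lemma symdiffK A : involutive (symdiff A).
Proof. by move=> B; rewrite symdiffA symdiffxx symdiffC symdiff0. Qed.

Lemma symdiff_eq A B C : (symdiff A B == C) = (B == symdiff A C).
Proof. by apply/eqP/eqP => [<-|->]; rewrite symdiffK. Qed.

Lemma odd_symdiff1 x A : odd #|symdiff [set x]%SET A| = ~~ odd #|A|.
Proof.
have [xA|xA] := boolP (x \in A).
  have -> : symdiff [set x]%SET A = (A :\ x)%SET.
    by apply/setP => y; rewrite in_symdiff !inE; case: eqP => [->|] //=; rewrite xA.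
  by rewrite (cardsD1 x A) xA /= negbK.
have -> : symdiff [set x]%SET A = (x |: A)%SET.
  by apply/setP => y; rewrite in_symdiff !inE; case: eqP => [->|] //=; rewrite (negPf xA).
by rewrite cardsU1 xA.
Qed.

End SymmetricDifference.

Section CliffordAlgebra.
Context {R : realType} {n : nat}.
Implicit Types (A B C S : {set 'I_n}) (a b c : cliff_alg R n) (u v w : 'rV[R]_n).
Local Notation sgn := (@cl_sign R n).

(** As a product over pairs the sign is visibly multiplicative in each argument with respect to
    symmetric difference. Associativity of [cl_mul] rests on this. *)
Lemma cl_signE A B : sgn A B =
  \prod_i \prod_j (-1) ^+ [&& i \in A, j \in B & (j <= i)%N].
Proof.
rewrite /cl_sign pair_big /= -expr_sum; congr (_ ^+ _).
rewrite -sum1_card big_mkcond /=; apply: eq_bigr => -[i j] _ /=.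
by case: ifPn => [/set_mem /= -> //|/negP H]; case: (boolP [&& _, _ & _]) => // /mem_set.
Qed.

Lemma cl_sign_symdiffl A A' B : sgn (symdiff A A') B = sgn A B * sgn A' B.
Proof.
rewrite !cl_signE -big_split; apply: eq_bigr => i _ /=.
rewrite -big_split; apply: eq_bigr => j _ /=; rewrite in_symdiff.
by case: (i \in A); case: (i \in A'); case: (j \in B); case: (j <= i)%N;
  rewrite /= ?expr0 ?expr1 ?mulr1 ?mul1r ?mulrNN ?mulr1.
Qed.

Lemma cl_sign_symdiffr A B B' : sgn A (symdiff B B') = sgn A B * sgn A B'.
Proof.
rewrite !cl_signE -big_split; apply: eq_bigr => i _ /=.
rewrite -big_split; apply: eq_bigr => j _ /=; rewrite in_symdiff.
by case: (i \in A); case: (j \in B); case: (j \in B'); case: (j <= i)%N;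
  rewrite /= ?expr0 ?expr1 ?mulr1 ?mul1r ?mulrNN ?mulr1.
Qed.

Lemma cl_sign0l B : sgn finset.set0 B = 1.
Proof.
by rewrite cl_signE big1 // => i _; rewrite big1 // => j _; rewrite inE.
Qed.

Lemma cl_sign0r A : sgn A finset.set0 = 1.
Proof.
by rewrite cl_signE big1 // => i _; rewrite big1 // => j _; rewrite inE andbF.
Qed.

Lemma cl_sign1l i B : sgn [set i]%SET B = \prod_(j in B) (-1) ^+ (j <= i)%N.
Proof.
rewrite cl_signE (bigD1 i) //= [X in _ * X]big1 ?mulr1 => [|k ki].
  rewrite [RHS]big_mkcond; apply: eq_bigr => j _; rewrite inE eqxx /=.
  by case: (j \in B).
by rewrite big1 // => j _; rewrite inE (negPf ki).
Qed.

Lemma cl_sign1r A j : sgn A [set j]%SET = \prod_(i in A) (-1) ^+ (j <= i)%N.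
Proof.
rewrite cl_signE [RHS]big_mkcond; apply: eq_bigr => i _.
rewrite (bigD1 j) //= [X in _ * X]big1 ?mulr1 => [|k kj].
  by rewrite inE eqxx; case: (i \in A).
by rewrite inE (negPf kj) andbF.
Qed.

Lemma cl_sign11 i : sgn [set i]%SET [set i]%SET = -1.
Proof. by rewrite cl_sign1l big_set1 leqnn. Qed.

Lemma cl_mulE a b S :
  cl_mul a b S = \sum_A sgn A (symdiff A S) * a A * b (symdiff A S).
Proof.
rewrite ffunE; apply: eq_bigr => A _.
by under eq_bigl => B do rewrite -/(symdiff A B) symdiff_eq; rewrite big_pred1_eq.
Qed.

Lemma cl_mulE_r a b S :
  cl_mul a b S = \sum_B sgn (symdiff B S) B * a (symdiff B S) * b B.
Proof.
rewrite cl_mulE (reindex_inj (inv_inj (symdiffK S))) /=; apply: eq_bigr => B _.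
have -> : symdiff (symdiff S B) S = B by rewrite symdiffC symdiffK.
by rewrite symdiffC.
Qed.

Lemma cl_mulA a b c : cl_mul a (cl_mul b c) = cl_mul (cl_mul a b) c.
Proof.
apply/ffunP => S; rewrite cl_mulE [RHS]cl_mulE.
under eq_bigr do rewrite cl_mulE mulr_sumr.
under [RHS]eq_bigr do rewrite cl_mulE mulr_sumr mulr_suml.
rewrite [RHS]exchange_big /=; apply: eq_bigr => A _.
(* The outer index on the right is that of the product of [a] and [b]; it is written as
   [symdiff A B], so that [B] indexes the factor [b], as on the left. *)
rewrite [RHS](reindex_inj (inv_inj (symdiffK A))) /=; apply: eq_bigr => B _.
rewrite symdiffK; set C := symdiff B (symdiff A S).
have -> : symdiff (symdiff A B) S = C.
  by rewrite /C symdiffA [symdiff B A]symdiffC.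
have -> : symdiff A S = symdiff B C by rewrite /C symdiffK.
by rewrite cl_sign_symdiffl cl_sign_symdiffr; ring.
Qed.

Lemma cl_mul1l a : cl_mul cl_one a = a.
Proof.
apply/ffunP => S; rewrite cl_mulE (bigD1 finset.set0) //= ffunE eqxx.
rewrite symdiffC symdiff0 cl_sign0l !mul1r big1 ?addr0 // => A A0.
by rewrite ffunE (negPf A0) mulr0 mul0r.
Qed.

Lemma cl_mul1r a : cl_mul a cl_one = a.
Proof.
apply/ffunP => S; rewrite cl_mulE_r (bigD1 finset.set0) //= ffunE eqxx.
rewrite symdiffC symdiff0 cl_sign0r mul1r mulr1 big1 ?addr0 // => A A0.
by rewrite ffunE (negPf A0) mulr0.
Qed.

Lemma cl_mulZl (x : R) a b : cl_mul (x *: a) b = x *: cl_mul a b.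
Proof.
apply/ffunP => S; rewrite [RHS]ffunE !cl_mulE scaler_sumr; apply: eq_bigr => A _.
by rewrite ffunE /GRing.scale /=; ring.
Qed.

Lemma cl_mulZr (x : R) a b : cl_mul a (x *: b) = x *: cl_mul a b.
Proof.
apply/ffunP => S; rewrite [RHS]ffunE !cl_mulE scaler_sumr; apply: eq_bigr => A _.
by rewrite ffunE /GRing.scale /=; ring.
Qed.

Lemma cl_mul_vecl u a S : cl_mul (cl_vec u) a S =
  \sum_i u 0 i * sgn [set i]%SET (symdiff [set i]%SET S) * a (symdiff [set i]%SET S).
Proof.
rewrite cl_mulE; under eq_bigr do rewrite ffunE mulr_sumr mulr_suml.
rewrite exchange_big /=; apply: eq_bigr => i _.
rewrite (bigD1 [set i]%SET) //= eqxx big1 ?addr0 => [|A Ai].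
  by rewrite mulr1 [_ * u 0 i]mulrC.
by rewrite (negPf Ai) mulr0 mulr0 mul0r.
Qed.

Lemma cl_mul_vecr u a S : cl_mul a (cl_vec u) S =
  \sum_i u 0 i * sgn (symdiff [set i]%SET S) [set i]%SET * a (symdiff [set i]%SET S).
Proof.
rewrite cl_mulE_r; under eq_bigr do rewrite ffunE mulr_sumr.
rewrite exchange_big /=; apply: eq_bigr => i _.
rewrite (bigD1 [set i]%SET) //= eqxx big1 ?addr0 => [|A Ai].
  by rewrite mulr1 mulrC mulrA.
by rewrite (negPf Ai) !mulr0.
Qed.

Lemma cl_mul_vec u v S : cl_mul (cl_vec u) (cl_vec v) S =
  \sum_i \sum_j u 0 i * v 0 j *
    (sgn [set i]%SET [set j]%SET * (S == symdiff [set i]%SET [set j]%SET)%:R).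
Proof.
rewrite cl_mul_vecl; apply: eq_bigr => i _; rewrite ffunE mulr_sumr.
apply: eq_bigr => j _; rewrite symdiff_eq.
by case: eqP => [->|_]; rewrite ?symdiffK ?mulr1 ?mulr0; ring.
Qed.

Lemma cl_sign11_anti i j : i != j ->
  sgn [set i]%SET [set j]%SET = - sgn [set j]%SET [set i]%SET.
Proof.
move=> ij; rewrite !cl_sign1l !big_set1; case: (ltngtP i j) => [||/val_inj/eqP].
- by move=> _; rewrite /= expr0 expr1 opprK.
- by move=> _; rewrite /= expr0 expr1.
- by rewrite (negPf ij).
Qed.

Lemma cl_vec_anticomm u v S : cl_mul (cl_vec u) (cl_vec v) S =
  - cl_mul (cl_vec v) (cl_vec u) S - 2 * (\sum_i u 0 i * v 0 i) * cl_one S.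
Proof.
have pair i j : sgn [set i]%SET [set j]%SET * (S == symdiff [set i]%SET [set j]%SET)%:R
    + sgn [set j]%SET [set i]%SET * (S == symdiff [set j]%SET [set i]%SET)%:R
    = (i == j)%:R * (- 2 * cl_one S).
  rewrite ffunE [symdiff [set j]%SET _]symdiffC -mulrDl.
  case: (eqVneq i j) => [->|ij]; rewrite ?cl_sign11.
    have -> : (-1 + -1 : R) = -2 by ring.
    by rewrite symdiffxx mul1r.
  by rewrite cl_sign11_anti // addNr !mul0r.
have sumE : cl_mul (cl_vec u) (cl_vec v) S + cl_mul (cl_vec v) (cl_vec u) S
    = - 2 * (\sum_i u 0 i * v 0 i) * cl_one S.
  rewrite !cl_mul_vec [X in _ + X]exchange_big -big_split /=.
  rewrite mulr_sumr mulr_suml; apply: eq_bigr => i _.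
  rewrite -big_split /=.
  under eq_bigr => j _ do rewrite [v 0 j * _]mulrC -mulrDr pair.
  rewrite (bigD1 i) //= eqxx big1 ?addr0 => [|j ji]; first by rewrite mul1r; ring.
  by rewrite eq_sym (negPf ji) mul0r mulr0.
by rewrite -[LHS](addrK (cl_mul (cl_vec v) (cl_vec u) S)) sumE; ring.
Qed.

Definition cl_prod (us : seq 'rV[R]_n) : cliff_alg R n :=
  foldr cl_mul cl_one (map cl_vec us).

Lemma cl_prod_cat us vs : cl_prod (us ++ vs) = cl_mul (cl_prod us) (cl_prod vs).
Proof.
by elim: us => [|u us IH]; rewrite /cl_prod /= ?cl_mul1l // -cl_mulA -IH.
Qed.

Definition unit_vectors (us : seq 'rV[R]_n) :=
  forall u, u \in us -> \sum_i u 0 i ^+ 2 = 1.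

Lemma cl_vec_sq u : \sum_i u 0 i ^+ 2 = 1 -> cl_mul (cl_vec u) (cl_vec u) = - cl_one.
Proof.
move=> u1; apply/ffunP => S; have := cl_vec_anticomm u u S.
under eq_bigr do rewrite -expr2.
rewrite u1 mulr1 => h; rewrite [RHS]ffunE; lra.
Qed.

(** Equal unit vectors meet in the middle and their square is [-1], from the inside outwards. For an
    even number of factors the reversed product is thus the inverse. *)
Lemma cl_prod_rev us : unit_vectors us ->
  cl_mul (cl_prod us) (cl_prod (rev us)) = (-1) ^+ size us *: cl_one.
Proof.
elim: us => [_|u us IH u1]; first by rewrite cl_mul1l scale1r.
have u1' : unit_vectors us by move=> v vus; apply: u1; rewrite inE vus orbT.
rewrite rev_cons -cats1 cl_prod_cat [cl_prod [:: u]]/cl_prod /= cl_mul1r.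
rewrite -/(cl_prod us) -cl_mulA [cl_mul (cl_prod us) _]cl_mulA IH //.
rewrite cl_mulZl cl_mul1l cl_mulZr cl_vec_sq; last by apply: u1; rewrite inE eqxx.
by rewrite exprS mulN1r scaleNr scalerN.
Qed.

Lemma is_spinP a : is_spin a <->
  exists us, [/\ ~~ odd (size us), unit_vectors us & a = cl_prod us].
Proof. by []. Qed.

Lemma is_spin_one : is_spin (cl_one : cliff_alg R n).
Proof. by exists [::]. Qed.

Lemma is_spin_mul a b : is_spin a -> is_spin b -> is_spin (cl_mul a b).
Proof.
move=> /is_spinP[us [ous u1 ->]] /is_spinP[vs [ovs v1 ->]].
apply/is_spinP; exists (us ++ vs); split; last by rewrite cl_prod_cat.
  by rewrite size_cat oddD (negPf ous) (negPf ovs).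
by move=> w; rewrite mem_cat => /orP[/u1|/v1].
Qed.

Lemma is_spin_inv a : is_spin a ->
  exists2 b, is_spin b & cl_mul a b = cl_one /\ cl_mul b a = cl_one.
Proof.
move=> /is_spinP[us [ous u1 ->]]; exists (cl_prod (rev us)).
  apply/is_spinP; exists (rev us); split=> //; first by rewrite size_rev.
  by move=> w; rewrite mem_rev; exact: u1.
have r1 : unit_vectors (rev us) by move=> w; rewrite mem_rev; exact: u1.
split; first by rewrite cl_prod_rev // -signr_odd (negPf ous) scale1r.
by have := cl_prod_rev r1; rewrite revK size_rev -signr_odd (negPf ous) scale1r.
Qed.

(** [-1] is the square of any unit vector, and a unit vector exists as soon as [n] is positive. *)
Lemma is_spin_opp a : (0 < n)%N -> is_spin a -> is_spin (- a).
Proof.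
move=> n0 sa; have -> : - a = cl_mul (- cl_one) a.
  by rewrite -(scaleN1r cl_one) cl_mulZl cl_mul1l scaleN1r.
apply: is_spin_mul => //; apply/is_spinP; pose u : 'rV[R]_n := delta_mx 0 (Ordinal n0).
have u1 : \sum_i u 0 i ^+ 2 = 1.
  rewrite (bigD1 (Ordinal n0)) //= big1 ?addr0 => [|i i0].
    by rewrite mxE !eqxx expr1n.
  by rewrite mxE (negPf i0) andbF expr0n.
exists [:: u; u]; split=> //; first by move=> w; rewrite !inE orbb => /eqP ->.
by rewrite /cl_prod /= cl_mul1r cl_vec_sq.
Qed.

Definition cl_dot a b : R := \sum_S a S * b S.

Lemma cl_dot_vecl u a b : cl_dot (cl_mul (cl_vec u) a) b = - cl_dot a (cl_mul (cl_vec u) b).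
Proof.
rewrite /cl_dot -sumrN; under eq_bigr do rewrite cl_mul_vecl mulr_suml.
under [RHS]eq_bigr do rewrite cl_mul_vecl mulr_sumr -sumrN.
rewrite exchange_big [RHS]exchange_big /=; apply: eq_bigr => i _.
rewrite (reindex_inj (inv_inj (symdiffK [set i]%SET))) /=; apply: eq_bigr => S _.
rewrite symdiffK cl_sign_symdiffr cl_sign11; ring.
Qed.

(** Left multiplication by a unit vector is skew for [cl_dot] and squares to [-1], hence preserves
    the norm. Constancy of the norm later forces the derivative of a spin curve at the unit to have
    no scalar part. *)
Lemma spin_norm a : is_spin a -> cl_dot a a = 1.
Proof.
move=> /is_spinP[us [_ u1 ->]]; elim: us u1 => [_|u us IH u1].
  rewrite /cl_dot (bigD1 finset.set0) //= ffunE eqxx mulr1 big1 ?addr0 // => S S0.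
  by rewrite ffunE (negPf S0) mulr0.
rewrite /cl_prod /= -/(cl_prod us) cl_dot_vecl cl_mulA cl_vec_sq; last first.
  by apply: u1; rewrite inE eqxx.
have -> : cl_mul (- cl_one) (cl_prod us) = - cl_prod us.
  by rewrite -(scaleN1r cl_one) cl_mulZl cl_mul1l scaleN1r.
rewrite -IH => [|v vus]; last by apply: u1; rewrite inE vus orbT.
rewrite /cl_dot -sumrN; apply: eq_bigr => S _; by rewrite ffunE mulrN opprK.
Qed.

Lemma cl_prod_parity us S : odd #|S| != odd (size us) -> cl_prod us S = 0.
Proof.
elim: us S => [|u us IH] S /= oS.
  by rewrite /cl_prod /= ffunE; case: eqP => // S0; rewrite S0 cards0 in oS.
rewrite /cl_prod /= -/(cl_prod us) cl_mul_vecl big1 // => i _.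
rewrite IH ?mulr0 // odd_symdiff1; by move: oS; case: (odd _); case: (odd _).
Qed.

Lemma spin_even a S : is_spin a -> odd #|S| -> a S = 0.
Proof.
move=> /is_spinP[us [ous _ ->]] oS; apply: cl_prod_parity.
by rewrite oS (negPf ous).
Qed.

(** The matrix is minus the reflection in the hyperplane orthogonal to [u]: it sends [v] to
    [2 <u, v> u - v], and the identity is the Clifford relation together with [u u = -1]. *)
Lemma cl_vec_conj u v : \sum_i u 0 i ^+ 2 = 1 ->
  cl_mul (cl_vec u) (cl_vec v)
  = cl_mul (cl_vec (v *m (2 *: (u^T *m u) - 1%:M))) (cl_vec u).
Proof.
move=> u1; have uv : v *m (2 *: (u^T *m u) - 1%:M)
    = (2 * \sum_i u 0 i * v 0 i) *: u - v.
  rewrite mulmxBr mulmx1 -scalemxAr mulmxA -scalerA; congr (_ *: _ - _).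
  rewrite [v *m u^T]mx11_scalar mul_scalar_mx; congr (_ *: _).
  by rewrite mxE; apply: eq_bigr => i _; rewrite mxE mulrC.
have vecE (x : R) S (w : cliff_alg R n) : cl_mul (cl_vec (x *: u - v)) w S
    = x * cl_mul (cl_vec u) w S - cl_mul (cl_vec v) w S.
  rewrite !cl_mul_vecl mulr_sumr -sumrB; apply: eq_bigr => i _.
  by rewrite !mxE; ring.
apply/ffunP => S; rewrite uv vecE cl_vec_sq // (cl_vec_anticomm u v) [(- _ : cliff_alg R
  n) S]ffunE.
ring.
Qed.

Lemma spin_conj a : is_spin a -> exists L : 'M[R]_n,
  forall v, cl_mul a (cl_vec v) = cl_mul (cl_vec (v *m L)) a.
Proof.
move=> /is_spinP[us [_ u1 ->]]; elim: us u1 => [_|u us IH u1].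
  by exists 1%:M => v; rewrite mulmx1 cl_mul1l cl_mul1r.
have [v vus|L LP] := IH; first by apply: u1; rewrite inE vus orbT.
exists (L *m (2 *: (u^T *m u) - 1%:M)) => v.
rewrite /cl_prod /= -/(cl_prod us) -cl_mulA LP cl_mulA cl_vec_conj.
  by rewrite -cl_mulA mulmxA.
by apply: u1; rewrite inE eqxx.
Qed.

Lemma lambdaP a : is_spin a -> forall j,
  cl_mul a (cl_vec (delta_mx 0 j)) = cl_mul (cl_vec (col j (lambda a))^T) a.
Proof.
move=> /spin_conj[L LP].
pose P := [set L : 'M[R]_n | forall j,
  cl_mul a (cl_vec (delta_mx 0 j)) = cl_mul (cl_vec (col j L)^T) a].
have PL : P L^T.
  by move=> j; rewrite LP -rowE tr_col trmxK.
exact: (@xgetPex _ 0 P (ex_intro P _ PL)).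
Qed.

Lemma cl_vec1 u i : cl_vec u [set i]%SET = u 0 i.
Proof.
rewrite ffunE (bigD1 i) //= eqxx mulr1 big1 ?addr0 // => j ji.
have /negPf-> : [set i]%SET != [set j]%SET :> {set 'I_n}.
  by apply: contra ji => /eqP/set1_inj ->.
by rewrite mulr0.
Qed.

(** [lambda] is a choice among the solutions of its defining relation; at the unit, the coefficients
    of the single generators show that the solution is unique. *)
Lemma lambda1 : lambda (cl_one : cliff_alg R n) = 1%:M.
Proof.
apply/matrixP => i j; have := lambdaP is_spin_one j.
rewrite cl_mul1l cl_mul1r => /ffunP/(_ [set i]%SET); rewrite !cl_vec1 !mxE eqxx => <-.
by rewrite /= eq_sym.
Qed.

Lemma symdiff1_min (T : {set 'I_n}) (m j : 'I_n) : m \in T ->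
  (forall i, i \in T -> (m <= i)%N) ->
  ((m < j)%N && (T == [set m; j]%SET)) = (symdiff T [set m]%SET == [set j]%SET).
Proof.
move=> mT mmin; apply/andP/eqP => [[mj /eqP->]|Tj].
  apply/setP => i; rewrite in_symdiff !inE.
  by case: (eqVneq i m) => [->|]; rewrite ?addbF //= -val_eqE /= (ltn_eqF mj).
have TE : T = symdiff [set m]%SET [set j]%SET by rewrite -Tj [symdiff T _]symdiffC symdiffK.
have mj : m != j.
  by apply: contraTneq mT => mj; rewrite TE -mj symdiffxx inE.
have jT : j \in T by rewrite TE in_symdiff !inE eqxx eq_sym (negPf mj).
split; first by rewrite ltn_neqAle mmin // andbT.
apply/eqP/setP => i; rewrite TE in_symdiff !inE.
by case: (eqVneq i m) => [->|]; rewrite ?(negPf mj) // orFb.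
Qed.

(* Read off the coefficient of [e_T] by commuting with the generator of least
   index in [T]: it anticommutes with [e_T] when [T] is even and nonempty. *)
Lemma even_commutator (a : cliff_alg R n) (L : 'M[R]_n) :
  a finset.set0 = 0 -> (forall S, odd #|S| -> a S = 0) ->
  (forall j T, (sgn T [set j]%SET - sgn [set j]%SET T) * a T
     = \sum_i L i j * (symdiff T [set j]%SET == [set i]%SET)%:R) ->
  forall T, a T = \sum_(i < n) \sum_(j < n | (i < j)%N)
                    (T == [set i; j]%SET)%:R * (2^-1 * L j i).
Proof.
move=> a0 aodd comm T.
have pair_card (i j : 'I_n) : (i < j)%N -> #|[set i; j]%SET| = 2.
  by move=> ij; rewrite cards2 -val_eqE /= (ltn_eqF ij).
have [oT|eT] := boolP (odd #|T|).
  rewrite aodd // big1 // => i _; rewrite big1 // => j ij.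
  by case: eqP => [TE|_]; rewrite ?mul0r // TE pair_card in oT *.
have [->|[i0 i0T]] := set_0Vmem T.
  rewrite a0 big1 // => i _; rewrite big1 // => j ij.
  by case: eqP => [TE|_]; rewrite ?mul0r //; have := pair_card _ _ ij; rewrite -TE cards0.
case: (arg_minnP (fun i : 'I_n => val i) i0T) => m mT mmin.
have := comm m T.
(* As [m] is the least element of [T], the sign of [e_T e_m] counts all elements of [T], an even
   number, while that of [e_m e_T] counts [m] alone. The commutator with [e_m] thus doubles the
   coefficient [a T]. *)
have -> : sgn T [set m]%SET = 1.
  rewrite cl_sign1r (eq_bigr (fun=> -1)) => [|i iT]; last by rewrite mmin // expr1.
  by rewrite prodr_const -signr_odd (negPf eT).
have -> : sgn [set m]%SET T = -1.
  rewrite cl_sign1l (bigD1 m) //= leqnn big1 ?mulr1 // => j /andP[jT jm].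
  by rewrite leqNgt ltn_neqAle mmin // andbT eq_sym val_eqE jm.
move=> aT.
have {}aT : a T = 2^-1 * \sum_i L i m * (symdiff T [set m]%SET == [set i]%SET)%:R.
  by rewrite -aT; field.
have zero (i : 'I_n) : i != m -> \sum_(j < n | (i < j)%N)
    (T == [set i; j]%SET)%:R * (2^-1 * L j i) = 0.
  move=> im; rewrite big1 // => j ij; case: eqP => [TE|_]; rewrite ?mul0r //.
  have iT : i \in T by rewrite TE set21.
  have : m \in [set i; j]%SET by rewrite -TE.
  case/set2P => [mi|mj]; first by rewrite mi eqxx in im.
  by have := mmin i iT; rewrite mj leqNgt ij.
rewrite aT [RHS](bigD1 m) //= [X in _ = _ + X](_ : _ = 0) ?addr0; last exact: big1.
rewrite mulr_sumr [RHS]big_mkcond; apply: eq_bigr => j _.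
rewrite -symdiff1_min //; case: ifP => mj /=; last by rewrite !mulr0.
by case: (T == _); rewrite ?mulr1 ?mulr0 ?mul0r ?mul1r.
Qed.

Variable gam : 'I_n -> 'M[R[i]]_(spinor_dim n).

Lemma kappa1 : kappa gam cl_one = 1%:M.
Proof.
rewrite /kappa (bigD1 finset.set0) //= ffunE eqxx enum_set0 /= scale1r.
by rewrite big1 ?addr0 // => S S0; rewrite ffunE (negPf S0) scale0r.
Qed.

(** [kappa] multiplies the generators in the order of [enum]; this order has to be the increasing
    one for [e_i e_j] with [i < j] to act by [gam i] after [gam j]. *)
Lemma enum_pair (i j : 'I_n) : (i < j)%N -> enum [set i; j]%SET = [:: i; j].
Proof.
move=> ij; pose lt_ord (k l : 'I_n) := (k < l)%N.
have lt_trans : transitive lt_ord by move=> k l m; exact: ltn_trans.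
have lt_irr : irreflexive lt_ord by move=> k; exact: ltnn.
apply: (irr_sorted_eq lt_trans lt_irr); last by move=> k; rewrite mem_enum !inE.
  rewrite /enum_mem; apply: sorted_filter => //.
  have := iota_ltn_sorted 0 n; rewrite -val_enum_ord sorted_map enumT.
  by [].
by rewrite /= /lt_ord ij.
Qed.

Lemma kappa_pairs (a : cliff_alg R n) (c : 'I_n -> 'I_n -> R) :
  (forall T, a T = \sum_(i < n) \sum_(j < n | (i < j)%N) (T == [set i; j]%SET)%:R * c i j) ->
  kappa gam a = \sum_(i < n) \sum_(j < n | (i < j)%N) (c i j)%:C *: (gam i *m gam j).
Proof.
move=> aE; rewrite /kappa.
under eq_bigr => S _ do rewrite aE raddf_sum scaler_suml.
rewrite exchange_big /=; apply: eq_bigr => i _.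
under eq_bigr => S _ do rewrite raddf_sum scaler_suml.
rewrite exchange_big /=; apply: eq_bigr => j ij.
rewrite (bigD1 [set i; j]%SET) //= eqxx mul1r enum_pair //= mulmx1.
rewrite big1 ?addr0 // => S /negPf->; by rewrite mul0r scale0r.
Qed.

End CliffordAlgebra.

(** * Gamma matrices *)

Section GammaAlgebra.
Context {C : numFieldType} {n N : nat}.
Variable gam : 'I_n -> 'M[C]_N.
Hypothesis gamP : forall i j, gam i *m gam j + gam j *m gam i
  = if i == j then (- 2%:R)%:M else 0.

Lemma gam_swap i j : gam j *m gam i = - (gam i *m gam j) - (2 * (i == j)%:R)%:M.
Proof.
apply: (@addrI _ (gam i *m gam j)); rewrite gamP addrA subrr sub0r.
by case: eqP => _; rewrite ?mulr1 ?mulr0 ?raddf0 ?oppr0 // raddfN.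
Qed.

Lemma sum_delta (V : lmodType C) (F : 'I_n -> V) k :
  \sum_i (i == k)%:R *: F i = F k.
Proof.
rewrite (bigD1 k) //= eqxx scale1r big1 ?addr0 // => i /negPf->.
by rewrite scale0r.
Qed.

(** The sum is averaged with its copy in which [i] and [j] are exchanged; reordering the generators
    in the copy costs the diagonal and leaves a difference. With second covariant derivatives for
    [X], the diagonal leads to the Laplacian and the difference to the curvature. *)
Lemma gam_antisym_sum q (X : 'I_n -> 'I_n -> 'M[C]_(N, q)) :
  \sum_i \sum_j gam i *m gam j *m X i j
  = - \sum_i X i i + 2^-1 *: \sum_i \sum_j gam i *m gam j *m (X i j - X j i).
Proof.
set S := LHS.
have SE : S = - \sum_i \sum_j gam i *m gam j *m X j i - 2 *: \sum_i X i i.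
  rewrite /S exchange_big /= -sumrN scaler_sumr -sumrB; apply: eq_bigr => i _.
  have -> : \sum_j gam j *m gam i *m X j i
      = \sum_j (- (gam i *m gam j *m X j i) - (j == i)%:R *: (2 *: X j i)).
    apply: eq_bigr => j _; rewrite gam_swap mulmxDl mulNmx; congr (_ + _).
    by rewrite mulNmx mul_scalar_mx scalerA mulrC eq_sym.
  by rewrite big_split /= sumrN [X in _ + X]sumrN sum_delta.
have diffE : \sum_i \sum_j gam i *m gam j *m (X i j - X j i)
    = S - \sum_i \sum_j gam i *m gam j *m X j i.
  rewrite /S -sumrB; apply: eq_bigr => i _; rewrite -sumrB; apply: eq_bigr => j _.
  by rewrite mulmxBr.
transitivity (2^-1 *: (S + S)).
  by rewrite -mulr2n -[S *+ 2]scaler_nat scalerA mulVf ?scale1r // pnatr_eq0.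
by rewrite {2}SE addrA -diffE scalerBr scalerA mulVf ?pnatr_eq0 // scale1r addrC.
Qed.

Lemma gam_sym_sum (S : 'I_n -> 'I_n -> C) : (forall i j, S i j = S j i) ->
  \sum_i \sum_j S i j *: (gam i *m gam j) = (- \sum_i S i i)%:M.
Proof.
move=> symS; have := gam_antisym_sum (fun i j => (S i j)%:M).
under eq_bigr do under eq_bigr do rewrite mul_mx_scalar.
move=> ->; rewrite [X in _ + X](_ : _ = 0) ?addr0.
  by rewrite [RHS]raddfN /= [X in _ = - X]raddf_sum.
rewrite big1 ?scaler0 // => i _; rewrite big1 // => j _.
by rewrite symS subrr mulmx0.
Qed.

(** For antisymmetric [G] this is the action of an element of so(n) on spinors: [1/4] over all
    ordered pairs equals the usual [1/2] over [a < b]. The full sum is preferred because it can be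
    reindexed freely. *)
Definition spin_form (G : 'I_n -> 'I_n -> C) : 'M[C]_N :=
  4^-1 *: \sum_a \sum_b G a b *: (gam a *m gam b).

Lemma gam_pair_comm a b k : gam a *m gam b *m gam k - gam k *m (gam a *m gam b)
  = (b == b)%:R *: ((a == k)%:R *: (2 *: gam b)) - (b == k)%:R *: (2 *: gam a).
Proof.
rewrite eqxx scale1r -mulmxA (gam_swap k b) mulmxBr mulmxN (mulmxA _ (gam k)).
rewrite (gam_swap k a) mulmxBl mulNmx.
rewrite opprB mul_mx_scalar mul_scalar_mx [gam k *m (_ *m _)]mulmxA !scalerA.
rewrite [2 * (k == b)%:R]mulrC [2 * (k == a)%:R]mulrC [k == b]eq_sym [k == a]eq_sym.
by apply/matrixP => u v; rewrite !mxE; ring.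
Qed.

(** A product [gam a gam b] commutes with [gam k] when neither index is [k], so only row and column
    [k] of [G] remain, and they agree by antisymmetry. This infinitesimal equivariance is what makes
    Clifford multiplication parallel. *)
Lemma spin_form_comm G k : (forall a b, G b a = - G a b) ->
  spin_form G *m gam k - gam k *m spin_form G = \sum_l G k l *: gam l.
Proof.
move=> aG; rewrite /spin_form -scalemxAl -scalemxAr -scalerBr.
rewrite mulmx_suml mulmx_sumr -sumrB.
have inner a : (\sum_b G a b *: (gam a *m gam b)) *m gam k
     - gam k *m (\sum_b G a b *: (gam a *m gam b))
   = (a == k)%:R *: (2 *: \sum_b G k b *: gam b) - (2 * G a k) *: gam a.
  rewrite mulmx_suml mulmx_sumr -sumrB.
  transitivity (\sum_b ((a == k)%:R *: (2 *: (G k b *: gam b))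
      - (b == k)%:R *: ((2 * G a b) *: gam a))).
    apply: eq_bigr => b _; rewrite -scalemxAl -scalemxAr -scalerBr gam_pair_comm.
    rewrite eqxx scale1r; apply/matrixP => u v; rewrite !mxE.
    by case: (eqVneq a k) => [->|_]; rewrite ?mul1r ?mul0r ?mulr0; ring.
  by rewrite sumrB sum_delta -!scaler_sumr.
rewrite (eq_bigr _ (fun a _ => inner a)) sumrB sum_delta.
have -> : \sum_a (2 * G a k) *: gam a = - (2 *: \sum_b G k b *: gam b).
  rewrite scaler_sumr -sumrN; apply: eq_bigr => a _.
  by rewrite aG mulrN scaleNr scalerA.
by rewrite opprK -scalerDl scalerA -natrD mulVf ?scale1r // pnatr_eq0.
Qed.

(** Commutation with [spin_form G] is a derivation, so [spin_form_comm] applies to each factor of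
    [gam k gam l]. By antisymmetry of [G], the coefficients on the right are those of the matrix
    commutator of [G'] and [G], in this order. *)
Lemma spin_form_bracket G G' : (forall a b, G b a = - G a b) ->
  spin_form G *m spin_form G' - spin_form G' *m spin_form G
  = spin_form (fun k l => \sum_m (G' m l * G m k + G' k m * G m l)).
Proof.
move=> aG; have comm_scale c (U A : 'M[C]_N) : U *m (c *: A) - (c *: A) *m U = c *: (U *m
  A - A *m U).
  by rewrite -scalemxAl -scalemxAr -scalerBr.
apply: (etrans (comm_scale _ _ _)); rewrite [RHS]/spin_form; congr (_ *: _).
have prod k l : spin_form G *m (gam k *m gam l) - gam k *m gam l *m spin_form G
    = \sum_m (G k m *: (gam m *m gam l)) + \sum_m (G l m *: (gam k *m gam m)).
  have -> : spin_form G *m (gam k *m gam l) - gam k *m gam l *m spin_form G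
    = (spin_form G *m gam k - gam k *m spin_form G) *m gam l
      + gam k *m (spin_form G *m gam l - gam l *m spin_form G).
    by rewrite mulmxBl mulmxBr !mulmxA addrA subrK.
  rewrite !spin_form_comm // mulmx_suml mulmx_sumr; congr (_ + _).
    by apply: eq_bigr => m _; rewrite scalemxAl.
  by apply: eq_bigr => m _; rewrite scalemxAr.
transitivity (\sum_k \sum_l (\sum_m (G' k l * G k m) *: (gam m *m gam l)
   + \sum_m (G' k l * G l m) *: (gam k *m gam m))).
  rewrite mulmx_sumr mulmx_suml -sumrB; apply: eq_bigr => k _.
  rewrite mulmx_sumr mulmx_suml -sumrB; apply: eq_bigr => l _.
  rewrite -scalemxAr -scalemxAl -scalerBr prod scalerDr !scaler_sumr.
  by congr (_ + _); apply: eq_bigr => m _; rewrite scalerA.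
transitivity (\sum_k \sum_l (\sum_m (G' m l * G m k) *: (gam k *m gam l)
   + \sum_m (G' k m * G m l) *: (gam k *m gam l))); last first.
  apply: eq_bigr => k _; apply: eq_bigr => l _; rewrite -!scaler_suml -scalerDl.
  by rewrite big_split.
under eq_bigr do rewrite big_split /=.
under [RHS]eq_bigr do rewrite big_split /=.
rewrite !big_split /=; congr (_ + _).
  under eq_bigr do rewrite exchange_big /=.
  rewrite exchange_big /=; apply: eq_bigr => k _.
  by rewrite exchange_big.
by apply: eq_bigr => k _; rewrite exchange_big.
Qed.

(** Rotating the three generators back into the order [i], [j], [k] costs contraction terms. With
    [S] the sum and [Z] the right-hand side, the two rotations give [S = S' + 2 Z] and
    [S = S'' + Z], where [S'] and [S''] carry the rotated coefficients; the cyclic identity says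
    [S + S' + S'' = 0], hence [3 S = 3 Z]. *)
Lemma cyclic_triple (T : 'I_n -> 'I_n -> 'I_n -> C) :
  (forall i j k, T j i k = - T i j k) ->
  (forall i j k, T i j k + T j k i + T k i j = 0) ->
  \sum_i \sum_j \sum_k T i j k *: (gam i *m gam j *m gam k)
  = 2 *: \sum_b (\sum_a T a b a) *: gam b.
Proof.
move=> antiT cycT; pose g3 i j k := gam i *m gam j *m gam k.
pose Q b := \sum_a T a b a.
have rot1 i j k : g3 j k i
    = g3 i j k + (j == i)%:R *: (2 *: gam k) - (k == i)%:R *: (2 *: gam j).
  rewrite /g3 -(mulmxA (gam j) (gam k)) (gam_swap i k) mulmxBr mulmxN (mulmxA _ (gam i))
    (gam_swap i j) mulmxBl mulNmx.
  rewrite mul_mx_scalar mul_scalar_mx [i == j]eq_sym [i == k]eq_sym !scalerA.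
  by apply/matrixP => u v; rewrite !mxE; ring.
have rot2 i j k : g3 k i j
    = g3 i j k + (k == j)%:R *: (2 *: gam i) - (k == i)%:R *: (2 *: gam j).
  rewrite /g3 (gam_swap i k) mulmxBl mulNmx -(mulmxA (gam i) (gam k)) (gam_swap j k)
    mulmxBr mulmxN (mulmxA _ (gam j)).
  rewrite mul_mx_scalar mul_scalar_mx [i == k]eq_sym [j == k]eq_sym !scalerA.
  by apply/matrixP => u v; rewrite !mxE; ring.
pose S (F : 'I_n -> 'I_n -> 'I_n -> 'M[C]_N) : 'M[C]_N :=
  \sum_i \sum_j \sum_k F i j k.
have S_rot F : S (fun i j k => F j k i) = S F.
  by rewrite /S exchange_big /=; apply: eq_bigr => j _; rewrite exchange_big.
have SD F H : S (fun i j k => F i j k + H i j k) = S F + S H.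
  rewrite /S -big_split; apply: eq_bigr => i _; rewrite -big_split.
  by apply: eq_bigr => j _; rewrite -big_split.
have S_eq F H : (forall i j k, F i j k = H i j k) -> S F = S H.
  by move=> FH; apply: eq_bigr => i _; apply: eq_bigr => j _; apply: eq_bigr.
pose Z := 2 *: \sum_b Q b *: gam b.
pose G i j k := T i j k *: g3 i j k.
have ZE : \sum_i \sum_b T i b i *: (2 *: gam b) = Z.
  rewrite /Z scaler_sumr exchange_big /=; apply: eq_bigr => b _.
  by rewrite /Q scaler_suml scaler_sumr; apply: eq_bigr => a _; rewrite !scalerA mulrC.
have diag F : S (fun i j k => (j == i)%:R *: F i j k) = \sum_i \sum_k F i i k.
  apply: eq_bigr => i _; rewrite -[RHS](sum_delta (fun j => \sum_k F i j k)).
  by apply: eq_bigr => j _; rewrite scaler_sumr.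
have diag' F : S (fun i j k => (k == i)%:R *: F i j k) = \sum_i \sum_j F i j i.
  by apply: eq_bigr => i _; apply: eq_bigr => j _; rewrite sum_delta.
have diag2 F : S (fun i j k => (k == j)%:R *: F i j k) = \sum_i \sum_j F i j j.
  by apply: eq_bigr => i _; apply: eq_bigr => j _; rewrite sum_delta.
have S1 : S G = S (fun i j k => T j k i *: g3 i j k) + Z + Z.
  rewrite -S_rot (S_eq _ (fun i j k => T j k i *: g3 i j k
      + (j == i)%:R *: (T j k i *: (2 *: gam k))
      + (k == i)%:R *: (- T j k i *: (2 *: gam j)))).
    rewrite !SD diag diag'; congr (_ + _ + _); first exact: ZE.
    by rewrite -ZE; apply: eq_bigr => i _; apply: eq_bigr => b _; rewrite antiT opprK.
  move=> i j k; rewrite /G rot1; apply/matrixP => u v; rewrite !mxE; ring.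
have S2 : S G = S (fun i j k => T k i j *: g3 i j k) + Z.
  rewrite -S_rot -S_rot (S_eq _ (fun i j k => T k i j *: g3 i j k
      + (k == j)%:R *: (T k i j *: (2 *: gam i))
      + (k == i)%:R *: (- T k i j *: (2 *: gam j)))).
    rewrite !SD diag2 diag' -[RHS]addr0; congr (_ + _ + _).
      by rewrite exchange_big /= -ZE.
    rewrite big1 // => i _; rewrite big1 // => j _.
    have -> : T i i j = 0.
      by have := antiT i i j => /eqP; rewrite -addr_eq0 -mulr2n mulrn_eq0 => /eqP.
    by rewrite oppr0 scale0r.
  move=> i j k; rewrite /G rot2; apply/matrixP => u v; rewrite !mxE; ring.
have S3 : S G + S (fun i j k => T j k i *: g3 i j k) + S (fun i j k => T k i j *: g3 i j
  k) = 0.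
  rewrite -!SD /S big1 // => i _; rewrite big1 // => j _; rewrite big1 // => k _.
  by rewrite -!scalerDl cycT scale0r.
have S3Z : S G *+ 3 = Z *+ 3.
  have sum3 (a b c z : 'M[C]_N) : a = b + z + z -> a = c + z -> a + b + c = 0 ->
      a *+ 3 = z *+ 3.
    move=> ab ac abc; have -> : a *+ 3 = a + (b + z + z) + (c + z).
      by rewrite -ab -ac !mulrS mulr0n addr0 addrA.
    have -> : a + (b + z + z) + (c + z) = a + b + c + z *+ 3.
      by apply/matrixP => u v; rewrite !mxE; ring.
    by rewrite abc add0r.
  exact: sum3 S1 S2 S3.
have third (w : 'M[C]_N) : 3^-1 *: (w *+ 3) = w.
  by rewrite -[w *+ 3]scaler_nat scalerA mulVf ?scale1r // pnatr_eq0.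
by change (S G = Z); rewrite -[LHS]third S3Z third.
Qed.

(** With the last index frozen, [cyclic_triple] reduces three generators to one and leaves a
    quadratic expression in the generators whose coefficients form the Ricci contraction. Pair
    symmetry makes this contraction symmetric, so only its trace survives. *)
Lemma lichnerowicz_contraction (T : 'I_n -> 'I_n -> 'I_n -> 'I_n -> C) :
  (forall i j k l, T j i k l = - T i j k l) ->
  (forall i j k l, T i j l k = - T i j k l) ->
  (forall i j k l, T i j k l + T j k i l + T k i j l = 0) ->
  (forall i j k l, T i j k l = T k l i j) ->
  \sum_i \sum_j gam i *m gam j *m (\sum_k \sum_l T i j k l *: (gam k *m gam l))
  = (2 * \sum_i \sum_j T i j j i)%:M.
Proof.
move=> a12 a34 cyc pair.
transitivity (\sum_l (\sum_i \sum_j \sum_k T i j k l *: (gam i *m gam j *m gam k)) *m gam l).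
  under [RHS]eq_bigr => l _ do rewrite mulmx_suml.
  rewrite [RHS]exchange_big /=; apply: eq_bigr => i _.
  under [RHS]eq_bigr => l _ do rewrite mulmx_suml.
  rewrite [RHS]exchange_big /=; apply: eq_bigr => j _.
  rewrite mulmx_sumr; under [RHS]eq_bigr => l _ do rewrite mulmx_suml.
  rewrite [RHS]exchange_big /=; apply: eq_bigr => k _.
  rewrite mulmx_sumr; apply: eq_bigr => l _.
  by rewrite -scalemxAr -scalemxAl !mulmxA.
have cycE l := cyclic_triple (T := fun i j k => T i j k l)
  (fun i j k => a12 i j k l) (fun i j k => cyc i j k l).
under eq_bigr => l _ do rewrite cycE -scalemxAl mulmx_suml.
rewrite -scaler_sumr exchange_big /=.
under eq_bigr => b _ do under eq_bigr => l _ do rewrite -scalemxAl.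
rewrite (gam_sym_sum (S := fun b l => \sum_a T a b a l)) => [|b l]; last first.
  by apply: eq_bigr => a _; rewrite pair.
rewrite scale_scalar_mx; congr (_ * _)%:M; rewrite -sumrN exchange_big /=.
rewrite [RHS]exchange_big /=; apply: eq_bigr => b _.
by rewrite -sumrN; apply: eq_bigr => a _; rewrite a34 opprK.
Qed.

End GammaAlgebra.

(** * The Levi-Civita connection *)

#[local] Opaque partial tder smooth_on.

Section LieBracket.
Context {R : realType} {n : nat} {M : topologicalType}.
Context {mM : oriented_manifold R n M}.
Variable V : set M.
Hypothesis oV : open V.
Implicit Types (X Y Z : M -> 'rV[R]_n) (f : M -> R).

Lemma lie_anti X Y x : lie mM X Y x = - lie mM Y X x.
Proof. by apply/rowP => j; rewrite !mxE opprB. Qed.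

Lemma lie_eq X X' Y Y' x : V x -> (forall y, V y -> X y = X' y) ->
  (forall y, V y -> Y y = Y' y) -> lie mM X Y x = lie mM X' Y' x.
Proof.
move=> Vx XX YY; apply/rowP => j; rewrite !mxE (XX x Vx) (YY x Vx).
have eqD v Z Z' : (forall y, V y -> Z y = Z' y) ->
    tder mM x v (fun y => tder mM y (Z y) (fun z => coord (chart_at mM x) z 0 j))
    = tder mM x v (fun y => tder mM y (Z' y) (fun z => coord (chart_at mM x) z 0 j)).
  by move=> ZZ; apply: (tder_eq _ oV Vx) => y Vy; rewrite ZZ.
by rewrite (eqD _ _ _ XX) (eqD _ _ _ YY).
Qed.

(** Derivations separate vectors, so a bracket can be identified by the commutator alone; the rules
    for sums and multiples then become identities between scalars. *)
Lemma lieP X Y x u : V x -> smooth_vf mM V X -> smooth_vf mM V Y ->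
  (forall W f, open W -> W `<=` V -> W x -> smooth_on mM W f ->
     tder mM x (X x) (fun z => tder mM z (Y z) f)
     - tder mM x (Y x) (fun z => tder mM z (X z) f) = tder mM x u f) ->
  lie mM X Y x = u.
Proof.
move=> Vx sX sY uP; apply: (@tder_inj _ _ _ mM _ _ _ _ oV Vx) => W f oW WV Wx sf.
rewrite (tder_lie oW Wx (smooth_vf_subset WV sX) (smooth_vf_subset WV sY) sf).
exact: (uP W f oW WV Wx sf).
Qed.

Lemma lieDr X Y Z x : V x -> smooth_vf mM V X -> smooth_vf mM V Y ->
  smooth_vf mM V Z ->
  lie mM X (fun y => Y y + Z y) x = lie mM X Y x + lie mM X Z x.
Proof.
move=> Vx sX sY sZ; apply: lieP => // [|W f oW WV Wx sf].
  exact: smooth_vfD.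
have [sX' sY' sZ'] : [/\ smooth_vf mM W X, smooth_vf mM W Y & smooth_vf mM W Z].
  by split; apply: (smooth_vf_subset WV).
rewrite [RHS]tderDv (tder_lie oW Wx sX' sY' sf) (tder_lie oW Wx sX' sZ' sf).
rewrite (eq_fun (fun z => tderDv z (Y z) (Z z) f)).
rewrite (tderD _ (sY' W f oW _ sf) (sZ' W f oW _ sf)) // tderDv.
ring.
Qed.

Lemma lieZr X Y f x : V x -> smooth_vf mM V X -> smooth_vf mM V Y ->
  smooth_on mM V f ->
  lie mM X (fun y => f y *: Y y) x = f x *: lie mM X Y x + tder mM x (X x) f *: Y x.
Proof.
move=> Vx sX sY sf; apply: lieP => // [|W h oW WV Wx sh].
  exact: smooth_vfZ.
have [sX' sY'] : smooth_vf mM W X /\ smooth_vf mM W Y.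
  by split; apply: (smooth_vf_subset WV).
have sf' := smooth_on_subset WV sf.
rewrite [RHS]tderDv !tderZv (tder_lie oW Wx sX' sY' sh).
rewrite (eq_fun (fun z => tderZv z (f z) (Y z) h)).
rewrite (tderM _ sf' (sY' W h oW _ sh)) //.
ring.
Qed.

Lemma smooth_lie X Y : smooth_vf mM V X -> smooth_vf mM V Y ->
  smooth_vf mM V (lie mM X Y).
Proof.
move=> sX sY W f oW WV sf.
have [sX' sY'] : smooth_vf mM W X /\ smooth_vf mM W Y.
  by split; apply: (smooth_vf_subset WV).
apply: (@smooth_on_eq _ _ _ mM W (fun y => tder mM y (X y) (fun z => tder mM z (Y z) f)
                             - tder mM y (Y y) (fun z => tder mM z (X z) f))) => //.
  by move=> y Wy; rewrite (tder_lie oW).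
by apply: (smooth_onB oW); do 2 (apply: smooth_vf_tder => //).
Qed.

(** On a function each double bracket becomes four threefold derivatives, and the twelve that result
    cancel in pairs. *)
Lemma lie_jacobi X Y Z x : V x -> smooth_vf mM V X -> smooth_vf mM V Y ->
  smooth_vf mM V Z ->
  lie mM X (lie mM Y Z) x + lie mM Y (lie mM Z X) x + lie mM Z (lie mM X Y) x = 0.
Proof.
move=> Vx sX sY sZ; apply: (@tder_inj _ _ _ mM _ _ _ _ oV Vx) => W f oW WV Wx sf.
have [sX' sY' sZ'] : [/\ smooth_vf mM W X, smooth_vf mM W Y & smooth_vf mM W Z].
  by split; apply: (smooth_vf_subset WV).
have nested A B C : smooth_vf mM W A -> smooth_vf mM W B -> smooth_vf mM W C ->
    (forall D E, smooth_vf mM V D -> smooth_vf mM V E -> smooth_vf mM W (lie mM D E)) ->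
    smooth_vf mM W (lie mM B C) ->
    tder mM x (lie mM A (lie mM B C) x) f =
    tder mM x (A x) (fun y => tder mM y (B y) (fun z => tder mM z (C z) f))
    - tder mM x (A x) (fun y => tder mM y (C y) (fun z => tder mM z (B z) f))
    - tder mM x (B x) (fun y => tder mM y (C y) (fun z => tder mM z (A z) f))
    + tder mM x (C x) (fun y => tder mM y (B y) (fun z => tder mM z (A z) f)).
  move=> sA sB sC _ sBC; have WW := @subset_refl _ W.
  rewrite (tder_lie oW Wx sA sBC sf).
  rewrite (tder_eq _ oW Wx (fun y Wy => tder_lie oW Wy sB sC sf)).
  rewrite (tderB _ oW (sB W _ oW WW (sC W f oW WW sf)) (sC W _ oW WW (sB W f oW WW sf)) Wx).
  rewrite (tder_lie oW Wx sB sC (sA W f oW (@subset_refl _ W) sf)).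
  have regroup (a b c d : R) : a - b - (c - d) = a - b - c + d by ring.
  exact: regroup.
have sl A B : smooth_vf mM V A -> smooth_vf mM V B -> smooth_vf mM W (lie mM A B).
  by move=> sA sB; apply: (smooth_vf_subset WV); exact: smooth_lie.
have cancel6 (a b c d e k : R) :
  a - b - c + d + (c - e - k + b) + (k - d - a + e) = 0 by ring.
rewrite !tderDv tder0v (nested X Y Z) ?(nested Y Z X) ?(nested Z X Y) //; try exact: sl.
Qed.

End LieBracket.

(** * The metric, tensoriality and the Koszul form *)

Section Metric.
Context {R : realType} {n : nat} {M : topologicalType}.
Context {mM : oriented_manifold R n M}.
Variable g : riemannian_metric mM.
Local Notation ip y u v := (inner (gram g) y u v).

Lemma innerC y u v : ip y u v = ip y v u.
Proof.
have -> : ip y u v = ((u *m gram g y *m v^T)^T) 0 0 by rewrite mxE.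
by rewrite /inner !trmx_mul trmxK gram_sym mulmxA.
Qed.

Lemma innerDl y u v w : ip y (u + v) w = ip y u w + ip y v w.
Proof. by rewrite /inner !mulmxDl mxE. Qed.

Lemma innerZl y a u v : ip y (a *: u) v = a * ip y u v.
Proof. by rewrite /inner -!scalemxAl mxE. Qed.

Lemma innerDr y u v w : ip y w (u + v) = ip y w u + ip y w v.
Proof. by rewrite !(innerC y w) innerDl. Qed.

Lemma innerZr y a u v : ip y v (a *: u) = a * ip y v u.
Proof. by rewrite !(innerC y v) innerZl. Qed.

Lemma inner0l y v : ip y 0 v = 0.
Proof. by rewrite -[0](scale0r 0) innerZl mul0r. Qed.

Lemma innerNl y u v : ip y (- u) v = - ip y u v.
Proof. by rewrite -scaleN1r innerZl mulN1r. Qed.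

Lemma innerBl y u v w : ip y (u - v) w = ip y u w - ip y v w.
Proof. by rewrite innerDl innerNl. Qed.

Lemma inner_suml y (I : Type) (r : seq I) (F : I -> 'rV[R]_n) v :
  ip y (\sum_(i <- r) F i) v = \sum_(i <- r) ip y (F i) v.
Proof.
elim: r => [|i r IH]; first by rewrite !big_nil inner0l.
by rewrite !big_cons innerDl IH.
Qed.

Lemma inner_sumr y (I : Type) (r : seq I) (F : I -> 'rV[R]_n) v :
  ip y v (\sum_(i <- r) F i) = \sum_(i <- r) ip y v (F i).
Proof. by rewrite innerC inner_suml; apply: eq_bigr => i _; rewrite innerC. Qed.

Lemma gram_unit y : gram g y \in unitmx.
Proof.
rewrite -row_free_unit; apply: inj_row_free => v vG0; apply/eqP.
apply: contraT => /(@gram_posdef _ _ _ _ g y).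
by rewrite /inner vG0 mul0mx mxE ltxx.
Qed.

Lemma inner_delta y u k : ip y u (delta_mx 0 k) = (u *m gram g y) 0 k.
Proof. by rewrite /inner trmx_delta -colE mxE. Qed.

Lemma inner_inj y u w : (forall k, ip y u (delta_mx 0 k) = ip y w (delta_mx 0 k)) ->
  u = w.
Proof.
move=> uw; apply: (can_inj (mulmxK (gram_unit y))).
by apply/rowP => k; rewrite -!inner_delta.
Qed.

(** Linearity over functions, evaluated at one point, for fields that are meaningful on [V] only.
    Its use is the expansion of the argument in a local frame, which shows that [T X] depends on
    [X x] alone; the target is any module so that scalar and vector expressions are both covered. *)
Record tensorial (V : set M) (x : M) (W : lmodType R)
    (T : (M -> 'rV[R]_n) -> W) : Prop := Tensorial {
  tensorial_eq : forall X Y, (forall y, V y -> X y = Y y) -> T X = T Y;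
  tensorialD : forall X Y, smooth_vf mM V X -> smooth_vf mM V Y ->
    T (fun y => X y + Y y) = T X + T Y;
  tensorialZ : forall X f, smooth_vf mM V X -> smooth_on mM V f ->
    T (fun y => f y *: X y) = f x *: T X }.

Lemma tensorial_sum V x (W : lmodType R) (T : (M -> 'rV[R]_n) -> W)
    (I : Type) (r : seq I) (f : I -> M -> R) (E : I -> M -> 'rV[R]_n) :
  tensorial V x T -> (forall i, smooth_on mM V (f i)) ->
  (forall i, smooth_vf mM V (E i)) ->
  T (fun y => \sum_(i <- r) f i y *: E i y) = \sum_(i <- r) f i x *: T (E i).
Proof.
move=> tT sf sE; elim: r => [|i r IH].
  rewrite big_nil.
  (* The empty sum is presented as the zero multiple of the zero field, so that homogeneity yields
     [T 0 = 0]. *)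
  rewrite (tensorial_eq tT (Y := fun y => 0 *: 0)); last first.
    by move=> y _; rewrite big_nil scale0r.
  rewrite (tensorialZ tT (X := fun=> 0) (f := fun=> 0)) ?scale0r //.
    exact: smooth_vf0.
  exact: smooth_on_cst.
rewrite big_cons -IH -(tensorialZ tT) // -(tensorialD tT).
- by apply: (tensorial_eq tT) => y _; rewrite big_cons.
- exact: smooth_vfZ.
- by apply: smooth_vf_sum => j; exact: smooth_vfZ.
Qed.

(** Together with [koszul_metric], this gives the two defining properties of the Levi-Civita
    connection in weak form: both are cancellations among the six terms, by symmetry of the metric
    and antisymmetry of the bracket. *)
Lemma koszul_torsion X Y Z x : koszul g X Y Z x - koszul g Y X Z x
  = ip x (lie mM X Y x) (Z x).
Proof.
rewrite /koszul (lie_anti Y X) innerNl.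
have -> : (fun y => ip y (Y y) (X y)) = (fun y => ip y (X y) (Y y)).
  by apply/funext => y; exact: innerC.
by field.
Qed.

Lemma koszul_metric X Y Z x : koszul g X Y Z x + koszul g X Z Y x
  = tder mM x (X x) (fun y => ip y (Y y) (Z y)).
Proof.
rewrite /koszul (lie_anti Z Y) innerNl.
have -> : (fun y => ip y (Z y) (Y y)) = (fun y => ip y (Y y) (Z y)).
  by apply/funext => y; exact: innerC.
by field.
Qed.

(* [koszul] is [h * (a + b - c + l - m - k)]; additivity in the shape produced
   by additivity of each term. *)
Fact koszul_sumE (h a a' b b' c c' l l' m m' k k' : R) :
  h * ((a + a') + (b + b') - (c + c') + (l + l') - (m + m') - (k + k'))
  = h * (a + b - c + l - m - k) + h * (a' + b' - c' + l' - m' - k').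
Proof. ring. Qed.

Section Open.
Variable V : set M.
Hypothesis oV : open V.

Lemma smooth_inner X Y : smooth_vf mM V X -> smooth_vf mM V Y ->
  smooth_on mM V (fun y => ip y (X y) (Y y)).
Proof. exact: gram_smooth. Qed.

Lemma koszul_eq X X' Y Y' Z Z' x : V x -> (forall y, V y -> X y = X' y) ->
  (forall y, V y -> Y y = Y' y) -> (forall y, V y -> Z y = Z' y) ->
  koszul g X Y Z x = koszul g X' Y' Z' x.
Proof.
move=> Vx XX YY ZZ; rewrite /koszul.
rewrite (lie_eq oV Vx XX YY) (lie_eq oV Vx XX ZZ) (lie_eq oV Vx YY ZZ).
have eqI v A A' B B' : (forall y, V y -> A y = A' y) ->
    (forall y, V y -> B y = B' y) ->
    tder mM x v (fun y => ip y (A y) (B y)) = tder mM x v (fun y => ip y (A' y) (B' y)).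
  by move=> AA BB; apply: (tder_eq _ oV Vx) => y Vy; rewrite AA ?BB.
rewrite (eqI _ _ _ _ _ YY ZZ) (eqI _ _ _ _ _ XX ZZ) (eqI _ _ _ _ _ XX YY).
by rewrite (XX x Vx) (YY x Vx) (ZZ x Vx).
Qed.

Lemma smooth_koszul X Y Z : smooth_vf mM V X -> smooth_vf mM V Y ->
  smooth_vf mM V Z -> smooth_on mM V (koszul g X Y Z).
Proof.
move=> sX sY sZ; have sL A B C : smooth_vf mM V A -> smooth_vf mM V B ->
    smooth_vf mM V C -> smooth_on mM V (fun y => ip y (lie mM A B y) (C y)).
  by move=> sA sB sC; apply: smooth_inner => //; exact: smooth_lie.
have sT A B C : smooth_vf mM V A -> smooth_vf mM V B ->
    smooth_vf mM V C -> smooth_on mM V (fun y => tder mM y (A y) (fun y => ip y (B y) (C y))).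
  by move=> sA sB sC; apply: smooth_vf_tder => //; exact: smooth_inner.
apply: (smooth_onZ _ oV).
apply: (smooth_onB oV); last exact: sL.
apply: (smooth_onB oV); last exact: sL.
apply: (smooth_onD oV); last exact: sL.
apply: (smooth_onB oV); last exact: sT.
by apply: (smooth_onD oV); exact: sT.
Qed.

(** The derivatives of [f] produced by the metric terms cancel those produced by the brackets.
    Without this, the vector [nabla X Y x], which is tested on coordinate fields only, would not
    represent the Koszul form on other fields. *)
Lemma koszul_tensorial_r X Y x : V x -> smooth_vf mM V X -> smooth_vf mM V Y ->
  tensorial V x (fun Z => koszul g X Y Z x : R^o).
Proof.
move=> Vx sX sY; split=> [Z Z' ZZ|Z Z' sZ sZ'|Z f sZ sf].
- exact: koszul_eq.
- rewrite /koszul !(lieDr oV Vx) // !innerDr !innerDl tderDv.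
  rewrite (eq_fun (fun y => innerDr y (Z y) (Z' y) (Y y))).
  rewrite (eq_fun (fun y => innerDr y (Z y) (Z' y) (X y))).
  rewrite !(tderD (V := V)) //; do ?exact: smooth_inner.
  exact: koszul_sumE.
- rewrite /koszul !(lieZr oV Vx) // !innerZr !innerDl !innerZl tderZv.
  rewrite (eq_fun (fun y => innerZr y (f y) (Z y) (Y y))).
  rewrite (eq_fun (fun y => innerZr y (f y) (Z y) (X y))).
  rewrite !(tderM (V := V)) //; do ?exact: smooth_inner.
  rewrite (innerC x (Z x) (Y x)) (innerC x (Z x) (X x)) /GRing.scale /=.
  by ring.
Qed.

End Open.
End Metric.

Arguments tensorial {R n M} mM V x {W} T.

(** * The Levi-Civita connection as the vector representing the Koszul form *)

Section LeviCivita.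
Context {R : realType} {n : nat} {M : topologicalType}.
Context {mM : oriented_manifold R n M}.
Variable g : riemannian_metric mM.
Local Notation ip y u v := (inner (gram g) y u v).
Variable V : set M.
Hypothesis oV : open V.
Implicit Types (X Y Z : M -> 'rV[R]_n) (f : M -> R).

Lemma lieDl X Y Z x : V x -> smooth_vf mM V X -> smooth_vf mM V Y ->
  smooth_vf mM V Z ->
  lie mM (fun y => X y + Y y) Z x = lie mM X Z x + lie mM Y Z x.
Proof.
by move=> Vx sX sY sZ; rewrite lie_anti (lieDr oV Vx sZ sX sY) opprD -!lie_anti.
Qed.

Lemma lieZl X Y f x : V x -> smooth_vf mM V X -> smooth_vf mM V Y ->
  smooth_on mM V f ->
  lie mM (fun y => f y *: X y) Y x = f x *: lie mM X Y x - tder mM x (Y x) f *: X x.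
Proof.
move=> Vx sX sY sf; rewrite lie_anti (lieZr oV Vx sY sX sf) opprD.
by rewrite -scalerN -lie_anti.
Qed.

Lemma koszul_tensorial_l Y Z x : V x -> smooth_vf mM V Y -> smooth_vf mM V Z ->
  tensorial mM V x (fun X => koszul g X Y Z x : R^o).
Proof.
move=> Vx sY sZ; split=> [X X' XX|X X' sX sX'|X f sX sf].
- exact: (koszul_eq g oV Vx XX).
- have [sXZ sXY] : smooth_on mM V (fun y => ip y (X y) (Z y)) /\
      smooth_on mM V (fun y => ip y (X y) (Y y)) by split; exact: smooth_inner.
  have [sXZ' sXY'] : smooth_on mM V (fun y => ip y (X' y) (Z y)) /\
      smooth_on mM V (fun y => ip y (X' y) (Y y)) by split; exact: smooth_inner.
  rewrite /koszul !(lieDl Vx sX sX') // !innerDr !innerDl tderDv.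
  rewrite (eq_fun (fun y => innerDl g y (X y) (X' y) (Y y))).
  rewrite (eq_fun (fun y => innerDl g y (X y) (X' y) (Z y))).
  rewrite (tderD _ sXZ sXZ' Vx) (tderD _ sXY sXY' Vx).
  exact: koszul_sumE.
- have [sXZ sXY] : smooth_on mM V (fun y => ip y (X y) (Z y)) /\
      smooth_on mM V (fun y => ip y (X y) (Y y)) by split; exact: smooth_inner.
  rewrite /koszul !(lieZl Vx sX _ sf) // !innerZr !innerBl !innerZl tderZv.
  rewrite (eq_fun (fun y => innerZl g y (f y) (X y) (Y y))).
  rewrite (eq_fun (fun y => innerZl g y (f y) (X y) (Z y))).
  rewrite (tderM _ sf sXZ Vx) (tderM _ sf sXY Vx) /GRing.scale /=.
  by ring.
Qed.

(** By [koszul_torsion] the middle argument can be moved to the first place at the cost of a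
    bracket; there [koszul_tensorial_l] applies. [koszulZm] follows the same way. *)
Lemma koszulDm X Y Z U x : V x -> smooth_vf mM V X -> smooth_vf mM V Y ->
  smooth_vf mM V Z -> smooth_vf mM V U ->
  koszul g X (fun y => Y y + Z y) U x = koszul g X Y U x + koszul g X Z U x.
Proof.
move=> Vx sX sY sZ sU.
have flip A : koszul g X A U x = koszul g A X U x + ip x (lie mM X A x) (U x).
  by rewrite -koszul_torsion addrC subrK.
rewrite !flip (lieDr oV Vx sX sY sZ) innerDl.
rewrite (tensorialD (koszul_tensorial_l Vx sX sU) sY sZ).
by rewrite addrACA.
Qed.

Lemma koszulZm X Y U f x : V x -> smooth_vf mM V X -> smooth_vf mM V Y ->
  smooth_on mM V f -> smooth_vf mM V U ->
  koszul g X (fun y => f y *: Y y) U x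
  = f x * koszul g X Y U x + tder mM x (X x) f * ip x (Y x) (U x).
Proof.
move=> Vx sX sY sf sU.
have flip A : koszul g X A U x = koszul g A X U x + ip x (lie mM X A x) (U x).
  by rewrite -koszul_torsion addrC subrK.
rewrite !flip (lieZr oV Vx sX sY sf) innerDl !innerZl.
rewrite (tensorialZ (koszul_tensorial_l Vx sX sU) sY sf) /GRing.scale /=.
by rewrite mulrDr addrA.
Qed.

Lemma coord_vf_at x k : coord_vf (chart_at mM x) k x = delta_mx 0 k.
Proof.
apply/rowP => j; have -> : coord_vf (chart_at mM x) k x 0 j
    = tder mM x (coord_vf (chart_at mM x) k x) (fun z => coord (chart_at mM x) z 0 j).
  by rewrite tder_coord.
have cx := chart_atP mM x.
have dc := smooth_on_differentiable (smooth_on_coord (mM := mM) j) cx cx.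
rewrite tder_coord_vf // mxE eqxx /= -(partial_coord k j (coord (chart_at mM x) x)).
apply: (@partial_eq _ _ (coord (chart_at mM x) @` (setT `&` dom (chart_at mM x)))).
- exact/open_coord_image/openT.
- by move=> _ [z [_ cz] <-]; rewrite coordK.
- by exists x.
Qed.

Lemma coord_vf_expand (c : chart mM) X y : V y -> dom c y -> smooth_vf mM V X ->
  X y = \sum_k tder mM y (X y) (fun z => coord c z 0 k) *: coord_vf c k y.
Proof.
move=> Vy cy sX; apply: (@tder_inj _ _ _ mM _ _ _ _ oV Vy) => W f oW WV Wy sf.
rewrite tder_sumv (tder_chart _ cy (smooth_on_differentiable sf Wy cy)).
apply: eq_bigr => k _; rewrite tderZv tder_coord_vf //.
exact: (smooth_on_differentiable sf Wy (chart_atP mM y)).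
Qed.

Lemma inner_nabla_coord X Y x k :
  ip x (nabla g X Y x) (delta_mx 0 k) = koszul g X Y (coord_vf (chart_at mM x) k) x.
Proof. by rewrite inner_delta /nabla mulmxKV ?gram_unit // mxE. Qed.

(** The definition of [nabla] imposes this for the coordinate fields of the chart at [x]; any smooth
    [Z] is a combination of these with smooth coefficients near [x], and both sides are tensorial in
    [Z]. *)
Lemma inner_nabla X Y Z x : V x -> smooth_vf mM V X -> smooth_vf mM V Y ->
  smooth_vf mM V Z -> ip x (nabla g X Y x) (Z x) = koszul g X Y Z x.
Proof.
move=> Vx sX sY sZ; set c := chart_at mM x; have cx := chart_atP mM x.
pose W := V `&` dom c; have oW : open W by exact: openI oV (dom_open _).
have Wx : W x by [].
have WV : W `<=` V by move=> z [].
have Wc : W `<=` dom c by move=> z [].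
have sX' := smooth_vf_subset WV sX; have sY' := smooth_vf_subset WV sY.
pose z k y := tder mM y (Z y) (fun z => coord c z 0 k).
have sz k : smooth_on mM W (z k).
  apply: (smooth_vf_tder oW (smooth_vf_subset WV sZ)).
  exact: smooth_on_subset Wc (smooth_on_coord k).
have sd k : smooth_vf mM W (coord_vf c k).
  exact: smooth_vf_subset Wc (smooth_coord_vf (c := c) k).
have tK := koszul_tensorial_r g oW Wx sX' sY'.
have ZE y : W y -> Z y = \sum_k z k y *: coord_vf c k y.
  by move=> [Vy cy]; exact: coord_vf_expand.
rewrite (tensorial_eq tK ZE) (tensorial_sum _ tK sz sd) {1}(ZE x Wx) inner_sumr.
by apply: eq_bigr => k _; rewrite innerZr -inner_nabla_coord coord_vf_at.
Qed.

Lemma nablaP X Y x u : V x -> smooth_vf mM V X -> smooth_vf mM V Y ->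
  (forall Z W, open W -> W `<=` V -> W x -> smooth_vf mM W Z ->
     koszul g X Y Z x = ip x u (Z x)) ->
  nabla g X Y x = u.
Proof.
move=> Vx sX sY uP; apply: (inner_inj (g := g) (y := x)) => k.
rewrite inner_nabla_coord -(coord_vf_at x k); set c := chart_at mM x.
apply: (uP _ (V `&` dom c)).
- exact: openI oV (dom_open _).
- by move=> z [].
- by split=> //; exact: chart_atP.
- by apply: smooth_vf_subset (smooth_coord_vf k) => z [].
Qed.

Lemma nabla_eq X X' Y Y' x : V x -> (forall y, V y -> X y = X' y) ->
  (forall y, V y -> Y y = Y' y) -> nabla g X Y x = nabla g X' Y' x.
Proof.
move=> Vx XX YY; apply: (inner_inj (g := g) (y := x)) => k.
by rewrite !inner_nabla_coord; exact: (koszul_eq g oV Vx XX YY).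
Qed.

End LeviCivita.

Section LeviCivitaRules.
Context {R : realType} {n : nat} {M : topologicalType}.
Context {mM : oriented_manifold R n M}.
Variable g : riemannian_metric mM.
Local Notation ip y u v := (inner (gram g) y u v).
Variable V : set M.
Hypothesis oV : open V.
Implicit Types (X Y Z : M -> 'rV[R]_n) (f : M -> R).

Lemma nabla_tensorial Y x : V x -> smooth_vf mM V Y ->
  tensorial mM V x (fun X => nabla g X Y x).
Proof.
move=> Vx sY; split=> [X X' XX|X X' sX sX'|X f sX sf].
- exact: (nabla_eq g oV Vx XX).
- apply: (nablaP oV Vx) => // [|Z W oW WV Wx sZ]; first exact: smooth_vfD.
  have s := fun X => @smooth_vf_subset _ _ _ mM _ _ X WV.
  rewrite (tensorialD (koszul_tensorial_l g oW Wx (s _ sY) sZ) (s _ sX) (s _ sX')).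
  rewrite innerDl (inner_nabla g oW Wx (s _ sX) (s _ sY) sZ).
  by rewrite (inner_nabla g oW Wx (s _ sX') (s _ sY) sZ).
- apply: (nablaP oV Vx) => // [|Z W oW WV Wx sZ]; first exact: smooth_vfZ.
  have s := fun X => @smooth_vf_subset _ _ _ mM _ _ X WV.
  have sf' := smooth_on_subset WV sf.
  rewrite (tensorialZ (koszul_tensorial_l g oW Wx (s _ sY) sZ) (s _ sX) sf').
  by rewrite innerZl (inner_nabla g oW Wx (s _ sX) (s _ sY) sZ).
Qed.

Lemma nablaDr X Y Z x : V x -> smooth_vf mM V X -> smooth_vf mM V Y ->
  smooth_vf mM V Z ->
  nabla g X (fun y => Y y + Z y) x = nabla g X Y x + nabla g X Z x.
Proof.
move=> Vx sX sY sZ; apply: (nablaP oV Vx) => // [|U W oW WV Wx sU].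
  exact: smooth_vfD.
have s := fun X => @smooth_vf_subset _ _ _ mM _ _ X WV.
rewrite (koszulDm g oW Wx (s _ sX) (s _ sY) (s _ sZ) sU).
rewrite innerDl.
apply: (f_equal2 +%R (esym (inner_nabla g oW Wx (s _ sX) (s _ sY) sU))).
exact: (esym (inner_nabla g oW Wx (s _ sX) (s _ sZ) sU)).
Qed.

Lemma nablaZr X Y f x : V x -> smooth_vf mM V X -> smooth_vf mM V Y ->
  smooth_on mM V f ->
  nabla g X (fun y => f y *: Y y) x = f x *: nabla g X Y x + tder mM x (X x) f *: Y x.
Proof.
move=> Vx sX sY sf; apply: (nablaP oV Vx) => // [|U W oW WV Wx sU].
  exact: smooth_vfZ.
have s := fun X => @smooth_vf_subset _ _ _ mM _ _ X WV.
rewrite (koszulZm g oW Wx (s _ sX) (s _ sY) (smooth_on_subset WV sf) sU).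
by rewrite innerDl !innerZl (inner_nabla g oW Wx (s _ sX) (s _ sY) sU).
Qed.

Lemma nabla_torsion X Y x : V x -> smooth_vf mM V X -> smooth_vf mM V Y ->
  nabla g X Y x - nabla g Y X x = lie mM X Y x.
Proof.
move=> Vx sX sY; apply: (inner_inj (g := g) (y := x)) => k.
by rewrite innerBl !inner_nabla_coord koszul_torsion coord_vf_at.
Qed.

Lemma nabla_sumr X x (I : Type) (r : seq I) (f : I -> M -> R)
    (E : I -> M -> 'rV[R]_n) :
  V x -> smooth_vf mM V X -> (forall i, smooth_on mM V (f i)) ->
  (forall i, smooth_vf mM V (E i)) ->
  nabla g X (fun y => \sum_(i <- r) f i y *: E i y) x
  = \sum_(i <- r) (f i x *: nabla g X (E i) x + tder mM x (X x) (f i) *: E i x).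
Proof.
move=> Vx sX sf sE; elim: r => [|i r IH].
  rewrite big_nil (nabla_eq (X' := X) (Y' := fun y => 0 *: X y) g oV Vx) //.
    rewrite (nablaZr Vx sX sX (@smooth_on_cst _ _ _ mM V 0)).
    by rewrite tder_cst !scale0r addr0.
  by move=> y _; rewrite big_nil scale0r.
have sr : smooth_vf mM V (fun y => \sum_(i <- r) f i y *: E i y).
  by apply: smooth_vf_sum => j; exact: smooth_vfZ.
rewrite big_cons -IH -(nablaZr Vx sX (sE i) (sf i)).
rewrite -(nablaDr Vx sX (smooth_vfZ (sf i) (sE i)) sr).
by apply: (nabla_eq g oV Vx) => // y _; rewrite big_cons.
Qed.

End LeviCivitaRules.

(** * Curvature of a torsion-free connection given by its rules *)

Definition curv (V : zmodType) (M : Type) (nab L : (M -> V) -> (M -> V) -> M -> V)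
    X Y Z x : V :=
  nab X (nab Y Z) x - nab Y (nab X Z) x - nab (L X Y) Z x.

(* The connection and the bracket are abstract here, so that unification never
   unfolds the Koszul formula. *)
Section AbstractConnection.
Context {R : realType} {n : nat} {M : topologicalType}.
Context {mM : oriented_manifold R n M}.
Variable V : set M.
Hypothesis oV : open V.
Local Notation field := (M -> 'rV[R]_n).
Local Notation smooth := (smooth_vf mM V).
Variables nab L : field -> field -> field.
Hypothesis nab_eq : forall X X' Y Y' x, V x -> (forall y, V y -> X y = X' y) ->
  (forall y, V y -> Y y = Y' y) -> nab X Y x = nab X' Y' x.
Hypothesis nabDl : forall X X' Y x, V x -> smooth X -> smooth X' -> smooth Y ->
  nab (fun y => X y + X' y) Y x = nab X Y x + nab X' Y x.
Hypothesis nabZl : forall X Y f x, V x -> smooth X -> smooth Y ->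
  smooth_on mM V f -> nab (fun y => f y *: X y) Y x = f x *: nab X Y x.
Hypothesis nabDr : forall X Y Y' x, V x -> smooth X -> smooth Y -> smooth Y' ->
  nab X (fun y => Y y + Y' y) x = nab X Y x + nab X Y' x.
Hypothesis nabZr : forall X Y f x, V x -> smooth X -> smooth Y ->
  smooth_on mM V f ->
  nab X (fun y => f y *: Y y) x = f x *: nab X Y x + tder mM x (X x) f *: Y x.
Hypothesis nab_torsion : forall X Y x, V x -> smooth X -> smooth Y ->
  nab X Y x - nab Y X x = L X Y x.
Hypothesis smooth_nab : forall X Y, smooth X -> smooth Y -> smooth (nab X Y).
Hypothesis L_eq : forall X X' Y Y' x, V x -> (forall y, V y -> X y = X' y) ->
  (forall y, V y -> Y y = Y' y) -> L X Y x = L X' Y' x.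
Hypothesis L_anti : forall X Y x, L X Y x = - L Y X x.
Hypothesis LDl : forall X Y Z x, V x -> smooth X -> smooth Y -> smooth Z ->
  L (fun y => X y + Y y) Z x = L X Z x + L Y Z x.
Hypothesis LZl : forall X Y f x, V x -> smooth X -> smooth Y ->
  smooth_on mM V f ->
  L (fun y => f y *: X y) Y x = f x *: L X Y x - tder mM x (Y x) f *: X x.
Hypothesis smooth_L : forall X Y, smooth X -> smooth Y -> smooth (L X Y).
Hypothesis L_jacobi : forall X Y Z x, V x -> smooth X -> smooth Y -> smooth Z ->
  L X (L Y Z) x + L Y (L Z X) x + L Z (L X Y) x = 0.
Hypothesis tder_L : forall X Y f x, V x -> smooth X -> smooth Y ->
  smooth_on mM V f ->
  tder mM x (L X Y x) f = tder mM x (X x) (fun z => tder mM z (Y z) f)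
                        - tder mM x (Y x) (fun z => tder mM z (X z) f).

Local Notation curv := (curv nab L).

Lemma curv_anti X Y Z x : V x -> smooth X -> smooth Y -> smooth Z ->
  curv X Y Z x = - curv Y X Z x.
Proof.
move=> Vx sX sY sZ; rewrite /curv.
have LE y : V y -> L X Y y = (- 1) *: L Y X y by rewrite L_anti scaleN1r.
rewrite (nab_eq Vx LE (fun y _ => erefl (Z y))).
rewrite (nabZl Vx (smooth_L sY sX) sZ (@smooth_on_cst _ _ _ mM V (-1))).
by apply/rowP => j; rewrite !mxE; ring.
Qed.

(** The derivative of [f] along [Y] occurs twice, from [nab Y] applied to [f *: nab X Z] and from
    the bracket of [f *: X] with [Y]; the two contributions are opposite. *)
Lemma curv_tensorial_l Y Z x : V x -> smooth Y -> smooth Z ->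
  tensorial mM V x (fun X => curv X Y Z x).
Proof.
move=> Vx sY sZ; split=> [X X' XX|X X' sX sX'|X f sX sf]; rewrite /curv.
- have nabE y : V y -> nab X Z y = nab X' Z y by move=> Vy; exact: nab_eq.
  have LE y : V y -> L X Y y = L X' Y y by move=> Vy; exact: L_eq.
  by congr (_ - _ - _); exact: nab_eq.
- have sum6 (a b c a' b' c' : 'rV[R]_n) :
      (a + a') - (b + b') - (c + c') = (a - b - c) + (a' - b' - c').
    by apply/rowP => j; rewrite !mxE; ring.
  have nabE y : V y -> nab (fun y => X y + X' y) Z y = nab X Z y + nab X' Z y.
    by move=> Vy; exact: nabDl.
  have LE y : V y -> L (fun y => X y + X' y) Y y = L X Y y + L X' Y y.
    by move=> Vy; exact: LDl.
  rewrite (nabDl Vx sX sX' (smooth_nab sY sZ)).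
  rewrite (nab_eq Vx (fun y _ => erefl (Y y)) nabE).
  rewrite (nabDr Vx sY (smooth_nab sX sZ) (smooth_nab sX' sZ)).
  rewrite (nab_eq Vx LE (fun y _ => erefl (Z y))).
  by rewrite (nabDl Vx (smooth_L sX sY) (smooth_L sX' sY) sZ) sum6.
- have sYf : smooth_on mM V (fun y => - tder mM y (Y y) f).
    by apply: (smooth_onN oV); exact: smooth_vf_tder.
  have nabE y : V y -> nab (fun y => f y *: X y) Z y = f y *: nab X Z y.
    by move=> Vy; exact: nabZl.
  have LE y : V y -> L (fun y => f y *: X y) Y y
      = f y *: L X Y y + (- tder mM y (Y y) f) *: X y.
    by move=> Vy; rewrite LZl // scaleNr.
  rewrite (nabZl Vx sX (smooth_nab sY sZ) sf).
  rewrite (nab_eq Vx (fun y _ => erefl (Y y)) nabE).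
  rewrite (nabZr Vx sY (smooth_nab sX sZ) sf).
  rewrite (nab_eq Vx LE (fun y _ => erefl (Z y))).
  rewrite (nabDl Vx (smooth_vfZ sf (smooth_L sX sY)) (smooth_vfZ sYf sX) sZ).
  rewrite (nabZl Vx (smooth_L sX sY) sZ sf) (nabZl Vx sX sZ sYf).
  by apply/rowP => j; rewrite !mxE; ring.
Qed.

Lemma curv_tensorial_m X Z x : V x -> smooth X -> smooth Z ->
  tensorial mM V x (fun Y => curv X Y Z x).
Proof.
move=> Vx sX sZ; have tl := curv_tensorial_l Vx sX sZ.
split=> [Y Y' YY|Y Y' sY sY'|Y f sY sf].
- rewrite /curv; have nabE y : V y -> nab Y Z y = nab Y' Z y by move=> Vy; exact: nab_eq.
  have LE y : V y -> L X Y y = L X Y' y by move=> Vy; exact: L_eq.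
  by congr (_ - _ - _); exact: nab_eq.
- rewrite !(curv_anti Vx sX) //; last exact: smooth_vfD.
  by rewrite (tensorialD tl sY sY') opprD.
- rewrite !(curv_anti Vx sX) //; last exact: smooth_vfZ.
  by rewrite (tensorialZ tl sY sf) scalerN.
Qed.

(** Moving [f] through two derivatives creates first-order terms that are symmetric in [X] and [Y],
    and the expression [X (Y f) - Y (X f) - [X, Y] f], which vanishes by [tder_L]. *)
Lemma curv_tensorial_r X Y x : V x -> smooth X -> smooth Y ->
  tensorial mM V x (fun Z => curv X Y Z x).
Proof.
move=> Vx sX sY; split=> [Z Z' ZZ|Z Z' sZ sZ'|Z f sZ sf]; rewrite /curv.
- have nabE U y : V y -> nab U Z y = nab U Z' y by move=> Vy; exact: nab_eq.
  rewrite (nabE (L X Y) x Vx) (nab_eq Vx (fun y _ => erefl (X y)) (nabE Y)).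
  by rewrite (nab_eq Vx (fun y _ => erefl (Y y)) (nabE X)).
- have sum6 (a b c a' b' c' : 'rV[R]_n) :
      (a + a') - (b + b') - (c + c') = (a - b - c) + (a' - b' - c').
    by apply/rowP => j; rewrite !mxE; ring.
  have nabE U y : V y -> smooth U ->
      nab U (fun y => Z y + Z' y) y = nab U Z y + nab U Z' y.
    by move=> Vy sU; exact: nabDr.
  rewrite (nabE _ _ Vx (smooth_L sX sY)).
  have nab2 U W : smooth U -> smooth W ->
      nab U (nab W (fun y => Z y + Z' y)) x = nab U (nab W Z) x + nab U (nab W Z') x.
    move=> sU sW; rewrite -(nabDr Vx sU (smooth_nab sW sZ) (smooth_nab sW sZ')).
    by apply: (nab_eq Vx) => // y Vy; exact: nabE.
  by rewrite !nab2 // sum6.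
- have sder U : smooth U -> smooth_on mM V (fun y => tder mM y (U y) f).
    by move=> sU; exact: smooth_vf_tder.
  have nab2 U W : smooth U -> smooth W ->
      nab U (nab W (fun y => f y *: Z y)) x
      = f x *: nab U (nab W Z) x + tder mM x (U x) f *: nab W Z x
        + (tder mM x (W x) f *: nab U Z x
           + tder mM x (U x) (fun y => tder mM y (W y) f) *: Z x).
    move=> sU sW; rewrite -(nabZr Vx sU (smooth_nab sW sZ) sf).
    rewrite -(nabZr Vx sU sZ (sder W sW)).
    rewrite -(nabDr Vx sU (smooth_vfZ sf (smooth_nab sW sZ)) (smooth_vfZ (sder W sW) sZ)).
    by apply: (nab_eq Vx) => // y Vy; exact: nabZr.
  rewrite !nab2 // (nabZr Vx (smooth_L sX sY) sZ sf) (tder_L Vx sX sY sf).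
  apply/rowP => j; rewrite !mxE; ring.
Qed.

(** The six second derivatives are grouped by their outer field. Vanishing torsion, used for the
    inner pair and then for the outer one, turns each group into a double bracket, and the Jacobi
    identity remains. *)
Lemma curv_bianchi X Y Z x : V x -> smooth X -> smooth Y -> smooth Z ->
  curv X Y Z x + curv Y Z X x + curv Z X Y x = 0.
Proof.
move=> Vx sX sY sZ; rewrite -(L_jacobi Vx sX sY sZ).
have nabB A B C : smooth A -> smooth B -> smooth C ->
    nab A (nab B C) x - nab A (nab C B) x - nab (L B C) A x = L A (L B C) x.
  move=> sA sB sC; rewrite -(nab_torsion Vx sA (smooth_L sB sC)); congr (_ - _).
  have LE y : V y -> L B C y = nab B C y + (- 1) *: nab C B y.
    by move=> Vy; rewrite scaleN1r nab_torsion.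
  rewrite (nab_eq Vx (fun y _ => erefl (A y)) LE).
  have s1 := @smooth_on_cst _ _ _ mM V (-1).
  rewrite (nabDr Vx sA (smooth_nab sB sC) (smooth_vfZ s1 (smooth_nab sC sB))).
  by rewrite (nabZr Vx sA (smooth_nab sC sB) s1) tder_cst scale0r addr0 scaleN1r.
rewrite -!nabB // /curv; apply/rowP => j; rewrite !mxE; ring.
Qed.

End AbstractConnection.

(** There is one cyclic identity for each index placed last. After normalization by the
    antisymmetries they involve six quantities, each occurring twice; adding the first and the
    fourth and subtracting the other two leaves twice the difference of the two sides. *)
Lemma pair_symmetry (R : realType) (I : Type) (T : I -> I -> I -> I -> R) :
  (forall i j k l, T j i k l = - T i j k l) ->
  (forall i j k l, T i j l k = - T i j k l) ->
  (forall i j k l, T i j k l + T j k i l + T k i j l = 0) ->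
  forall i j k l, T i j k l = T k l i j.
Proof.
move=> a12 a34 b i j k l; have := (b i j k l, b j k l i, b k l i j, b l i j k).
rewrite (a34 j k i l) (a34 k l i j) (a12 j l k i) (a34 j l i k) (a34 l i j k).
rewrite (a12 k i l j) (a34 k i j l) (a34 i j k l); case=> [[[]]]; lra.
Qed.

(** * Orthonormal frames *)

Section Frame.
Context {R : realType} {n : nat} {M : topologicalType}.
Context {mM : oriented_manifold R n M}.
Variable g : riemannian_metric mM.
Local Notation ip y u v := (inner (gram g) y u v).
Variables (V : set M) (e : 'I_n -> M -> 'rV[R]_n).
Hypothesis oV : open V.
Hypothesis se : forall i, smooth_vf mM V (e i).
Hypothesis eo : forall y i j, V y -> ip y (e i y) (e j y) = (i == j)%:R.
Implicit Types (X Y Z : M -> 'rV[R]_n) (f : M -> R).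

Lemma inner_sum_frame y (a : 'I_n -> R) l : V y ->
  ip y (\sum_m a m *: e m y) (e l y) = a l.
Proof.
move=> Vy; rewrite inner_suml (bigD1 l) //= big1 ?addr0 => [|m ml].
  by rewrite innerZl eo // eqxx mulr1.
by rewrite innerZl eo // (negPf ml) mulr0.
Qed.

Lemma frame_matrix y : V y -> (\matrix_i e i y) *m gram g y *m (\matrix_i e i y)^T = 1%:M.
Proof.
move=> Vy; apply/matrixP => i j; rewrite [RHS]mxE -(eo i j Vy) /inner.
set F := \matrix_i e i y.
have rowF k : e k y = row k F by rewrite rowK.
rewrite !rowF -row_mul !mxE; apply: eq_bigr => k _; congr (_ * _); by rewrite !mxE.
Qed.

Lemma frame_expand y u : V y -> u = \sum_k ip y u (e k y) *: e k y.
Proof.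
move=> Vy; set F := \matrix_i e i y.
have FGF : F *m (gram g y *m F^T) = 1%:M by rewrite mulmxA frame_matrix.
have := mulmx1C FGF => GFF.
rewrite -{1}[u]mulmx1 -GFF mulmxA [LHS]mulmx_sum_row; apply: eq_bigr => k _.
rewrite rowK; congr (_ *: _); rewrite /inner mulmxA !mxE; apply: eq_bigr => j _.
by rewrite !mxE.
Qed.

Lemma tensorial_frame x (W : lmodType R) (T : (M -> 'rV[R]_n) -> W) X : V x ->
  tensorial mM V x T -> smooth_vf mM V X ->
  T X = \sum_k ip x (X x) (e k x) *: T (e k).
Proof.
move=> Vx tT sX.
rewrite (tensorial_eq tT (Y := fun y => \sum_k ip y (X y) (e k y) *: e k y)).
  by rewrite (tensorial_sum (f := fun k y => ip y (X y) (e k y)) _ tT) // => k;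
    exact: smooth_inner.
by move=> y Vy; exact: frame_expand.
Qed.

(* Locked, so that a failed unification of two symbols does not unfold the
   Koszul formula. *)
Definition christoffel i j k := locked (koszul g) (e i) (e j) (e k).

Lemma christoffelE i j k : christoffel i j k = koszul g (e i) (e j) (e k).
Proof. by rewrite /christoffel -lock. Qed.

Lemma smooth_christoffel i j k : smooth_on mM V (christoffel i j k).
Proof. by rewrite christoffelE; exact: smooth_koszul. Qed.

Lemma inner_nabla_frame i j k y : V y ->
  ip y (nabla g (e i) (e j) y) (e k y) = christoffel i j k y.
Proof. by move=> Vy; rewrite christoffelE; exact: (inner_nabla g oV Vy (se i) (se j) (se
  k)). Qed.

Lemma nabla_frame i j y : V y ->
  nabla g (e i) (e j) y = \sum_k christoffel i j k y *: e k y.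
Proof.
move=> Vy; rewrite {1}(frame_expand (nabla g (e i) (e j) y) Vy).
by apply: eq_bigr => k _; rewrite inner_nabla_frame.
Qed.

(** The scalar products of an orthonormal frame are constant, so metric compatibility has zero on
    its right-hand side. *)
Lemma christoffel_anti i j k y : V y -> christoffel i k j y = - christoffel i j k y.
Proof.
move=> Vy; apply/eqP; rewrite -addr_eq0 addrC !christoffelE koszul_metric; apply/eqP.
rewrite -(tder_cst (mM := mM) y (e i y) (j == k)%:R).
by apply: (tder_eq _ oV Vy) => z Vz; exact: eo.
Qed.

Lemma inner_lie_frame i j k y :
  ip y (lie mM (e i) (e j) y) (e k y) = christoffel i j k y - christoffel j i k y.
Proof. by rewrite !christoffelE koszul_torsion. Qed.

Lemma lie_frame i j y : V y ->
  lie mM (e i) (e j) y = \sum_k (christoffel i j k y - christoffel j i k y) *: e k y.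
Proof.
move=> Vy; rewrite {1}(frame_expand (lie mM (e i) (e j) y) Vy).
by apply: eq_bigr => k _; rewrite inner_lie_frame.
Qed.

(** The definition of [nabla] refers to a chart that changes with the point, so smoothness is not
    visible from it. Expanded in the frame, the field has Koszul expressions as coefficients, and
    these are smooth. *)
Lemma smooth_nabla X Y : smooth_vf mM V X -> smooth_vf mM V Y ->
  smooth_vf mM V (nabla g X Y).
Proof.
move=> sX sY.
apply: (@smooth_vf_eq _ _ _ mM V (fun y => \sum_k koszul g X Y (e k) y *: e k y)).
  move=> y Vy; rewrite [RHS](frame_expand _ Vy).
  by apply: eq_bigr => k _; rewrite (inner_nabla g oV Vy sX sY (se k)).
apply: smooth_vf_sum => k; apply: smooth_vfZ => //; exact: smooth_koszul.
Qed.

Let nablaDl X X' Y x : V x -> smooth_vf mM V X -> smooth_vf mM V X' ->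
  smooth_vf mM V Y ->
  nabla g (fun y => X y + X' y) Y x = nabla g X Y x + nabla g X' Y x.
Proof. by move=> Vx sX sX' sY; exact: (tensorialD (nabla_tensorial g oV Vx sY)). Qed.

Let nablaZl X Y f x : V x -> smooth_vf mM V X -> smooth_vf mM V Y ->
  smooth_on mM V f -> nabla g (fun y => f y *: X y) Y x = f x *: nabla g X Y x.
Proof. by move=> Vx sX sY sf; exact: (tensorialZ (nabla_tensorial g oV Vx sY)). Qed.

Let tder_lieV X Y f x : V x -> smooth_vf mM V X -> smooth_vf mM V Y ->
  smooth_on mM V f ->
  tder mM x (lie mM X Y x) f = tder mM x (X x) (fun z => tder mM z (Y z) f)
                             - tder mM x (Y x) (fun z => tder mM z (X z) f).
Proof. by move=> Vx; exact: (tder_lie oV Vx). Qed.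

(** [riem g] unfolds to [curv] for [nabla g] and [lie mM], so the abstract results apply as they
    stand once the rules of these two operations over [V] are supplied. *)
Lemma riem_anti X Y Z x : V x -> smooth_vf mM V X -> smooth_vf mM V Y ->
  smooth_vf mM V Z -> riem g X Y Z x = - riem g Y X Z x.
Proof.
exact: (@curv_anti _ _ _ mM V (nabla g) (lie mM) (@nabla_eq _ _ _ mM g V oV) nablaZl
  (@lie_anti _ _ _ mM)
         (@smooth_lie _ _ _ mM V)).
Qed.

Lemma riem_tensorial_l Y Z x : V x -> smooth_vf mM V Y -> smooth_vf mM V Z ->
  tensorial mM V x (fun X => riem g X Y Z x).
Proof.
exact: (@curv_tensorial_l _ _ _ mM V oV (nabla g) (lie mM) (@nabla_eq _ _ _ mM g V oV)
  nablaDl nablaZl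
  (nablaDr g oV) (nablaZr g oV) smooth_nabla (@lie_eq _ _ _ mM V oV)
  (lieDl oV) (lieZl oV) (@smooth_lie _ _ _ mM V)).
Qed.

Lemma riem_tensorial_m X Z x : V x -> smooth_vf mM V X -> smooth_vf mM V Z ->
  tensorial mM V x (fun Y => riem g X Y Z x).
Proof.
exact: (@curv_tensorial_m _ _ _ mM V oV (nabla g) (lie mM) (@nabla_eq _ _ _ mM g V oV)
  nablaDl nablaZl
  (nablaDr g oV) (nablaZr g oV) smooth_nabla (@lie_eq _ _ _ mM V oV)
  (@lie_anti _ _ _ mM) (lieDl oV) (lieZl oV) (@smooth_lie _ _ _ mM V)).
Qed.

Lemma riem_tensorial_r X Y x : V x -> smooth_vf mM V X -> smooth_vf mM V Y ->
  tensorial mM V x (fun Z => riem g X Y Z x).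
Proof.
exact: (@curv_tensorial_r _ _ _ mM V oV (nabla g) (lie mM) (@nabla_eq _ _ _ mM g V oV) 
  (nablaDr g oV) (nablaZr g oV) smooth_nabla (@smooth_lie _ _ _ mM V) tder_lieV).
Qed.

Lemma riem_bianchi X Y Z x : V x -> smooth_vf mM V X -> smooth_vf mM V Y ->
  smooth_vf mM V Z -> riem g X Y Z x + riem g Y Z X x + riem g Z X Y x = 0.
Proof.
exact: (@curv_bianchi _ _ _ mM V (nabla g) (lie mM) (@nabla_eq _ _ _ mM g V oV) (nablaDr
  g oV) (nablaZr g oV)
  (@nabla_torsion _ _ _ mM g V) smooth_nabla (@smooth_lie _ _ _ mM V) (lie_jacobi oV)).
Qed.

Definition riem_frame i j k l y := ip y (riem g (e i) (e j) (e k) y) (e l y).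

(** The structure equation in components. It serves twice: for the antisymmetry in the last two
    indices, and for comparison with the curvature of the spin connection, which has the same
    shape. *)
Lemma riem_frameE i j k l x : V x -> riem_frame i j k l x =
  (tder mM x (e i x) (christoffel j k l)
     + \sum_m christoffel j k m x * christoffel i m l x)
  - (tder mM x (e j x) (christoffel i k l)
     + \sum_m christoffel i k m x * christoffel j m l x)
  - \sum_m (christoffel i j m x - christoffel j i m x) * christoffel m k l x.
Proof.
move=> Vx.
have second a b : ip x (nabla g (e a) (nabla g (e b) (e k)) x) (e l x) =
    tder mM x (e a x) (christoffel b k l)
      + \sum_m christoffel b k m x * christoffel a m l x.
  rewrite (nabla_eq g oV Vx (fun y _ => erefl (e a y))
            (fun y Vy => nabla_frame b k Vy)).
  rewrite (nabla_sumr _ oV) //; last by move=> m; exact: smooth_christoffel.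
  rewrite big_split innerDl inner_sum_frame // addrC inner_suml; congr (_ + _).
  by apply: eq_bigr => m _; rewrite innerZl inner_nabla_frame.
have -> : riem_frame i j k l x = ip x (nabla g (e i) (nabla g (e j) (e k)) x) (e l x)
    - ip x (nabla g (e j) (nabla g (e i) (e k)) x) (e l x)
    - ip x (nabla g (lie mM (e i) (e j)) (e k) x) (e l x).
  by rewrite /riem_frame /riem !innerBl.
have sL : smooth_vf mM V (lie mM (e i) (e j)) by exact: smooth_lie.
apply: (f_equal2 (fun a b => a - b)).
  by apply: (f_equal2 (fun a b => a - b)); exact: second.
rewrite (tensorial_frame Vx (nabla_tensorial g oV Vx (se k)) sL) inner_suml.
apply: eq_bigr => m _.
by rewrite innerZl inner_nabla_frame // inner_lie_frame.
Qed.

Lemma riem_frame_anti12 i j k l x : V x -> riem_frame j i k l x = - riem_frame i j k l x.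
Proof.
by move=> Vx; rewrite /riem_frame (riem_anti Vx (se j) (se i) (se k)) innerNl.
Qed.

(** In the component formula, exchanging [k] and [l] negates the derivative terms and the bracket
    term by [christoffel_anti], and exchanges the two quadratic sums, which enter with opposite
    signs. *)
Lemma riem_frame_anti34 i j k l x : V x -> riem_frame i j l k x = - riem_frame i j k l x.
Proof.
move=> Vx.
have tderE a b : tder mM x (e a x) (christoffel b l k)
    = - tder mM x (e a x) (christoffel b k l).
  rewrite -(tderN _ (smooth_christoffel b k l) Vx).
  by apply: (tder_eq _ oV Vx) => y Vy; exact: christoffel_anti.
have sumE a b : \sum_m christoffel a l m x * christoffel b m k x
    = \sum_m christoffel b k m x * christoffel a m l x.
  apply: eq_bigr => m _.
  by rewrite (christoffel_anti a m l Vx) (christoffel_anti b k m Vx) mulrN mulNr opprK mulrC.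
have lieE : \sum_m (christoffel i j m x - christoffel j i m x) * christoffel m l k x
    = - \sum_m (christoffel i j m x - christoffel j i m x) * christoffel m k l x.
  by rewrite -sumrN; apply: eq_bigr => m _; rewrite (christoffel_anti m k l Vx) mulrN.
have shuffle (a b c d s a' b' c' d' s' : R) :
    a' = - a -> b' = - b -> c' = d -> d' = c -> s' = - s ->
    a' + c' - (b' + d') - s' = - (a + c - (b + d) - s).
  by move=> -> -> -> -> ->; ring.
apply: (etrans (riem_frameE i j l k Vx)).
apply: (etrans _ (f_equal -%R (esym (riem_frameE i j k l Vx)))).
exact: (shuffle _ _ _ _ _ _ _ _ _ _ (tderE i j) (tderE j i) (sumE j i) (sumE i j) lieE).
Qed.

Lemma riem_frame_bianchi i j k l x : V x ->
  riem_frame i j k l x + riem_frame j k i l x + riem_frame k i j l x = 0.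
Proof. by move=> Vx; rewrite /riem_frame -!innerDl riem_bianchi // inner0l. Qed.

Lemma riem_frame_pair i j k l x : V x -> riem_frame i j k l x = riem_frame k l i j x.
Proof.
move=> Vx; apply: (@pair_symmetry _ _ (fun i j k l => riem_frame i j k l x)) => *.
- exact: riem_frame_anti12.
- exact: riem_frame_anti34.
- exact: riem_frame_bianchi.
Qed.

End Frame.

(** * Divergence and scalar curvature in an orthonormal frame *)

Section FrameTraces.
Context {R : realType} {n : nat} {M : topologicalType}.
Context {mM : oriented_manifold R n M}.
Variable g : riemannian_metric mM.
Local Notation ip y u v := (inner (gram g) y u v).
Variables (V : set M) (e : 'I_n -> M -> 'rV[R]_n).
Hypothesis oV : open V.
Hypothesis se : forall i, smooth_vf mM V (e i).
Hypothesis eo : forall y i j, V y -> ip y (e i y) (e j y) = (i == j)%:R.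
Variable x : M.
Hypothesis Vx : V x.
Implicit Types (X Y Z : M -> 'rV[R]_n) (f : M -> R).

Let c := chart_at mM x.
Let W := V `&` dom c.
Let oW : open W. Proof. exact: openI oV (dom_open _). Qed.
Let Wx : W x. Proof. by split=> //; exact: chart_atP. Qed.
Let WV : W `<=` V. Proof. by move=> z []. Qed.
Let seW i : smooth_vf mM W (e i). Proof. exact: smooth_vf_subset WV (se i). Qed.
Let eoW y i j : W y -> ip y (e i y) (e j y) = (i == j)%:R.
Proof. by move=> /WV; exact: eo. Qed.
Let sd k : smooth_vf mM W (coord_vf c k).
Proof. by apply: smooth_vf_subset (smooth_coord_vf k) => z []. Qed.

Local Notation u k i := (ip x (delta_mx 0 k) (e i x)).

Lemma inner_expand_l v w : ip x v w = \sum_k v 0 k * ip x (delta_mx 0 k) w.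
Proof.
rewrite {1}[v]row_sum_delta inner_suml.
by apply: eq_bigr => k _; rewrite innerZl.
Qed.

Lemma divergence_frame X : smooth_vf mM V X ->
  divergence g X x = \sum_i ip x (nabla g (e i) X x) (e i x).
Proof.
move=> sX; have sX' := smooth_vf_subset WV sX.
rewrite /divergence -/c.
under eq_bigr => k _ do rewrite (tensorial_frame oW seW eoW Wx
  (nabla_tensorial g oW Wx sX') (sd k)) summxE.
rewrite exchange_big /=; apply: eq_bigr => i _.
rewrite inner_expand_l; apply: eq_bigr => k _.
by rewrite mxE coord_vf_at mulrC.
Qed.

(** With [F] the matrix of the frame and [G] the Gram matrix, the scalar products of coordinate and
    frame vectors form the matrix [G F^T]. The sum is then an entry of [F G G^-1 G F^T = F G F^T],
    which is the identity. *)
Lemma gram_inv_frame i p :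
  \sum_a \sum_l invmx (gram g x) a l * (u a i * u l p) = (i == p)%:R.
Proof.
set F := \matrix_i e i x; set G := gram g x.
have uE a j : u a j = (G *m F^T) a j.
  by rewrite innerC inner_delta !mxE; apply: eq_bigr => k _;
    rewrite !mxE mulrC -[G]gram_sym mxE.
have := frame_matrix eo Vx; rewrite -/F -/G => FGF.
have -> : (i == p)%:R = ((F *m G) *m invmx G *m (G *m F^T)) i p.
  by rewrite mulmxK ?gram_unit // mulmxA FGF mxE.
rewrite mxE; under [RHS]eq_bigr do rewrite mxE mulr_suml.
rewrite [RHS]exchange_big /=; apply: eq_bigr => a _; apply: eq_bigr => l _.
have -> : (F *m G) i a = u a i.
  have -> : F *m G = (G *m F^T)^T by rewrite trmx_mul trmxK gram_sym.
  by rewrite mxE uE.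
by rewrite -uE mulrCA mulrA.
Qed.

Lemma contraction_frame (B : 'I_n -> 'I_n -> R) :
  \sum_a \sum_l invmx (gram g x) a l * (\sum_i \sum_p u a i * u l p * B i p)
  = \sum_i B i i.
Proof.
transitivity (\sum_i \sum_p (\sum_a \sum_l invmx (gram g x) a l * (u a i * u l p)) * B i p).
  under eq_bigr => a _ do under eq_bigr => l _ do rewrite mulr_sumr.
  under eq_bigr => a _ do rewrite exchange_big.
  rewrite exchange_big /=; apply: eq_bigr => i _.
  under eq_bigr => a _ do under eq_bigr => l _ do rewrite mulr_sumr.
  under eq_bigr => a _ do rewrite exchange_big.
  rewrite exchange_big /=; apply: eq_bigr => p _.
  rewrite mulr_suml; apply: eq_bigr => a _; rewrite mulr_suml.
  by apply: eq_bigr => l _; rewrite !mulrA.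
apply: eq_bigr => i _; rewrite (bigD1 i) //= gram_inv_frame eqxx mul1r.
rewrite big1 ?addr0 // => p pi.
by rewrite gram_inv_frame eq_sym (negPf pi) mul0r.
Qed.

(** The definition contracts over coordinate fields. The first and last slots are expanded in the
    frame and contracted by [contraction_frame], then the two middle ones; each expansion is an
    instance of tensoriality. *)
Lemma scalar_curvature_frame :
  scalar_curvature g x = \sum_i \sum_j riem_frame g e i j j i x.
Proof.
have sr := smooth_nabla oW seW eoW.
rewrite /scalar_curvature -/c.
have inner_frame v w : ip x v w = \sum_p ip x w (e p x) * ip x v (e p x).
  rewrite {1}(frame_expand eo w Vx) inner_sumr.
  by apply: eq_bigr => p _; rewrite innerZr.
have expand_l b k a l :
    ip x (riem g (coord_vf c a) (coord_vf c b) (coord_vf c k) x) (coord_vf c l x)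
    = \sum_i \sum_p u a i * u l p *
        ip x (riem g (e i) (coord_vf c b) (coord_vf c k) x) (e p x).
  rewrite (tensorial_frame oW seW eoW Wx
    (riem_tensorial_l oW seW eoW Wx (sd b) (sd k)) (sd a)) inner_suml.
  apply: eq_bigr => i _; rewrite innerZl !coord_vf_at (inner_frame (riem _ _ _ _ _)) mulr_sumr.
  by apply: eq_bigr => p _; rewrite mulrA.
transitivity (\sum_b \sum_k invmx (gram g x) b k *
  \sum_i ip x (riem g (e i) (coord_vf c b) (coord_vf c k) x) (e i x)).
  rewrite exchange_big /=; apply: eq_bigr => b _.
  rewrite exchange_big /=; apply: eq_bigr => k _.
  rewrite -(contraction_frame (fun i p =>
    ip x (riem g (e i) (coord_vf c b) (coord_vf c k) x) (e p x))) mulr_sumr.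
  apply: eq_bigr => a _; rewrite mulr_sumr; apply: eq_bigr => l _.
  have reorder (a1 a2 a3 b3 : R) : a3 = b3 -> a1 * a2 * a3 = a2 * (a1 * b3).
    by move=> ->; ring.
  exact: reorder (expand_l b k a l).
have expand_mr b k i :
    ip x (riem g (e i) (coord_vf c b) (coord_vf c k) x) (e i x)
    = \sum_j \sum_m u b j * u k m * riem_frame g e i j m i x.
  rewrite (tensorial_frame oW seW eoW Wx
    (riem_tensorial_m oW seW eoW Wx (seW i) (sd k)) (sd b)) inner_suml.
  apply: eq_bigr => j _; rewrite innerZl coord_vf_at.
  rewrite (tensorial_frame oW seW eoW Wx
    (riem_tensorial_r oW seW eoW Wx (seW i) (seW j)) (sd k)) inner_suml mulr_sumr.
  by apply: eq_bigr => m _; rewrite innerZl coord_vf_at mulrA.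
rewrite [RHS]exchange_big /= -(contraction_frame (fun j m => \sum_i riem_frame g e i j m i x)).
apply: eq_bigr => b _; apply: eq_bigr => k _; congr (_ * _).
under eq_bigr => i _ do rewrite expand_mr.
rewrite exchange_big /=; apply: eq_bigr => j _.
rewrite exchange_big /=; apply: eq_bigr => m _.
by rewrite mulr_sumr.
Qed.

End FrameTraces.

(** * Complex-valued functions and curves of spin elements *)

Section ComplexCalculus.
Context {R : realType} {n : nat} {M : topologicalType}.
Context {mM : oriented_manifold R n M}.
Implicit Types (V W : set M) (f h : M -> R[i]) (x y : M) (v w : 'rV[R]_n).

Lemma Re_mul (a b : R[i]) :
  complex.Re (a * b) = complex.Re a * complex.Re b - complex.Im a * complex.Im b.
Proof. by case: a; case: b. Qed.

Lemma Im_mul (a b : R[i]) :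
  complex.Im (a * b) = complex.Re a * complex.Im b + complex.Im a * complex.Re b.
Proof. by case: a; case: b. Qed.

Lemma complex_ext (a b : R[i]) : complex.Re a = complex.Re b ->
  complex.Im a = complex.Im b -> a = b.
Proof. by case: a => ar ai; case: b => br bi /= -> ->. Qed.

Lemma Re_add (a b : R[i]) : complex.Re (a + b) = complex.Re a + complex.Re b.
Proof. by case: a; case: b. Qed.

Lemma Im_add (a b : R[i]) : complex.Im (a + b) = complex.Im a + complex.Im b.
Proof. by case: a; case: b. Qed.

Lemma csmooth_on_subset V W f : W `<=` V -> csmooth_on mM V f -> csmooth_on mM W f.
Proof. by move=> WV [sr si]; split; apply: smooth_on_subset WV _. Qed.

Lemma csmooth_on_eq V f h : open V -> (forall x, V x -> f x = h x) ->
  csmooth_on mM V f -> csmooth_on mM V h.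
Proof.
by move=> oV fh [sr si]; split; [apply: smooth_on_eq sr|apply: smooth_on_eq si] => // x Vx;
  rewrite fh.
Qed.

Lemma csmooth_on_cst V (a : R[i]) : csmooth_on mM V (fun=> a).
Proof. by split; exact: smooth_on_cst. Qed.

Lemma csmooth_on_real V (f : M -> R) : smooth_on mM V f ->
  csmooth_on mM V (fun y => (f y)%:C).
Proof. by move=> sf; split=> //=; exact: smooth_on_cst. Qed.

Lemma csmooth_onD V f h : open V -> csmooth_on mM V f -> csmooth_on mM V h ->
  csmooth_on mM V (fun y => f y + h y).
Proof.
move=> oV [fr fi] [hr hi]; split.
  by apply: smooth_on_eq oV _ (smooth_onD oV fr hr) => y _; rewrite Re_add.
by apply: smooth_on_eq oV _ (smooth_onD oV fi hi) => y _; rewrite Im_add.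
Qed.

Lemma csmooth_onM V f h : open V -> csmooth_on mM V f -> csmooth_on mM V h ->
  csmooth_on mM V (fun y => f y * h y).
Proof.
move=> oV [fr fi] [hr hi]; split.
  apply: smooth_on_eq oV _ (smooth_onB oV (smooth_onM oV fr hr) (smooth_onM oV fi hi)).
  by move=> y _; rewrite Re_mul.
apply: smooth_on_eq oV _ (smooth_onD oV (smooth_onM oV fr hi) (smooth_onM oV fi hr)).
by move=> y _; rewrite Im_mul.
Qed.

Lemma csmooth_on_sum V (I : Type) (r : seq I) (P : pred I) (F : I -> M -> R[i]) :
  open V -> (forall i, P i -> csmooth_on mM V (F i)) ->
  csmooth_on mM V (fun y => \sum_(i <- r | P i) F i y).
Proof.
move=> oV sF; elim: r => [|i r IH].
  by apply: csmooth_on_eq oV _ (csmooth_on_cst V 0) => y _; rewrite big_nil.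
case Pi: (P i).
  by apply: csmooth_on_eq oV _ (csmooth_onD oV (sF i Pi) IH) => y _; rewrite big_cons Pi.
by apply: csmooth_on_eq oV _ IH => y _; rewrite big_cons Pi.
Qed.

Lemma csmooth_on_prod V (I : Type) (r : seq I) (P : pred I) (F : I -> M -> R[i]) :
  open V -> (forall i, P i -> csmooth_on mM V (F i)) ->
  csmooth_on mM V (fun y => \prod_(i <- r | P i) F i y).
Proof.
move=> oV sF; elim: r => [|i r IH].
  by apply: csmooth_on_eq oV _ (csmooth_on_cst V 1) => y _; rewrite big_nil.
case Pi: (P i).
  by apply: csmooth_on_eq oV _ (csmooth_onM oV (sF i Pi) IH) => y _; rewrite big_cons Pi.
by apply: csmooth_on_eq oV _ IH => y _; rewrite big_cons Pi.
Qed.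

Lemma ctder_eq V x v f h : open V -> V x -> (forall y, V y -> f y = h y) ->
  ctder mM x v f = ctder mM x v h.
Proof.
move=> oV Vx fh; rewrite /ctder; congr (_ +i* _);
  by apply: (tder_eq _ oV Vx) => y Vy; rewrite fh.
Qed.

Lemma ctder_cst x v (a : R[i]) : ctder mM x v (fun=> a) = 0.
Proof. by rewrite /ctder !tder_cst. Qed.

Lemma ctder_real x v (f : M -> R) :
  ctder mM x v (fun y => (f y)%:C) = (tder mM x v f)%:C.
Proof. by apply: complex_ext => //=; exact: tder_cst. Qed.

Lemma ctderD V x v f h : csmooth_on mM V f -> csmooth_on mM V h -> V x ->
  ctder mM x v (fun y => f y + h y) = ctder mM x v f + ctder mM x v h.
Proof.
move=> [fr fi] [hr hi] Vx; apply: complex_ext; rewrite ?Re_add ?Im_add /=.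
  by rewrite -(tderD _ fr hr Vx); congr tder; apply/funext => y; rewrite Re_add.
by rewrite -(tderD _ fi hi Vx); congr tder; apply/funext => y; rewrite Im_add.
Qed.

Lemma ctderM V x v f h : open V -> csmooth_on mM V f -> csmooth_on mM V h -> V x ->
  ctder mM x v (fun y => f y * h y) = ctder mM x v f * h x + f x * ctder mM x v h.
Proof.
move=> oV [fr fi] [hr hi] Vx; apply: complex_ext.
  rewrite Re_add !Re_mul /=; have -> : (fun y => complex.Re (f y * h y)) =
      (fun y => complex.Re (f y) * complex.Re (h y) - complex.Im (f y) * complex.Im (h y)).
    by apply/funext => y; rewrite Re_mul.
  rewrite (tderB _ oV (smooth_onM oV fr hr) (smooth_onM oV fi hi) Vx).
  by rewrite (tderM _ fr hr Vx) (tderM _ fi hi Vx) opprD addrACA.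
rewrite Im_add !Im_mul /=; have -> : (fun y => complex.Im (f y * h y)) =
    (fun y => complex.Re (f y) * complex.Im (h y) + complex.Im (f y) * complex.Re (h y)).
  by apply/funext => y; rewrite Im_mul.
rewrite (tderD _ (smooth_onM oV fr hi) (smooth_onM oV fi hr) Vx).
by rewrite (tderM _ fr hi Vx) (tderM _ fi hr Vx) addrACA.
Qed.

Lemma ctder_sum V x v (I : Type) (r : seq I) (P : pred I) (F : I -> M -> R[i]) :
  open V -> (forall i, P i -> csmooth_on mM V (F i)) -> V x ->
  ctder mM x v (fun y => \sum_(i <- r | P i) F i y)
  = \sum_(i <- r | P i) ctder mM x v (F i).
Proof.
move=> oV sF Vx; elim: r => [|i r IH].
  by under eq_fun do rewrite big_nil; rewrite ctder_cst big_nil.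
rewrite big_cons; case Pi: (P i); last by under eq_fun do rewrite big_cons Pi.
under eq_fun do rewrite big_cons Pi.
by rewrite (ctderD _ (sF i Pi) (csmooth_on_sum _ oV sF) Vx) IH.
Qed.

Lemma ctderDv x v w f : ctder mM x (v + w) f = ctder mM x v f + ctder mM x w f.
Proof. by rewrite /ctder !tderDv. Qed.

Lemma ctderZv x (a : R) v f : ctder mM x (a *: v) f = a%:C * ctder mM x v f.
Proof.
by apply: complex_ext; rewrite /= ?tderZv ?mul0r ?subr0 ?addr0.
Qed.

Lemma ctder_sumv x (I : Type) (r : seq I) (F : I -> 'rV[R]_n) f :
  ctder mM x (\sum_(i <- r) F i) f = \sum_(i <- r) ctder mM x (F i) f.
Proof.
elim: r => [|i r IH]; last by rewrite !big_cons ctderDv IH.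
by rewrite !big_nil /ctder !tder0v.
Qed.

Lemma csmooth_ctder V X f : open V -> smooth_vf mM V X -> csmooth_on mM V f ->
  csmooth_on mM V (fun y => ctder mM y (X y) f).
Proof. by move=> oV sX [fr fi]; split; exact: smooth_vf_tder. Qed.

Lemma ctder_lie V X Y f x : open V -> V x -> smooth_vf mM V X ->
  smooth_vf mM V Y -> csmooth_on mM V f ->
  ctder mM x (lie mM X Y x) f = ctder mM x (X x) (fun z => ctder mM z (Y z) f)
                              - ctder mM x (Y x) (fun z => ctder mM z (X z) f).
Proof.
move=> oV Vx sX sY [fr fi]; rewrite /ctder /=.
by rewrite (tder_lie oV Vx sX sY fr) (tder_lie oV Vx sX sY fi).
Qed.

Definition smooth_mx p q V (F : M -> 'M[R[i]]_(p, q)) :=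
  forall i j, csmooth_on mM V (fun y => F y i j).

Lemma smooth_mx_subset p q V W (F : M -> 'M[R[i]]_(p, q)) : W `<=` V ->
  smooth_mx V F -> smooth_mx W F.
Proof. by move=> WV sF i j; exact: csmooth_on_subset WV (sF i j). Qed.

Lemma smooth_mx_eq p q V (F H : M -> 'M[R[i]]_(p, q)) : open V ->
  (forall y, V y -> F y = H y) -> smooth_mx V F -> smooth_mx V H.
Proof.
by move=> oV FH sF i j; apply: csmooth_on_eq oV _ (sF i j) => y Vy; rewrite FH.
Qed.

Lemma smooth_mx_cst p q V (A : 'M[R[i]]_(p, q)) : smooth_mx V (fun=> A).
Proof. by move=> i j; exact: csmooth_on_cst. Qed.

Lemma smooth_mxD p q V (F H : M -> 'M[R[i]]_(p, q)) : open V ->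
  smooth_mx V F -> smooth_mx V H -> smooth_mx V (fun y => F y + H y).
Proof.
move=> oV sF sH i j.
by apply: csmooth_on_eq oV _ (csmooth_onD oV (sF i j) (sH i j)) => y _; rewrite mxE.
Qed.

Lemma smooth_mxZ p q V f (F : M -> 'M[R[i]]_(p, q)) : open V ->
  csmooth_on mM V f -> smooth_mx V F -> smooth_mx V (fun y => f y *: F y).
Proof.
move=> oV sf sF i j.
by apply: csmooth_on_eq oV _ (csmooth_onM oV sf (sF i j)) => y _; rewrite mxE.
Qed.

Lemma smooth_mxM p q r V (F : M -> 'M[R[i]]_(p, q)) (H : M -> 'M_(q, r)) : open V ->
  smooth_mx V F -> smooth_mx V H -> smooth_mx V (fun y => F y *m H y).
Proof.
move=> oV sF sH i j.
apply: (csmooth_on_eq oV (f := fun y => \sum_k F y i k * H y k j)).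
  by move=> y _; rewrite mxE.
by apply: (csmooth_on_sum _ oV) => k _; exact: csmooth_onM.
Qed.

Lemma smooth_mx_sum p q V (I : Type) (r : seq I) (P : pred I)
    (F : I -> M -> 'M[R[i]]_(p, q)) : open V ->
  (forall i, P i -> smooth_mx V (F i)) ->
  smooth_mx V (fun y => \sum_(i <- r | P i) F i y).
Proof.
move=> oV sF i j.
apply: (csmooth_on_eq oV (f := fun y => \sum_(k <- r | P k) F k y i j)).
  by move=> y _; rewrite summxE.
by apply: (csmooth_on_sum _ oV) => k Pk; exact: sF.
Qed.

Lemma mxtder_eq p q V x v (F H : M -> 'M[R[i]]_(p, q)) : open V -> V x ->
  (forall y, V y -> F y = H y) -> mxtder mM x v F = mxtder mM x v H.
Proof.
move=> oV Vx FH; apply/matrixP => i j; rewrite !mxE.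
by apply: (ctder_eq _ oV Vx) => y Vy; rewrite FH.
Qed.

Lemma mxtderD p q V x v (F H : M -> 'M[R[i]]_(p, q)) : V x ->
  smooth_mx V F -> smooth_mx V H ->
  mxtder mM x v (fun y => F y + H y) = mxtder mM x v F + mxtder mM x v H.
Proof.
move=> Vx sF sH; apply/matrixP => i j; rewrite !mxE -(ctderD _ (sF i j) (sH i j) Vx).
by congr ctder; apply/funext => y; rewrite mxE.
Qed.

Lemma mxtderZ p q V x v f (F : M -> 'M[R[i]]_(p, q)) : open V -> V x ->
  csmooth_on mM V f -> smooth_mx V F ->
  mxtder mM x v (fun y => f y *: F y) = ctder mM x v f *: F x + f x *: mxtder mM x v F.
Proof.
move=> oV Vx sf sF; apply/matrixP => i j; rewrite !mxE -(ctderM _ oV sf (sF i j) Vx).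
by congr ctder; apply/funext => y; rewrite mxE.
Qed.

Lemma mxtderM p q r V x v (F : M -> 'M[R[i]]_(p, q)) (H : M -> 'M_(q, r)) :
  open V -> V x -> smooth_mx V F -> smooth_mx V H ->
  mxtder mM x v (fun y => F y *m H y) = mxtder mM x v F *m H x + F x *m mxtder mM x v H.
Proof.
move=> oV Vx sF sH; apply/matrixP => i j; rewrite !mxE -big_split /=.
rewrite (_ : (fun y => (F y *m H y) i j) = (fun y => \sum_k F y i k * H y k j)).
  rewrite (ctder_sum _ _ oV) // => [|k _]; last exact: csmooth_onM.
  by apply: eq_bigr => k _; rewrite (ctderM _ oV (sF i k) (sH k j) Vx) !mxE.
by apply/funext => y; rewrite mxE.
Qed.

Lemma mxtder_cst p q x v (A : 'M[R[i]]_(p, q)) : mxtder mM x v (fun=> A) = 0.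
Proof. by apply/matrixP => i j; rewrite !mxE ctder_cst. Qed.

Lemma mxtder_mull p q r V x v (A : 'M[R[i]]_(p, q)) (H : M -> 'M_(q, r)) :
  open V -> V x -> smooth_mx V H ->
  mxtder mM x v (fun y => A *m H y) = A *m mxtder mM x v H.
Proof.
move=> oV Vx sH; rewrite (mxtderM _ oV Vx (smooth_mx_cst V A) sH) mxtder_cst.
by rewrite mul0mx add0r.
Qed.

Lemma mxtder_sum p q V x v (I : Type) (r : seq I) (P : pred I)
    (F : I -> M -> 'M[R[i]]_(p, q)) : open V -> V x ->
  (forall i, P i -> smooth_mx V (F i)) ->
  mxtder mM x v (fun y => \sum_(i <- r | P i) F i y)
  = \sum_(i <- r | P i) mxtder mM x v (F i).
Proof.
move=> oV Vx sF; apply/matrixP => i j; rewrite summxE mxE.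
have -> : (fun y => (\sum_(i <- r | P i) F i y) i j)
    = (fun y => \sum_(k <- r | P k) F k y i j).
  by apply/funext => y; rewrite summxE.
rewrite (ctder_sum _ _ oV) // => [|k Pk]; last exact: sF.
by apply: eq_bigr => k _; rewrite mxE.
Qed.

Lemma mxtder_sumv p q x (I : Type) (r : seq I) (F : I -> 'rV[R]_n)
    (H : M -> 'M[R[i]]_(p, q)) :
  mxtder mM x (\sum_(i <- r) F i) H = \sum_(i <- r) mxtder mM x (F i) H.
Proof.
apply/matrixP => i j; rewrite summxE mxE ctder_sumv.
by apply: eq_bigr => k _; rewrite mxE.
Qed.

Lemma mxtderZv p q x (a : R) v (H : M -> 'M[R[i]]_(p, q)) :
  mxtder mM x (a *: v) H = a%:C *: mxtder mM x v H.
Proof. by apply/matrixP => i j; rewrite !mxE ctderZv. Qed.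

Lemma smooth_mxtder p q V X (F : M -> 'M[R[i]]_(p, q)) : open V ->
  smooth_vf mM V X -> smooth_mx V F -> smooth_mx V (fun y => mxtder mM y (X y) F).
Proof.
move=> oV sX sF i j.
by apply: csmooth_on_eq oV _ (csmooth_ctder oV sX (sF i j)) => y _; rewrite mxE.
Qed.

Lemma mxtder_lie p q V X Y (F : M -> 'M[R[i]]_(p, q)) x : open V -> V x ->
  smooth_vf mM V X -> smooth_vf mM V Y -> smooth_mx V F ->
  mxtder mM x (lie mM X Y x) F
  = mxtder mM x (X x) (fun z => mxtder mM z (Y z) F)
  - mxtder mM x (Y x) (fun z => mxtder mM z (X z) F).
Proof.
move=> oV Vx sX sY sF; apply/matrixP => i j; rewrite !mxE.
rewrite (ctder_lie oV Vx sX sY (sF i j)).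
by congr (_ - _); congr ctder; apply/funext => y; rewrite mxE.
Qed.

Lemma smooth_on_continuous V (f : M -> R) x : open V -> V x -> smooth_on mM V f ->
  {for x, continuous f}.
Proof.
move=> oV Vx sf; set c := chart_at mM x; have cx := chart_atP mM x.
have df := smooth_on_differentiable sf Vx cx.
have cf : {for x, continuous ((fun a => f (param c a)) \o coord c)}.
  apply: continuous_comp; first exact: coord_continuous.
  exact: differentiable_continuous df.
have fE : \forall y \near x, ((fun a => f (param c a)) \o coord c) y = f y.
  have : nbhs x (dom c) by apply: open_nbhs_nbhs; split => //; exact: dom_open.
  by apply: filterS => y cy /=; rewrite coordK.
have fx : f x = ((fun a => f (param c a)) \o coord c) x by rewrite /= coordK.
suff : f @ x --> f x by [].
by rewrite fx; exact: (cvg_trans (near_eq_cvg fE) cf).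
Qed.

End ComplexCalculus.

(** * The derivative of a curve of spin elements at the unit *)

Section SpinDerivative.
Context {R : realType} {n : nat} {M : topologicalType}.
Context {mM : oriented_manifold R n M}.
Variables (V : set M) (x : M) (v : 'rV[R]_n) (a : M -> cliff_alg R n).
Hypotheses (oV : open V) (Vx : V x).
Hypothesis a_spin : forall y, V y -> is_spin (a y).
Hypothesis sa : forall S, smooth_on mM V (fun y => a y S).
Hypothesis sl : forall i j, smooth_on mM V (fun y => lambda (a y) i j).
Hypothesis ax : a x = cl_one.

(** Differentiating [a e_j = (lambda a e_j) a] at the unit gives the commutator of the derivative of
    [a] with every generator. Evenness and unit norm remove the odd and scalar parts, the only ones
    that [even_commutator] could not recover. The result inverts the differential of the double
    covering. *)
Lemma spin_derivative T : tder mM x v (fun y => a y T)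
  = \sum_(i < n) \sum_(j < n | (i < j)%N) (T == [set i; j]%SET)%:R
      * (2^-1 * tder mM x v (fun y => lambda (a y) j i)).
Proof.
pose a' : cliff_alg R n := [ffun S => tder mM x v (fun y => a y S)].
pose L' := \matrix_(i, j) tder mM x v (fun y => lambda (a y) i j).
have -> : tder mM x v (fun y => a y T) = a' T by rewrite ffunE.
rewrite (@even_commutator _ _ a' L').
- by apply: eq_bigr => i _; apply: eq_bigr => j _; rewrite mxE.
(* At the unit only the scalar coefficient is nonzero, so the derivative of the constant norm is
   twice the scalar part of the derivative of [a]. *)
- have : tder mM x v (fun y => \sum_S a y S * a y S) = 0.
    apply: (etrans _ (tder_cst (mM := mM) x v 1)); apply: (tder_eq _ oV Vx) => y Vy.
    exact: (spin_norm (a_spin Vy)).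
  rewrite (tder_sum _ _ oV) // => [|S _]; last exact: smooth_onM.
  rewrite (bigD1 finset.set0) //= big1 => [|S S0].
    by rewrite addr0 (tderM _ (sa _) (sa _) Vx) ax !ffunE eqxx mulr1 mul1r; lra.
  by rewrite (tderM _ (sa _) (sa _) Vx) ax !ffunE (negPf S0) mulr0 mul0r addr0.
- move=> S oS; rewrite ffunE -(tder_cst (mM := mM) x v 0).
  by apply: (tder_eq _ oV Vx) => y Vy; rewrite spin_even //; exact: a_spin.
(* [U] is chosen so that the coefficient of [e_U] in [a e_j] consists of the single term in
   [a S]. *)
move=> j S; set U := symdiff S [set j]%SET.
have jU : symdiff [set j]%SET U = S by rewrite /U [symdiff S _]symdiffC symdiffK.
have commE y : V y -> cl_sign S [set j]%SET * a y S
    = \sum_i (cl_sign [set i]%SET (symdiff [set i]%SET U) * lambda (a y) i j)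
             * a y (symdiff [set i]%SET U).
  move=> Vy; have := lambdaP (a_spin Vy) j => /ffunP/(_ U).
  rewrite cl_mul_vecr cl_mul_vecl (bigD1 j) //= big1 ?addr0 => [|i ij].
    rewrite mxE !eqxx mul1r jU => ->; apply: eq_bigr => i _.
    by rewrite !mxE [lambda _ _ _ * _]mulrC.
  by rewrite mxE (negPf ij) andbF !mul0r.
have := tder_eq (mM := mM) v oV Vx commE.
have sT i (_ : true) : smooth_on mM V (fun y => (cl_sign [set i]%SET
    (symdiff [set i]%SET U) * lambda (a y) i j) * a y (symdiff [set i]%SET U)).
  exact: (smooth_onM oV (smooth_onZ _ oV (sl i j)) (sa _)).
have E1 : tder mM x v (fun y => cl_sign S [set j]%SET * a y S)
    = cl_sign S [set j]%SET * tder mM x v (fun y => a y S) := tderZ _ _ (sa S) Vx.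
rewrite E1 (tder_sum _ _ oV sT Vx).
have termE i : tder mM x v (fun y => (cl_sign [set i]%SET (symdiff [set i]%SET U)
      * lambda (a y) i j) * a y (symdiff [set i]%SET U))
    = L' i j * (U == [set i]%SET)%:R
      + (i == j)%:R * (cl_sign [set j]%SET S * a' S).
  rewrite (tderM _ (smooth_onZ _ oV (sl i j)) (sa _) Vx).
  have -> : tder mM x v (fun y => cl_sign [set i]%SET (symdiff [set i]%SET U) * lambda (a
    y) i j)
    = cl_sign [set i]%SET (symdiff [set i]%SET U) * tder mM x v (fun y => lambda (a y) i j)
    := tderZ _ _ (sl i j) Vx.
  rewrite ax lambda1 !mxE [cl_one _]ffunE symdiff_eq symdiff0 ffunE; congr (_ + _).
    case: (eqVneq U [set i]%SET) => [->|]; last by rewrite !mulr0.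
    by rewrite symdiffxx cl_sign0r mul1r.
  by case: (eqVneq i j) => [->|]; rewrite ?jU ?mulr0 ?mul0r // mulr1 mul1r.
under eq_bigr do rewrite termE.
have tailE : \sum_i (i == j)%:R * (cl_sign [set j]%SET S * a' S)
    = cl_sign [set j]%SET S * a' S.
  by rewrite (bigD1 j) //= eqxx mul1r big1 ?addr0 // => i /negPf->; rewrite mul0r.
rewrite big_split /= tailE => E.
rewrite mulrBl [X in X - _](_ : _ = cl_sign S [set j]%SET * tder mM x v (fun y => a y S)).
  by rewrite E addrK.
by rewrite ffunE.
Qed.

End SpinDerivative.

(** * Local sections and gauge invariance *)

Section SpinTGroup.
Context {R : realType} {n : nat}.
Implicit Types (t : spinT_rep R n).

Lemma is_spinT_one : is_spinT (spinT_one : spinT_rep R n).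
Proof. by split; rewrite /= ?normr1 //; exact: is_spin_one. Qed.

Lemma is_spinT_mul t t' : is_spinT t -> is_spinT t' -> is_spinT (spinT_mul t t').
Proof.
move=> [a1 z1 w1] [a2 z2 w2]; split; first exact: is_spin_mul.
  by rewrite normrM z1 z2 mulr1.
by rewrite normrM w1 w2 mulr1.
Qed.

Lemma norm1_neq0 (z : R[i]) : `|z| = 1 -> z != 0.
Proof. by move=> z1; rewrite -normr_eq0 z1 oner_neq0. Qed.

Lemma is_spinT_inv t : is_spinT t -> exists2 t', is_spinT t' & spinT_mul t t' = spinT_one.
Proof.
move=> [/is_spin_inv[b sb [ab _]] z1 w1].
exists (b, t.1.2^-1, t.2^-1); first by split; rewrite ?normfV ?z1 ?w1 ?invr1.
by rewrite /spinT_mul /= ab !mulfV ?norm1_neq0.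
Qed.

Lemma is_spinT_opp t : (0 < n)%N -> is_spinT t ->
  is_spinT (- t.1.1, - t.1.2, - t.2).
Proof.
by move=> n0 [a1 z1 w1]; split; rewrite /= ?normrN //; exact: is_spin_opp.
Qed.

Lemma lT_fiber (z1 z2 w1 w2 : R[i]) : z1 != 0 ->
  w1 ^+ 2 = z1 ^+ 2 -> w1 * w2 = z1 * z2 ->
  (w1 = z1 /\ w2 = z2) \/ (w1 = - z1 /\ w2 = - z2).
Proof.
move=> z10 /eqP; rewrite eqf_sqr => /orP[/eqP->|/eqP->].
  by move=> /(mulfI z10); left.
by rewrite mulNr -mulrN => /(mulfI z10) <-; right; rewrite opprK.
Qed.

End SpinTGroup.

Section SpinTBundle.
Context {R : realType} {n : nat} {M : topologicalType}.
Context {mM : oriented_manifold R n M} {g : riemannian_metric mM}.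
Variable P : spinT_structure g.
Hypothesis n0 : (0 < n)%N.
Implicit Types (p q : total_space P) (t : spinT_rep R n) (V W : set M).
Implicit Types (s : M -> total_space P).

(** For the inclusion from right to left, a triple with the same image under [lT] has the same two
    circle components up to a common sign. The sign is absorbed by replacing the spin part with its
    opposite, since opposite triples act alike; this is where [-1] must belong to Spin(n). *)
Lemma spin_orbit_act p t : is_spinT t ->
  spin_orbit (act p t) = torus_act (spin_orbit p) (lT t).
Proof.
move=> tT; have [sa z1 w1] := tT; apply/seteqP; split=> q.
  move=> [b sb ->]; have bT : is_spinT ((b, 1, 1) : spinT_rep R n).
    by split; rewrite /= ?normr1.
  rewrite act_mul //; exists p, (spinT_mul t (b, 1, 1)); split=> //.
  - exists cl_one; first exact: is_spin_one.
    by rewrite -/(spinT_one) act_one.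
  - exact: is_spinT_mul.
  - by rewrite /lT /= !mulr1.
move=> [_ [t' [[b sb ->] t'T lTE ->]]].
have bT : is_spinT ((b, 1, 1) : spinT_rep R n) by split; rewrite /= ?normr1.
have [a' sa' [aa' a'a]] := is_spin_inv sa.
have [sa2 z1' w1'] := t'T.
rewrite act_mul //.
have orbitP c : is_spin c -> spin_orbit (act p t) (act p (c, t.1.2, t.2)).
  move=> sc; exists (cl_mul a' c); first exact: is_spin_mul.
  have acT : is_spinT ((cl_mul a' c, 1, 1) : spinT_rep R n).
    by split; rewrite /= ?normr1 //; exact: is_spin_mul.
  by rewrite act_mul // /spinT_mul /= cl_mulA aa' cl_mul1l !mulr1.
have sba : is_spin (cl_mul b t'.1.1) by exact: is_spin_mul.
rewrite /spinT_mul /= !mul1r.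
case: lTE => lT1 lT2; have [[-> ->]|[-> ->]] := lT_fiber (norm1_neq0 z1) lT1 lT2.
  exact: orbitP.
suff -> : act p (cl_mul b t'.1.1, - t.1.2, - t.2)
        = act p (- cl_mul b t'.1.1, t.1.2, t.2).
  exact/orbitP/is_spin_opp.
have T1 : is_spinT ((- cl_mul b t'.1.1, t.1.2, t.2) : spinT_rep R n).
  by split=> //; exact: is_spin_opp.
apply/act_free => //; last by right; rewrite /= !opprK.
by split; rewrite /= ?normrN.
Qed.

Lemma transporterP p q : proj p = proj q ->
  is_spinT (transporter p q) /\ act p (transporter p q) = q.
Proof.
move=> pq; have [t tT tq] := act_trans pq.
exact: (@xgetPex _ spinT_one [set t | is_spinT t /\ act p t = q]
  (ex_intro _ t (conj tT tq))).
Qed.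

Lemma smooth_spinT_subset V W (h : M -> spinT_rep R n) : W `<=` V ->
  smooth_spinT (mM := mM) V h -> smooth_spinT (mM := mM) W h.
Proof.
move=> WV [hT h1 h2 h3]; split.
- by move=> y /WV; exact: hT.
- by move=> S; exact: smooth_on_subset WV (h1 S).
- exact: csmooth_on_subset WV h2.
- exact: csmooth_on_subset WV h3.
Qed.

Lemma smooth_spinT_mul V (h k : M -> spinT_rep R n) : open V ->
  smooth_spinT (mM := mM) V h -> smooth_spinT (mM := mM) V k ->
  smooth_spinT (mM := mM) V (fun y => spinT_mul (h y) (k y)).
Proof.
move=> oV [hT h1 h2 h3] [kT k1 k2 k3]; split.
- by move=> y Vy; apply: is_spinT_mul; [exact: hT|exact: kT].
- move=> S; apply: (smooth_on_eq oV (f := fun y => \sum_A cl_sign A (symdiff A S)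
      * (h y).1.1 A * (k y).1.1 (symdiff A S))).
    by move=> y _; rewrite cl_mulE.
  apply: (smooth_on_sum _ oV) => A _; apply: (smooth_onM oV) => //.
  exact: smooth_onZ.
- exact: csmooth_onM.
- exact: csmooth_onM.
Qed.

Lemma smooth_spinT_cst V t : is_spinT t -> smooth_spinT (mM := mM) V (fun=> t).
Proof.
by move=> tT; split=> // *; [exact: smooth_on_cst|exact: csmooth_on_cst|exact: csmooth_on_cst].
Qed.

Lemma smooth_spinT_opp V (h : M -> spinT_rep R n) : open V ->
  smooth_spinT (mM := mM) V h ->
  smooth_spinT (mM := mM) V (fun y => (- (h y).1.1, - (h y).1.2, - (h y).2)).
Proof.
move=> oV [hT h1 h2 h3]; split.
- by move=> y Vy; apply: is_spinT_opp => //; exact: hT.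
- move=> S /=; apply: (smooth_on_eq oV _ (smooth_onN oV (h1 S))).
  by move=> y _; rewrite ffunE.
- apply: (csmooth_on_eq oV _ (csmooth_onM oV (csmooth_on_cst V (-1)) h2)).
  by move=> y _; rewrite mulN1r.
- apply: (csmooth_on_eq oV _ (csmooth_onM oV (csmooth_on_cst V (-1)) h3)).
  by move=> y _; rewrite mulN1r.
Qed.

Lemma smooth_section_subset V W s : open W -> W `<=` V ->
  smooth_section V s -> smooth_section W s.
Proof.
move=> oW WV [oV sV]; split=> // i x [Wx ix].
have [U [h [[oU Ux] UV hs hE]]] := sV i x (conj (WV x Wx) ix).
exists (U `&` W), h; split.
- by split; [exact: openI|].
- by move=> y [/UV[_ iy] Wy].
- by apply: smooth_spinT_subset hs => y [].
- by move=> y [Uy _]; exact: hE.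
Qed.

Lemma smooth_section_act_lsec i t : is_spinT t ->
  smooth_section (ldom i) (fun y => act (lsec (s := P) i y) t).
Proof.
move=> tT; split=> [|j x [ix jx]]; first exact: ldom_open.
have [U [h [oU UV hs hE]]] := lsec_smooth (conj jx ix).
exists U, (fun y => spinT_mul (h y) t); split=> //.
- by move=> y /UV[].
- by apply: smooth_spinT_mul => //; [case: oU|exact: smooth_spinT_cst].
- move=> y Uy; rewrite hE // act_mul //.
  by have [hT _ _ _] := hs; exact: hT.
Qed.

Lemma smooth_torus_section_orbit V s : smooth_section V s ->
  smooth_torus_section V (fun y => spin_orbit (s y)).
Proof.
move=> sV; have [oV _] := sV; split=> // x Vx.
by exists V, s; split=> //; split.
Qed.

Lemma row_frame_act p t k : is_spinT t ->
  row k (frame (act p t)) = \sum_m lambda t.1.1 m k *: row m (frame p).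
Proof.
move=> tT; rewrite frame_act // row_mul mulmx_sum_row; apply: eq_bigr => m _.
by rewrite !mxE.
Qed.

Lemma smooth_frame_act_lsec i t k : is_spinT t ->
  smooth_vf mM (ldom i) (fun y => row k (frame (act (lsec (s := P) i y) t))).
Proof.
move=> tT; apply: (smooth_vf_eq (X := fun y => \sum_m lambda t.1.1 m k *:
    row m (frame (lsec (s := P) i y)))).
  by move=> y iy; rewrite row_frame_act.
apply: smooth_vf_sum => m; apply: smooth_vfZ; first exact: smooth_on_cst.
exact: frame_smooth.
Qed.

Lemma frame_orthonormal_rows p i j :
  inner (gram g) (proj p) (row i (frame p)) (row j (frame p)) = (i == j)%:R.
Proof.
have := frame_orthonormal p => /matrixP/(_ i j); rewrite [RHS]mxE => <-.
rewrite /inner -row_mul !mxE; apply: eq_bigr => k _; congr (_ * _); by rewrite !mxE.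
Qed.

(** The transition map between the translated sections lifts to triples near [x]. At [x] it
    represents the unit, so its lift is the unit triple or the opposite one; in the second case the
    opposite lift is used, which acts in the same way. *)
Lemma sections_related i j t0 t1 x : is_spinT t0 -> is_spinT t1 ->
  ldom (s := P) i x -> ldom (s := P) j x ->
  act (lsec i x) t0 = act (lsec j x) t1 ->
  exists V h, [/\ open_nbhs x V, V `<=` ldom (s := P) i `&` ldom (s := P) j,
    smooth_spinT (mM := mM) V h, h x = spinT_one &
    forall y, V y -> act (lsec j y) t1 = act (act (lsec i y) t0) (h y)].
Proof.
move=> t0T t1T ix jx s01.
have [U [h [oU UV hs hE]]] := lsec_smooth (conj ix jx).
have [hT _ _ _] := hs.
have [t0' t0'T t0K] := is_spinT_inv t0T.
pose k y := spinT_mul t0' (spinT_mul (h y) t1).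
have oU' : open U by case: oU.
have Ux : U x by case: oU.
have ks : smooth_spinT (mM := mM) U k.
  apply: (smooth_spinT_mul oU'); first exact: smooth_spinT_cst.
  by apply: (smooth_spinT_mul oU') => //; exact: smooth_spinT_cst.
have [kT _ _ _] := ks.
have kE y : U y -> act (lsec j y) t1 = act (act (lsec i y) t0) (k y).
  move=> Uy; have hy := hT y Uy.
  have hyT : is_spinT (spinT_mul (h y) t1) by exact: is_spinT_mul.
  rewrite hE // act_mul // /k -[in RHS](act_mul _ t0'T hyT).
  by rewrite (act_mul (lsec i y) t0T t0'T) t0K act_one.
have kx : spinT_eq (k x) spinT_one.
  apply/(act_free (act (lsec i x) t0)); [exact: kT|exact: is_spinT_one|].
  by rewrite -kE // act_one.
case: kx => kx; first by exists U, k; split.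
exists U, (fun y => (- (k y).1.1, - (k y).1.2, - (k y).2)); split=> //.
- exact: smooth_spinT_opp.
- move=> y Uy; rewrite kE //; apply/act_free; [exact: kT| |by right].
  by apply: is_spinT_opp => //; exact: kT.
Qed.

End SpinTBundle.

(** * Invariance of the spinor derivative under a change of section *)

Section Gauge.
Context {R : realType} {n : nat} {M : topologicalType}.
Context {mM : oriented_manifold R n M} {g : riemannian_metric mM}.
Context {P : spinT_structure g}.
Variable AB : torus_connection P.
Variable gam : 'I_n -> 'M[R[i]]_(spinor_dim n).
Variable psi : total_space P -> 'cV[R[i]]_(spinor_dim n).
Hypothesis psiP : is_spinor_field gam psi.
Hypothesis n0 : (0 < n)%N.
Implicit Types (p q : total_space P) (t : spinT_rep R n) (V W : set M).
Implicit Types (s : M -> total_space P) (X : M -> 'rV[R]_n).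
Local Notation ip y u v := (inner (gram g) y u v).

(* [spin_nabla] in the trivialization given by an arbitrary local section. *)
Definition nabla_along s X psi (x : M) : 'cV[R[i]]_(spinor_dim n) :=
  let e i y := row i (frame (s y)) in
  let sigma y := spin_orbit (s y) in
  mxtder mM x (X x) (fun y => psi (s y))
  + 2%:R^-1 *: (\sum_(i < n) \sum_(j < n | (i < j)%N)
      (ip x (nabla g X (e i) x) (e j x))%:C *: (gam i *m gam j *m psi (s x)))
  + (2%:R^-1 * fapp (locA AB sigma) x (X x)) *: psi (s x)
  + fapp (locB AB sigma) x (X x) *: psi (s x).

Lemma smooth_psi_act_lsec i t : is_spinT t ->
  smooth_mx (mM := mM) (ldom i) (fun y => psi (act (lsec (s := P) i y) t)).
Proof.
move=> tT; apply: (smooth_mx_eq (ldom_open i)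
  (F := fun y => invmx (kappaT gam t) *m psi (lsec (s := P) i y))).
  by move=> y _; rewrite (spinor_equivariant psiP).
apply: (smooth_mxM (ldom_open i)); first exact: smooth_mx_cst.
by move=> k j; rewrite ord1; exact: (spinor_smooth psiP).
Qed.

Lemma smooth_kappa V (a : M -> cliff_alg R n) : open V ->
  (forall S, smooth_on mM V (fun y => a y S)) ->
  smooth_mx (mM := mM) V (fun y => kappa gam (a y)).
Proof.
move=> oV sa; apply: (smooth_mx_sum _ oV) => S _; apply: (smooth_mxZ oV).
  exact: csmooth_on_real.
exact: smooth_mx_cst.
Qed.

Lemma mxtder_kappa V x v (a : M -> cliff_alg R n) : open V -> V x ->
  (forall S, smooth_on mM V (fun y => a y S)) ->
  mxtder mM x v (fun y => kappa gam (a y))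
  = kappa gam [ffun S => tder mM x v (fun y => a y S)].
Proof.
move=> oV Vx sa; rewrite /kappa (mxtder_sum _ _ oV Vx) => [|S _].
  apply: eq_bigr => S _; rewrite ffunE.
  rewrite (mxtderZ _ oV Vx (csmooth_on_real (sa S)) (smooth_mx_cst V _)).
  by rewrite mxtder_cst scaler0 addr0 ctder_real.
apply: (smooth_mxZ oV); last exact: smooth_mx_cst.
exact: csmooth_on_real.
Qed.

(** The scalar part is the derivative of the weight [z1^2 z2] at the unit, and the matrix part is
    [spin_derivative] carried to matrices by [kappa_pairs]. *)
Lemma mxtder_kappaT V x v (h : M -> spinT_rep R n) : V x -> open V ->
  smooth_spinT (mM := mM) V h -> h x = spinT_one ->
  (forall i j, smooth_on mM V (fun y => lambda (h y).1.1 i j)) ->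
  mxtder mM x v (fun y => kappaT gam (h y))
  = (2 * ctder mM x v (fun y => (h y).1.2) + ctder mM x v (fun y => (h y).2))%:M
  + \sum_(i < n) \sum_(j < n | (i < j)%N)
      (2^-1 * tder mM x v (fun y => lambda (h y).1.1 j i))%:C *: (gam i *m gam j).
Proof.
move=> Vx oV [hT h1 h2 h3] hx sl.
have sz2 : csmooth_on mM V (fun y => (h y).1.2 * (h y).1.2) by exact: csmooth_onM.
have sz : csmooth_on mM V (fun y => (h y).1.2 * (h y).1.2 * (h y).2) by exact: csmooth_onM.
have -> : (fun y => kappaT gam (h y)) =
    (fun y => ((h y).1.2 * (h y).1.2 * (h y).2) *: kappa gam (h y).1.1).
  by apply/funext => y; rewrite /kappaT expr2.
rewrite (mxtderZ _ oV Vx sz (smooth_kappa oV h1)) (mxtder_kappa _ oV Vx h1).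
rewrite hx /= kappa1 !mulr1 scale1r.
rewrite (ctderM _ oV sz2 h3 Vx) (ctderM _ oV h2 h2 Vx) hx /= !mulr1 !mul1r.
rewrite -mulr2n -[_ *+ 2]mulr_natl scalemx1; congr (_ + _).
apply: kappa_pairs => T; rewrite ffunE.
by apply: (spin_derivative _ oV Vx) => //; [move=> y /hT[]|rewrite hx].
Qed.

Lemma fapp_dlog (w : M -> R[i]) x v : fapp (dlog mM w) x v = (w x)^-1 * ctder mM x v w.
Proof.
rewrite /fapp {2}[v]row_sum_delta ctder_sumv mulr_sumr; apply: eq_bigr => k _.
by rewrite ctderZv mxE mulrCA.
Qed.

Lemma fappD (a b : M -> 'rV[R[i]]_n) x v c : a x = b x + c x ->
  fapp a x v = fapp b x v + fapp c x v.
Proof.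
move=> abc; rewrite /fapp -big_split; apply: eq_bigr => k _.
by rewrite abc mxE mulrDr.
Qed.

(** Equivariance of spinor fields is written with [invmx], which is an inverse only on invertible
    matrices. For derivatives at [x] a neighbourhood is enough, and positivity of the real part of
    the determinant is an open condition that holds at [x]. *)
Lemma near_unitmx V x N (K : M -> 'M[R[i]]_N) : open V -> V x ->
  smooth_mx (mM := mM) V K -> K x = 1%:M ->
  exists W, [/\ open W, W `<=` V, W x & forall y, W y -> K y \in unitmx].
Proof.
move=> oV Vx sK Kx.
have sdet : csmooth_on mM V (fun y => \det (K y)).
  apply: (csmooth_on_sum _ oV) => s _; apply: (csmooth_onM oV).
    exact: csmooth_on_cst.
  by apply: (csmooth_on_prod _ oV) => i _; exact: sK.
have cdet := smooth_on_continuous oV Vx sdet.1.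
have near_pos : \forall y \near x, 0 < complex.Re (\det (K y)).
  by apply: (cdet _ (lt_nbhsr _)); rewrite Kx det1 /= ltr01.
have nearV : \forall y \near x, V y by exact: open_nbhs_nbhs.
have [W [oW Wx] WP] : exists2 W, open_nbhs x W &
    W `<=` [set y | 0 < complex.Re (\det (K y)) /\ V y].
  have : nbhs x [set y | 0 < complex.Re (\det (K y)) /\ V y] by exact: filterI near_pos nearV.
  by rewrite nbhsE.
exists W; split=> //; first by move=> y /WP[].
move=> y /WP[pos _]; rewrite unitmxE unitfE; apply: contraTneq pos => ->.
by rewrite /= ltxx.
Qed.

(** This is where the weights of the two connection forms matter: [1/2] of the correction [2 z1] to
    [A], plus the correction [z1 + z2] to [B], equals the derivative [2 z1 + z2] of the weight of
    [kappaT]. The term [D] is the change of the frame. *)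
Fact gauge_cancel N (A S D u : 'cV[R[i]]_N) (a b z1 z2 : R[i]) :
  A + 2%:R^-1 *: (S + D) + (2%:R^-1 * (a + 2 * z1)) *: u + (b + (z1 + z2)) *: u
  = (2 * z1 + z2) *: u + 2%:R^-1 *: D + A + 2%:R^-1 *: S + (2%:R^-1 * a) *: u + b *: u.
Proof. by apply/colP => k; rewrite !mxE; field. Qed.

(** Since [h] is the unit at [x], only its first derivative enters. It appears through [kappaT],
    through the frame and through the connection forms, and the three contributions compensate. *)
Lemma nabla_along_gauge V s s' (h : M -> spinT_rep R n) X x :
  open V -> V x -> smooth_vf mM V X ->
  smooth_section V s -> smooth_section V s' ->
  (forall y, V y -> proj (s y) = y) ->
  (forall k, smooth_vf mM V (fun y => row k (frame (s y)))) ->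
  (forall k, smooth_vf mM V (fun y => row k (frame (s' y)))) ->
  smooth_mx (mM := mM) V (fun y => psi (s y)) ->
  smooth_mx (mM := mM) V (fun y => psi (s' y)) ->
  smooth_spinT (mM := mM) V h -> h x = spinT_one ->
  (forall y, V y -> s' y = act (s y) (h y)) ->
  nabla_along s' X psi x = nabla_along s X psi x.
Proof.
move=> oV Vx sX sS sS' projs se se' spsi spsi' hs hx hE.
have [hT h1 h2 h3] := hs.
have s'x : s' x = s x by rewrite hE // hx act_one.
pose e k y := row k (frame (s y)); pose e' k y := row k (frame (s' y)).
have eo y i j : V y -> ip y (e i y) (e j y) = (i == j)%:R.
  by move=> Vy; have := frame_orthonormal_rows (s y) i j; rewrite projs.
pose ell k i y := lambda (h y).1.1 k i.
have e'E k y : V y -> e' k y = \sum_m ell m k y *: e m y.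
  by move=> Vy; rewrite /e' hE // row_frame_act //; exact: hT.
have ellE m k y : V y -> ip y (e' k y) (e m y) = ell m k y.
  by move=> Vy; rewrite e'E // (inner_sum_frame eo (fun m => ell m k y)).
(* [smooth_spinT] controls the spin component of [h] but not the matrix chosen by [lambda]; the
   entries of that matrix are scalar products of the two frames, which are smooth. *)
have sell i j : smooth_on mM V (ell i j).
  apply: (smooth_on_eq oV (f := fun y => ip y (e' j y) (e i y))) => [y Vy|].
    exact: ellE.
  exact: (smooth_inner g oV (se' j) (se i)).
have ellx i j : ell i j x = (i == j)%:R by rewrite /ell hx lambda1 mxE.
pose z1 := ctder mM x (X x) (fun y => (h y).1.2).
pose z2 := ctder mM x (X x) (fun y => (h y).2).
pose d i j := tder mM x (X x) (ell j i).
have frameE i j : ip x (nabla g X (e' i) x) (e j x)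
    = ip x (nabla g X (e i) x) (e j x) + d i j.
  rewrite (nabla_eq g oV Vx (fun y _ => erefl (X y)) (e'E i)).
  rewrite (nabla_sumr g oV _ Vx sX (fun m => sell m i) se) big_split /= innerDl.
  rewrite (inner_sum_frame eo (fun m => tder mM x (X x) (ell m i))) //.
  rewrite (bigD1 i) //= [X in ip _ (_ + X) _]big1 ?addr0.
    by rewrite ellx eqxx scale1r.
  by move=> m mi; rewrite ellx (negPf mi) scale0r.
(* The pair is [lT (h y)], by which the induced sections of the torus bundle differ according to
   [spin_orbit_act]. *)
pose w1 y := (h y).1.2 ^+ 2; pose w2 y := (h y).1.2 * (h y).2.
have sw1 : csmooth_on mM V w1 by exact: csmooth_onM.
have sw2 : csmooth_on mM V w2 by exact: csmooth_onM.
have [gaugeA gaugeB] := loc_gauge AB (smooth_torus_section_orbit sS)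
  (smooth_torus_section_orbit sS') sw1 sw2
  (fun y Vy => let: And3 _ b c := hT y Vy in
     And3 (etrans (normrX 2 _) (etrans (f_equal (fun z => z ^+ 2) b) (expr1n _ 2)))
          (etrans (normrM _ _) (etrans (f_equal2 *%R b c) (mulr1 1)))
          (etrans (f_equal _ (hE y Vy)) (spin_orbit_act n0 (s y) (hT y Vy)))) Vx.
have w1x : fapp (dlog mM w1) x (X x) = 2 * z1.
  rewrite fapp_dlog /w1 hx /= expr1n invr1 mul1r (ctderM _ oV h2 h2 Vx) hx /=.
  by rewrite mul1r mulr1 -mulr2n mulr_natl.
have w2x : fapp (dlog mM w2) x (X x) = z1 + z2.
  by rewrite fapp_dlog /w2 hx /= mulr1 invr1 mul1r (ctderM _ oV h2 h3 Vx) hx /= mul1r mulr1.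
have AE := fappD (X x) gaugeA; have BE := fappD (X x) gaugeB.
(* Near [x], equivariance is solved for [psi (s y)], so that [kappaT] itself is differentiated and
   not its inverse. *)
have psiE : mxtder mM x (X x) (fun y => psi (s y)) =
    ((2 * z1 + z2)%:M + \sum_(i < n) \sum_(j < n | (i < j)%N)
      (2^-1 * d i j)%:C *: (gam i *m gam j)) *m psi (s x)
    + mxtder mM x (X x) (fun y => psi (s' y)).
  have sK : smooth_mx (mM := mM) V (fun y => kappaT gam (h y)).
    apply: (smooth_mxZ oV); last exact: smooth_kappa.
    by apply: (csmooth_onM oV) => //; exact: sw1.
  have Kx : kappaT gam (h x) = 1%:M.
    by rewrite hx /kappaT /= expr1n mulr1 scale1r kappa1.
  have [W [oW WV Wx WK]] := near_unitmx oV Vx sK Kx.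
  have psiW y : W y -> psi (s y) = kappaT gam (h y) *m psi (s' y).
    move=> Wy; rewrite hE ?(spinor_equivariant psiP) ?mulKVmx //; first exact: WK.
    + exact/hT/WV.
    + exact: WV.
  rewrite (mxtder_eq _ oW Wx psiW) (mxtderM _ oV Vx sK spsi') Kx mul1mx s'x.
  by rewrite (mxtder_kappaT _ Vx oV hs hx sell).
rewrite /nabla_along psiE s'x AE BE w1x w2x.
have sumE : \sum_(i < n) \sum_(j < n | (i < j)%N)
      (ip x (nabla g X (e' i) x) (e j x))%:C *: (gam i *m gam j *m psi (s x))
    = \sum_(i < n) \sum_(j < n | (i < j)%N)
      (ip x (nabla g X (e i) x) (e j x))%:C *: (gam i *m gam j *m psi (s x))
    + \sum_(i < n) \sum_(j < n | (i < j)%N)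
      (d i j)%:C *: (gam i *m gam j *m psi (s x)).
  rewrite -big_split; apply: eq_bigr => i _; rewrite -big_split; apply: eq_bigr => j _.
  apply: (etrans (f_equal (fun c : R => c%:C *: _) (frameE i j))).
  by rewrite rmorphD scalerDl.
have dE : (\sum_(i < n) \sum_(j < n | (i < j)%N)
      (2^-1 * d i j)%:C *: (gam i *m gam j)) *m psi (s x)
    = 2%:R^-1 *: \sum_(i < n) \sum_(j < n | (i < j)%N)
      (d i j)%:C *: (gam i *m gam j *m psi (s x)).
  rewrite mulmx_suml scaler_sumr; apply: eq_bigr => i _.
  rewrite mulmx_suml scaler_sumr; apply: eq_bigr => j _.
  by rewrite -scalemxAl scalerA rmorphM fmorphV rmorph_nat.
rewrite mulmxDl mul_scalar_mx dE.
apply: (etrans _ (gauge_cancel _ _ _ _ _ _ _ _)).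
apply: (f_equal (fun S => _ + _ *: S + _ + _)); exact: sumE.
Qed.

Lemma sec_at_proj p : sec_at p (proj p) = p.
Proof.
have ip := triv_atP P (proj p).
by rewrite /sec_at; have [] := transporterP (lsecP ip).
Qed.

Lemma transporter_spinT p :
  is_spinT (transporter (lsec (triv_at P (proj p)) (proj p)) p).
Proof. by have [] := transporterP (lsecP (triv_atP P (proj p))). Qed.

Lemma spin_nablaE X p : spin_nabla AB gam X psi p = nabla_along (sec_at p) X psi (proj p).
Proof.
have psi_at : psi (sec_at p (proj p)) = psi p by rewrite sec_at_proj.
rewrite /nabla_along psi_at; reflexivity.
Qed.

(** At [sec_at p y] the definition uses the trivialization chosen at [y], translated to pass through
    that point. It meets the section [sec_at p] there, so gauge invariance allows the return to
    [sec_at p], which is independent of [y]. *)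
Lemma spin_nabla_sec_at p X y : ldom (triv_at P (proj p)) y ->
  (exists V, [/\ open V, V y & smooth_vf mM V X]) ->
  spin_nabla AB gam X psi (sec_at p y) = nabla_along (sec_at p) X psi y.
Proof.
move=> iy [U [oU Uy sX]]; set i := triv_at P (proj p).
set q := sec_at p y; set t0 := transporter (lsec i (proj p)) p.
have t0T : is_spinT t0 := transporter_spinT p.
have qy : proj q = y by rewrite /q /sec_at proj_act // lsecP.
rewrite spin_nablaE qy; set j := triv_at P (proj q).
have jy : ldom j y by rewrite -qy; exact: triv_atP.
set t1 := transporter (lsec j (proj q)) q.
have t1T : is_spinT t1 := transporter_spinT q.
have s01 : act (lsec i y) t0 = act (lsec j y) t1.
  have sec_q : sec_at q y = q by rewrite -[RHS]sec_at_proj qy.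
  exact: esym sec_q.
have [V [h [[oV Vy] Vij hs hy hE]]] := sections_related n0 t0T t1T iy jy s01.
pose W := U `&` V; have oW : open W by exact: openI.
have WU : W `<=` U by move=> z [].
have Wi : W `<=` ldom i by move=> z [_ /Vij[]].
have Wj : W `<=` ldom j by move=> z [_ /Vij[]].
have WV : W `<=` V by move=> z [].
apply: (nabla_along_gauge oW _ (smooth_vf_subset WU sX) (h := h)) => //.
- exact: (smooth_section_subset oW Wi (smooth_section_act_lsec i t0T)).
- exact: (smooth_section_subset oW Wj (smooth_section_act_lsec j t1T)).
- by move=> z /Wi iz; rewrite /sec_at proj_act // lsecP.
- by move=> k; exact: (smooth_vf_subset Wi (smooth_frame_act_lsec k t0T)).
- by move=> k; exact: (smooth_vf_subset Wj (smooth_frame_act_lsec k t1T)).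
- exact: (smooth_mx_subset Wi (smooth_psi_act_lsec i t0T)).
- exact: (smooth_mx_subset Wj (smooth_psi_act_lsec j t1T)).
- exact: (smooth_spinT_subset WV hs).
- by move=> z /WV Vz; exact: hE.
Qed.

End Gauge.

(** * The local computation *)

Section SpinFormLinear.
Context {C : numFieldType} {n N : nat}.
Variable gam : 'I_n -> 'M[C]_N.
Local Notation spin_form := (spin_form gam).

Lemma spin_form_eq G G' : (forall a b, G a b = G' a b) -> spin_form G = spin_form G'.
Proof.
move=> GG; rewrite /spin_form; congr (_ *: _).
by apply: eq_bigr => a _; apply: eq_bigr => b _; rewrite GG.
Qed.

Lemma spin_formD G G' : spin_form (fun a b => G a b + G' a b) = spin_form G + spin_form G'.
Proof.
rewrite /spin_form -scalerDr -big_split; congr (_ *: _); apply: eq_bigr => a _.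
by rewrite -big_split; apply: eq_bigr => b _; rewrite scalerDl.
Qed.

Lemma spin_formZ c G : spin_form (fun a b => c * G a b) = c *: spin_form G.
Proof.
rewrite /spin_form scalerA mulrC -scalerA; congr (_ *: _); rewrite scaler_sumr.
by apply: eq_bigr => a _; rewrite scaler_sumr; apply: eq_bigr => b _; rewrite scalerA.
Qed.

Lemma spin_formN G : spin_form (fun a b => - G a b) = - spin_form G.
Proof. by rewrite -scaleN1r -spin_formZ; apply: spin_form_eq => a b; rewrite mulN1r. Qed.

Lemma spin_form_sum (I : Type) (r : seq I) (F : I -> 'I_n -> 'I_n -> C) :
  spin_form (fun a b => \sum_(k <- r) F k a b) = \sum_(k <- r) spin_form (F k).
Proof.
elim: r => [|k r IH].
  rewrite big_nil (@spin_form_eq _ (fun _ _ => 0 * 0)) ?spin_formZ ?scale0r // => a b.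
  by rewrite big_nil mul0r.
by rewrite big_cons -IH -spin_formD; apply: spin_form_eq => a b; rewrite big_cons.
Qed.

End SpinFormLinear.

(** The commutator of two operators of the form derivative plus matrix plus scalar. [P] is a second
    derivative and [B] the derivative along the bracket; [S] and [sa], the matrix and scalar parts
    along the bracket, are inserted and subtracted so that covariant derivatives reappear. *)
Fact commutator_expand (C : numFieldType) N (P B ui uj f : 'cV[C]_N)
    (Oi Oj dij dji S : 'M[C]_N) (ai aj daij daji sa : C) :
  P + B + (dij *m f + Oj *m ui) + (daij *: f + aj *: ui)
    + Oi *m (uj + Oj *m f + aj *: f) + ai *: (uj + Oj *m f + aj *: f)
  - (P + (dji *m f + Oi *m uj) + (daji *: f + ai *: uj)
    + Oj *m (ui + Oi *m f + ai *: f) + aj *: (ui + Oi *m f + ai *: f))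
  = B + S *m f + sa *: f + (dij - dji + (Oi *m Oj - Oj *m Oi) - S) *m f
    + (daij - daji - sa) *: f.
Proof.
rewrite !mulmxDr !mulmxBl !mulmxDl !mulNmx -!scalemxAr !mulmxA.
move: (Oj *m ui) (Oi *m uj) (Oi *m Oj *m f) (Oj *m Oi *m f) (Oi *m f) (Oj *m f).
move: (dij *m f) (dji *m f) (S *m f) => *.
by apply/colP => k; rewrite !mxE; ring.
Qed.

Section LocalWeitzenbock.
Context {R : realType} {n : nat} {M : topologicalType}.
Context {mM : oriented_manifold R n M}.
Variable g : riemannian_metric mM.
Local Notation ip y u v := (inner (gram g) y u v).
Variables (V : set M) (e : 'I_n -> M -> 'rV[R]_n).
Hypothesis oV : open V.
Hypothesis se : forall i, smooth_vf mM V (e i).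
Hypothesis eo : forall y i j, V y -> ip y (e i y) (e j y) = (i == j)%:R.
Variables (N : nat) (gam : 'I_n -> 'M[R[i]]_N).
Hypothesis gamP : forall i j, gam i *m gam j + gam j *m gam i
  = if i == j then (- 2%:R)%:M else 0.
Variable alpha : 'I_n -> M -> R[i].
Hypothesis salpha : forall j, csmooth_on mM V (alpha j).
Variable x : M.
Hypothesis Vx : V x.
Local Notation Gam i j k y := (christoffel g e i j k y).
Implicit Types (F : M -> 'cV[R[i]]_N).

Definition spin_conn j y : 'M[R[i]]_N := spin_form gam (fun a b => (Gam j a b y)%:C).

(** [alpha] is an arbitrary scalar connection form evaluated on the frame; the combination of
    [A / 2] and [B] is substituted for it at the end. *)
Definition frame_nabla j F y : 'cV[R[i]]_N :=
  mxtder mM y (e j y) F + spin_conn j y *m F y + alpha j y *: F y.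

Definition bracket_coef i j k : R := Gam i j k x - Gam j i k x.

(** The exterior derivative, on two frame fields, of the 1-form taking the value [alpha j] on [e j];
    the bracket term is expanded in the frame. *)
Definition frame_curv i j : R[i] := ctder mM x (e i x) (alpha j)
  - ctder mM x (e j x) (alpha i) - \sum_k (bracket_coef i j k)%:C * alpha k x.

Lemma smooth_spin_conn j : smooth_mx (mM := mM) V (spin_conn j).
Proof.
apply: (smooth_mxZ oV); first exact: csmooth_on_cst.
apply: (smooth_mx_sum _ oV) => a _; apply: (smooth_mx_sum _ oV) => b _.
apply: (smooth_mxZ oV); last exact: smooth_mx_cst.
exact/csmooth_on_real/smooth_christoffel.
Qed.

Lemma smooth_frame_nabla j F : smooth_mx (mM := mM) V F ->
  smooth_mx (mM := mM) V (frame_nabla j F).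
Proof.
move=> sF; apply: (smooth_mxD oV); last exact: (smooth_mxZ oV).
apply: (smooth_mxD oV); first exact: smooth_mxtder.
by apply: (smooth_mxM oV) => //; exact: smooth_spin_conn.
Qed.

Lemma frame_nabla_eq j F F' : (forall y, V y -> F y = F' y) ->
  frame_nabla j F x = frame_nabla j F' x.
Proof.
move=> FF; rewrite /frame_nabla (FF x Vx).
by apply: (f_equal (fun u => u + _ + _)); exact: (mxtder_eq _ oV Vx).
Qed.

Lemma spin_conn_anti j a b y : V y -> (Gam j b a y)%:C = - (Gam j a b y)%:C :> R[i].
Proof. by move=> Vy; rewrite (christoffel_anti oV eo j a b Vy) rmorphN. Qed.

(** Parallelism of Clifford multiplication: by [spin_form_comm], moving the derivative past [gam k]
    leaves exactly the Clifford action of the covariant derivative of [e k] along [e i]. *)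
Lemma frame_nabla_gam i (F : 'I_n -> M -> 'cV[R[i]]_N) :
  (forall k, smooth_mx (mM := mM) V (F k)) ->
  frame_nabla i (fun y => \sum_k gam k *m F k y) x
  = \sum_k gam k *m frame_nabla i (F k) x
  + \sum_k (\sum_l (Gam i k l x)%:C *: gam l) *m F k x.
Proof.
move=> sF.
have sgF k : smooth_mx (mM := mM) V (fun y => gam k *m F k y).
  by apply: (smooth_mxM oV) => //; exact: smooth_mx_cst.
rewrite /frame_nabla (mxtder_sum _ _ oV Vx (fun k _ => sgF k)).
rewrite mulmx_sumr scaler_sumr -!big_split; apply: eq_bigr => k _ /=.
rewrite (mxtder_mull _ _ oV Vx (sF k)) !mulmxDr -scalemxAr.
rewrite -(spin_form_comm gamP k (fun a b => spin_conn_anti i a b Vx)) mulmxBl.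
rewrite -/(spin_conn i x) !mulmxA.
move: (gam k *m _ k) (gam k *m mxtder _ _ _ _).
by move=> *; apply/matrixP => u v; rewrite !mxE; ring.
Qed.

Lemma mxtder_spin_conn i j : mxtder mM x (e i x) (spin_conn j)
  = spin_form gam (fun a b => (tder mM x (e i x) (christoffel g e j a b))%:C).
Proof.
have sG a b : csmooth_on mM V (fun y => (Gam j a b y)%:C).
  exact/csmooth_on_real/smooth_christoffel.
have sGg a b : smooth_mx (mM := mM) V (fun y => (Gam j a b y)%:C *: (gam a *m gam b)).
  by apply: (smooth_mxZ oV) => //; exact: smooth_mx_cst.
have sS a : smooth_mx (mM := mM) V (fun y => \sum_b (Gam j a b y)%:C *: (gam a *m gam b)).
  by apply: (smooth_mx_sum _ oV) => b _.
rewrite /spin_conn /spin_form.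
rewrite (mxtderZ _ oV Vx (csmooth_on_cst V _) (smooth_mx_sum _ oV (fun a _ => sS a))).
rewrite ctder_cst scale0r add0r (mxtder_sum _ _ oV Vx (fun a _ => sS a)).
congr (_ *: _); apply: eq_bigr => a _.
rewrite (mxtder_sum _ _ oV Vx (fun b _ => sGg a b)); apply: eq_bigr => b _.
rewrite (mxtderZ _ oV Vx (sG a b) (smooth_mx_cst V _)) mxtder_cst scaler0 addr0.
by rewrite ctder_real.
Qed.

(** [spin_form] is linear and, by [spin_form_bracket], compatible with commutators, so the curvature
    of the spin connection is [spin_form] of that of the frame coefficients, which [riem_frameE]
    identifies. *)
Lemma spin_curvature i j :
  mxtder mM x (e i x) (spin_conn j) - mxtder mM x (e j x) (spin_conn i)
  + (spin_conn i x *m spin_conn j x - spin_conn j x *m spin_conn i x)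
  - \sum_k (bracket_coef i j k)%:C *: spin_conn k x
  = spin_form gam (fun a b => (riem_frame g e i j a b x)%:C).
Proof.
rewrite !mxtder_spin_conn.
rewrite {1 2}/spin_conn (spin_form_bracket gamP _ (fun a b => spin_conn_anti i a b Vx)).
have -> : \sum_k (bracket_coef i j k)%:C *: spin_conn k x
    = spin_form gam (fun a b => \sum_k (bracket_coef i j k)%:C * (Gam k a b x)%:C).
  by rewrite spin_form_sum; apply: eq_bigr => k _; rewrite spin_formZ.
rewrite -!spin_formN -!spin_formD; apply: spin_form_eq => a b.
rewrite (riem_frameE oV se eo _ _ _ _ Vx) !rmorphB !rmorphD !rmorph_sum.
(* Antisymmetry of the coefficients turns the bracket formula into the difference of the two
   quadratic sums of [riem_frameE]. *)
have quad : \sum_m ((Gam j m b x)%:C * (Gam i m a x)%:C + (Gam j a m x)%:C * (Gam i m b x)%:C)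
    = \sum_m (Gam j a m x * Gam i m b x)%:C - \sum_m (Gam i a m x * Gam j m b x)%:C :> R[i].
  rewrite -sumrB; apply: eq_bigr => m _; rewrite !rmorphM.
  by rewrite (spin_conn_anti i a m Vx) mulrN [LHS]addrC mulrC [X in _ - X]mulrC [X in X -
    _]mulrC.
rewrite quad.
have last3 : \sum_k (bracket_coef i j k)%:C * (Gam k a b x)%:C
    = \sum_k ((Gam i j k x - Gam j i k x) * Gam k a b x)%:C :> R[i].
  by apply: eq_bigr => k _; rewrite rmorphM.
rewrite last3.
have shuffle (p q r s t : R[i]) : p - q + (r - s) - t = p + r - (q + s) - t by ring.
exact: shuffle.
Qed.

(** The Ricci identity for spinors, with the derivative along the bracket written in the frame so
    that it can join the other first-order terms. *)
Lemma frame_nabla_comm i j F : smooth_mx (mM := mM) V F ->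
  frame_nabla i (frame_nabla j F) x - frame_nabla j (frame_nabla i F) x
  = \sum_k (bracket_coef i j k)%:C *: frame_nabla k F x
  + spin_form gam (fun a b => (riem_frame g e i j a b x)%:C) *m F x
  + frame_curv i j *: F x.
Proof.
move=> sF.
have twice a b : frame_nabla a (frame_nabla b F) x =
    mxtder mM x (e a x) (fun y => mxtder mM y (e b y) F)
    + (mxtder mM x (e a x) (spin_conn b) *m F x
       + spin_conn b x *m mxtder mM x (e a x) F)
    + (ctder mM x (e a x) (alpha b) *: F x + alpha b x *: mxtder mM x (e a x) F)
    + spin_conn a x *m (mxtder mM x (e b x) F + spin_conn b x *m F x + alpha b x *: F x)
    + alpha a x *: (mxtder mM x (e b x) F + spin_conn b x *m F x + alpha b x *: F x).
  have s1 := smooth_mxtder oV (se b) sF.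
  have s2 := smooth_mxM oV (smooth_spin_conn b) sF.
  have s3 := smooth_mxZ oV (salpha b) sF.
  rewrite {1}/frame_nabla; apply: (f_equal (fun u => u + _ + _)).
  apply: (etrans (mxtderD _ Vx (smooth_mxD oV s1 s2) s3)).
  apply: (f_equal2 +%R _ (mxtderZ _ oV Vx (salpha b) sF)).
  apply: (etrans (mxtderD _ Vx s1 s2)); apply: (f_equal (fun u => _ + u)).
  exact: (mxtderM _ oV Vx (smooth_spin_conn b) sF).
have lieE : mxtder mM x (e i x) (fun y => mxtder mM y (e j y) F)
    = mxtder mM x (e j x) (fun y => mxtder mM y (e i y) F)
    + \sum_k (bracket_coef i j k)%:C *: mxtder mM x (e k x) F.
  apply/eqP; rewrite addrC -subr_eq; apply/eqP.
  rewrite -(mxtder_lie oV Vx (se i) (se j) sF) (lie_frame eo i j Vx) mxtder_sumv.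
  by apply: eq_bigr => k _; rewrite mxtderZv.
rewrite -spin_curvature !twice lieE.
rewrite /frame_curv.
have -> : \sum_k (bracket_coef i j k)%:C *: frame_nabla k F x
    = \sum_k (bracket_coef i j k)%:C *: mxtder mM x (e k x) F
    + (\sum_k (bracket_coef i j k)%:C *: spin_conn k x) *m F x
    + (\sum_k (bracket_coef i j k)%:C * alpha k x) *: F x.
  rewrite mulmx_suml scaler_suml -!big_split; apply: eq_bigr => k _ /=.
  by rewrite /frame_nabla !scalerDr -scalemxAl scalerA.
exact: commutator_expand.
Qed.

Lemma bracket_coef_anti i j k : bracket_coef j i k = - bracket_coef i j k.
Proof. by rewrite /bracket_coef opprB. Qed.

Lemma frame_curv_anti i j : frame_curv j i = - frame_curv i j.
Proof.
rewrite /frame_curv; have -> : \sum_k (bracket_coef j i k)%:C * alpha k x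
    = - \sum_k (bracket_coef i j k)%:C * alpha k x.
  by rewrite -sumrN; apply: eq_bigr => k _; rewrite bracket_coef_anti rmorphN mulNr.
have swap (a b s : R[i]) : a - b - - s = - (b - a - s) by ring.
exact: swap.
Qed.

Lemma sum_upper_triangle (W : lmodType R[i]) (H : 'I_n -> 'I_n -> W) :
  (forall i, H i i = 0) -> (forall i j, H j i = H i j) ->
  2^-1 *: (\sum_i \sum_j H i j) = \sum_(i < n) \sum_(j < n | (i < j)%N) H i j.
Proof.
move=> H0 symH.
have -> : \sum_i \sum_j H i j = (\sum_(i < n) \sum_(j < n | (i < j)%N) H i j) *+ 2.
  rewrite mulr2n [X in _ = X + _](eq_bigr (fun i : 'I_n => \sum_(j < n) if (i < j)%N then
    H i j else 0));
    last by move=> i _; rewrite big_mkcond.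
  rewrite [X in _ = _ + X](eq_bigr (fun i : 'I_n => \sum_(j < n) if (i < j)%N then H i j
    else 0));
    last by move=> i _; rewrite big_mkcond.
  rewrite [X in _ = _ + X]exchange_big -big_split; apply: eq_bigr => i _ /=.
  rewrite -big_split; apply: eq_bigr => j _ /=; rewrite (symH i j).
  by case: (ltngtP i j) => [||/val_inj ->]; rewrite ?addr0 ?add0r ?H0.
have half (Z : W) : 2^-1 *: (Z *+ 2) = Z.
  by rewrite -(scaler_nat 2 Z) scalerA mulVf ?scale1r // pnatr_eq0.
exact: half.
Qed.

(* The terms of order one in the square of the Dirac operator: the
   antisymmetric part of the second covariant derivatives contributes the
   bracket coefficients, and what remains is symmetric in [i] and [j]. *)
Lemma first_order_terms (F : 'I_n -> 'cV[R[i]]_N) :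
  2^-1 *: (\sum_i \sum_j gam i *m gam j *m (\sum_k (bracket_coef i j k)%:C *: F k))
  + \sum_i gam i *m (\sum_k (\sum_l (Gam i k l x)%:C *: gam l) *m F k)
  = - \sum_k (\sum_i Gam i k i x)%:C *: F k.
Proof.
have -> : 2^-1 *: (\sum_i \sum_j gam i *m gam j *m (\sum_k (bracket_coef i j k)%:C *: F k))
    = \sum_k (\sum_i \sum_j (2^-1 * (bracket_coef i j k)%:C) *: (gam i *m gam j)) *m F k.
  under [RHS]eq_bigr do rewrite mulmx_suml.
  rewrite [RHS]exchange_big scaler_sumr; apply: eq_bigr => i _ /=.
  under [RHS]eq_bigr do rewrite mulmx_suml.
  rewrite [RHS]exchange_big scaler_sumr; apply: eq_bigr => j _ /=.
  rewrite mulmx_sumr scaler_sumr; apply: eq_bigr => k _.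
  by rewrite -scalemxAr -scalemxAl scalerA.
have -> : \sum_i gam i *m (\sum_k (\sum_l (Gam i k l x)%:C *: gam l) *m F k)
    = \sum_k (\sum_i \sum_j (Gam i k j x)%:C *: (gam i *m gam j)) *m F k.
  under [RHS]eq_bigr do rewrite mulmx_suml.
  rewrite [RHS]exchange_big; apply: eq_bigr => i _ /=.
  rewrite mulmx_sumr; apply: eq_bigr => k _; rewrite mulmxA mulmx_sumr.
  by congr (_ *m _); apply: eq_bigr => j _; rewrite scalemxAr.
rewrite -big_split -sumrN; apply: eq_bigr => k _ /=; rewrite -mulmxDl -big_split.
have -> : \sum_i (\sum_j (2^-1 * (bracket_coef i j k)%:C) *: (gam i *m gam j)
      + \sum_j (Gam i k j x)%:C *: (gam i *m gam j))
    = \sum_i \sum_j (2^-1 * (Gam i k j x)%:C + 2^-1 * (Gam j k i x)%:C) *: (gam i *m gam j).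
  apply: eq_bigr => i _; rewrite -big_split; apply: eq_bigr => j _ /=.
  rewrite -scalerDl; congr (_ *: _); rewrite /bracket_coef rmorphB /=.
  by rewrite (spin_conn_anti i k j Vx) (spin_conn_anti j k i Vx); field.
rewrite (gam_sym_sum gamP) => [|i j]; last by rewrite addrC.
rewrite mul_scalar_mx scaleNr rmorph_sum; congr (- (_ *: _)).
by apply: eq_bigr => i _; field.
Qed.

(** The diagonal in [gam_antisym_sum] gives the pure second derivatives. The divergence in the
    Laplacian has another origin: it is what [first_order_terms] leaves of the brackets and of the
    derivatives of the frame, namely the trace of [Gam i k i] over [i]. *)
Theorem local_weitzenbock F : smooth_mx (mM := mM) V F ->
  \sum_i gam i *m frame_nabla i (fun y => \sum_k gam k *m frame_nabla k F y) x
  = - \sum_i (frame_nabla i (frame_nabla i F) x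
               + (divergence g (e i) x)%:C *: frame_nabla i F x)
    + (scalar_curvature g x / 4%:R)%:C *: F x
    + \sum_(i < n) \sum_(j < n | (i < j)%N)
        frame_curv i j *: (gam i *m gam j *m F x).
Proof.
move=> sF; have sN k := smooth_frame_nabla k sF.
under eq_bigr => i _ do rewrite (frame_nabla_gam i sN) mulmxDr mulmx_sumr.
rewrite big_split /=.
have -> : \sum_i \sum_k gam i *m (gam k *m frame_nabla i (frame_nabla k F) x)
    = \sum_i \sum_k gam i *m gam k *m frame_nabla i (frame_nabla k F) x.
  by apply: eq_bigr => i _; apply: eq_bigr => k _; rewrite mulmxA.
rewrite (gam_antisym_sum gamP).
have -> : \sum_i \sum_j gam i *m gam j *m
      (frame_nabla i (frame_nabla j F) x - frame_nabla j (frame_nabla i F) x)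
    = \sum_i \sum_j gam i *m gam j *m (\sum_k (bracket_coef i j k)%:C *: frame_nabla k F x)
      + (\sum_i \sum_j gam i *m gam j
          *m spin_form gam (fun a b => (riem_frame g e i j a b x)%:C)) *m F x
      + \sum_i \sum_j frame_curv i j *: (gam i *m gam j *m F x).
  rewrite mulmx_suml -!big_split; apply: eq_bigr => i _ /=.
  rewrite mulmx_suml -!big_split; apply: eq_bigr => j _ /=.
  by rewrite (frame_nabla_comm i j sF) !mulmxDr mulmxA scalemxAr.
have upper := sum_upper_triangle (H := fun i j => frame_curv i j *: (gam i *m gam j *m F x)).
have zero_curv : 2^-1 *: \sum_i \sum_j frame_curv i j *: (gam i *m gam j *m F x)
    = \sum_(i < n) \sum_(j < n | (i < j)%N) frame_curv i j *: (gam i *m gam j *m F x).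
  have curv0 i : frame_curv i i = 0.
    by have := frame_curv_anti i i => /eqP; rewrite -addr_eq0 -mulr2n mulrn_eq0 => /eqP.
  apply: upper => [i|i j]; first by rewrite curv0 scale0r.
  have [->//|ij] := eqVneq i j.
  rewrite frame_curv_anti (gam_swap gamP i j) (negPf ij) mulr0 raddf0 subr0.
  by rewrite mulNmx scalerN scaleNr opprK.
(* The constants combine as [1/2] from the antisymmetric half, [1/4] from [spin_form] and [2] from
   [lichnerowicz_contraction]. *)
have scalar_term : 2^-1 *: ((\sum_i \sum_j gam i *m gam j
      *m spin_form gam (fun a b => (riem_frame g e i j a b x)%:C)) *m F x)
    = (scalar_curvature g x / 4%:R)%:C *: F x.
  have -> : \sum_i \sum_j gam i *m gam j
      *m spin_form gam (fun a b => (riem_frame g e i j a b x)%:C)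
    = 4^-1 *: \sum_i \sum_j gam i *m gam j
      *m (\sum_a \sum_b (riem_frame g e i j a b x)%:C *: (gam a *m gam b)).
    rewrite scaler_sumr; apply: eq_bigr => i _; rewrite scaler_sumr; apply: eq_bigr => j _.
    by rewrite /spin_form -scalemxAr.
  rewrite (lichnerowicz_contraction gamP (T := fun i j k l => (riem_frame g e i j k l x)%:C)).
  - rewrite -scalemxAl mul_scalar_mx !scalerA (scalar_curvature_frame oV se eo Vx).
    congr (_ *: _); rewrite rmorphM fmorphV rmorph_nat rmorph_sum.
    have -> : \sum_i (\sum_j riem_frame g e i j j i x)%:C
        = \sum_i \sum_j (riem_frame g e i j j i x)%:C :> R[i].
      by apply: eq_bigr => i _; rewrite rmorph_sum.
    by field.
  - by move=> i j k l; rewrite (riem_frame_anti12 g oV se) // rmorphN.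
  - by move=> i j k l; rewrite (riem_frame_anti34 oV se eo) // rmorphN.
  - by move=> i j k l; rewrite -!rmorphD /= (riem_frame_bianchi oV se eo) // rmorph0.
  - by move=> i j k l; rewrite (riem_frame_pair oV se eo).
have div_term : \sum_i (divergence g (e i) x)%:C *: frame_nabla i F x
    = \sum_k (\sum_i Gam i k i x)%:C *: frame_nabla k F x.
  apply: eq_bigr => k _; congr (_%:C *: _).
  rewrite (divergence_frame oV se eo Vx (se k)); apply: eq_bigr => i _.
  exact: (inner_nabla_frame g oV se i k i Vx).
have laplacian_split : \sum_i (frame_nabla i (frame_nabla i F) x
      + (divergence g (e i) x)%:C *: frame_nabla i F x)
    = \sum_i frame_nabla i (frame_nabla i F) x
      + \sum_k (\sum_i Gam i k i x)%:C *: frame_nabla k F x.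
  by rewrite -div_term -big_split.
rewrite laplacian_split !scalerDr zero_curv scalar_term opprD.
have := first_order_terms (fun k => frame_nabla k F x).
have glue (a t1 t2 t3 u w : 'cV[R[i]]_N) : t1 + u = - w ->
    a + (t1 + t2 + t3) + u = a - w + t2 + t3.
  by move=> <-; apply/colP => k; rewrite !mxE; ring.
exact: glue.
Qed.

End LocalWeitzenbock.

(** * The global formula *)

Section Forms.
Context {R : realType} {n : nat} {M : topologicalType}.
Context {mM : oriented_manifold R n M}.
Implicit Types (a b : M -> 'rV[R[i]]_n) (x : M) (X Y : M -> 'rV[R]_n).

Lemma fapp_sum a x (I : Type) (r : seq I) (c : I -> R) (v : I -> 'rV[R]_n) :
  fapp a x (\sum_(i <- r) c i *: v i) = \sum_(i <- r) (c i)%:C * fapp a x (v i).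
Proof.
rewrite /fapp; under eq_bigr do rewrite summxE raddf_sum mulr_suml.
rewrite exchange_big /=; apply: eq_bigr => i _; rewrite mulr_sumr.
by apply: eq_bigr => k _; rewrite mxE rmorphM mulrA.
Qed.

Lemma fapp_eq a b x v : a x = b x -> fapp a x v = fapp b x v.
Proof. by move=> ab; rewrite /fapp ab. Qed.

Lemma dform_eq V a b X Y x : open V -> V x -> (forall y, V y -> a y = b y) ->
  dform mM a X Y x = dform mM b X Y x.
Proof.
move=> oV Vx ab; have abE Z y : V y -> fapp a y (Z y) = fapp b y (Z y).
  by move=> Vy; apply: fapp_eq; exact: ab.
apply: (f_equal2 (fun u v => u - v)); last exact: fapp_eq (ab x Vx).
by apply: (f_equal2 (fun u v => u - v)); apply: (ctder_eq _ oV Vx); exact: abE.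
Qed.

Lemma dlog_cst (w : R[i]) x : dlog mM (fun=> w) x = 0.
Proof. by apply/rowP => k; rewrite !mxE ctder_cst mulr0. Qed.

End Forms.

Section Weitzenbock.
Context {R : realType} {n : nat} {M : topologicalType}.
Context {mM : oriented_manifold R n M} {g : riemannian_metric mM}.
Context {P : spinT_structure g}.
Variable AB : torus_connection P.
Variable gam : 'I_n -> 'M[R[i]]_(spinor_dim n).
Hypothesis gamP : clifford_module gam.
Variable psi : total_space P -> 'cV[R[i]]_(spinor_dim n).
Hypothesis psiP : is_spinor_field gam psi.
Hypothesis n0 : (0 < n)%N.
Variable p : total_space P.
Local Notation ip y u v := (inner (gram g) y u v).

Let x := proj p.
Let V : set M := ldom (triv_at P x).
Let s := sec_at p.
Let e := frame_at p.
Let sigma y := spin_orbit (s y).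
Let t0 := transporter (lsec (triv_at P x) x) p.
Let A j y := fapp (locA AB sigma) y (e j y).
Let B j y := fapp (locB AB sigma) y (e j y).
Let alpha j y := 2^-1 * A j y + B j y.
Local Notation nab := (frame_nabla g e gam alpha).

Let oV : open V. Proof. exact: ldom_open. Qed.
Let Vx : V x. Proof. exact: triv_atP. Qed.
Let t0T : is_spinT t0. Proof. exact: transporter_spinT. Qed.
Let sx : s x = p. Proof. exact: sec_at_proj. Qed.
Let projs y : V y -> proj (s y) = y.
Proof. by move=> Vy; rewrite /s /sec_at proj_act ?lsecP. Qed.
Let se i : smooth_vf mM V (e i). Proof. exact: (smooth_frame_act_lsec i t0T). Qed.
Let eo y i j : V y -> ip y (e i y) (e j y) = (i == j)%:R.
Proof. by move=> Vy; have := frame_orthonormal_rows (s y) i j; rewrite projs. Qed.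
Let spsi : smooth_mx (mM := mM) V (fun y => psi (s y)).
Proof. exact: (smooth_psi_act_lsec psiP _ t0T). Qed.
Let ssec : smooth_section V s.
Proof. exact: (smooth_section_act_lsec _ t0T). Qed.

Let sA j : csmooth_on mM V (A j).
Proof.
have [sA _] := loc_smooth AB (smooth_torus_section_orbit ssec).
by apply: sA.
Qed.

Let sB j : csmooth_on mM V (B j).
Proof.
have [_ sB] := loc_smooth AB (smooth_torus_section_orbit ssec).
by apply: sB.
Qed.

Let salpha j : csmooth_on mM V (alpha j).
Proof.
apply: (csmooth_onD oV) => //; apply: (csmooth_onM oV) => //.
exact: csmooth_on_cst.
Qed.

Lemma clifford_frame (q : total_space P) i : clifford gam q (frame_at q i (proj q)) = gam i.
Proof.
rewrite /clifford /frame_at sec_at_proj -row_mul mulmxV; last first.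
  by rewrite unitmxE unitfE gt_eqF // frame_oriented.
rewrite (bigD1 i) //= big1 ?addr0 => [|j ji]; first by rewrite !mxE eqxx scale1r.
by rewrite !mxE eq_sym (negPf ji) scale0r.
Qed.

Lemma spin_conn_upper j y : V y -> spin_conn g e gam j y
  = 2^-1 *: \sum_(a < n) \sum_(b < n | (a < b)%N)
      (christoffel g e j a b y)%:C *: (gam a *m gam b).
Proof.
move=> Vy; rewrite -(sum_upper_triangle
  (H := fun a b => (christoffel g e j a b y)%:C *: (gam a *m gam b))).
- by rewrite scalerA -invfM -natrM.
- move=> a; have -> : christoffel g e j a a y = 0.
    have := christoffel_anti oV eo j a a Vy.
    by move/eqP; rewrite -addr_eq0 -mulr2n mulrn_eq0 => /eqP.
  by rewrite scale0r.
- move=> a b; have [->//|ab] := eqVneq a b.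
  rewrite (christoffel_anti oV eo j a b Vy) (gam_swap gamP a b) (negPf ab).
  by rewrite mulr0 raddf0 subr0 rmorphN scalerN scaleNr opprK.
Qed.

(** Agreement of [X] with [e j] at the single point [y] suffices by tensoriality in the direction.
    This is needed for the frame belonging to the point [s y], another local field with the same
    value at [y]. *)
Lemma nabla_along_frame X j y (Psi : total_space P -> 'cV[R[i]]_(spinor_dim n)) :
  V y -> (exists U, [/\ open U, U y & smooth_vf mM U X]) -> X y = e j y ->
  nabla_along AB gam s X Psi y = nab j (fun z => Psi (s z)) y.
Proof.
move=> Vy [U [oU Uy sX]] Xy.
pose W := U `&` V; have oW : open W by exact: openI.
have Wy : W y by [].
have WV : W `<=` V by move=> z [].
have WU : W `<=` U by move=> z [].
have seW k : smooth_vf mM W (e k) := smooth_vf_subset WV (se k).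
have eoW z a b : W z -> ip z (e a z) (e b z) = (a == b)%:R by move=> /WV; exact: eo.
have coefE a b : ip y (nabla g X (e a) y) (e b y) = christoffel g e j a b y.
  have nablaE : nabla g X (e a) y = nabla g (e j) (e a) y.
    rewrite (tensorial_frame oW seW eoW Wy (nabla_tensorial g oW Wy (seW a))
      (smooth_vf_subset WU sX)) Xy.
    rewrite (bigD1 j) //= big1 ?addr0 => [|k kj].
      by rewrite eo // eqxx scale1r.
    by rewrite eo // eq_sym (negPf kj) scale0r.
  by rewrite nablaE; exact: (inner_nabla_frame g oV se).
have sumE : \sum_(a < n) \sum_(b < n | (a < b)%N)
    (ip y (nabla g X (e a) y) (e b y))%:C *: (gam a *m gam b *m Psi (s y))
  = (\sum_(a < n) \sum_(b < n | (a < b)%N)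
      (christoffel g e j a b y)%:C *: (gam a *m gam b)) *m Psi (s y).
  rewrite mulmx_suml; apply: eq_bigr => a _; rewrite mulmx_suml.
  apply: eq_bigr => b _; rewrite -scalemxAl.
  exact: (f_equal (fun c : R => c%:C *: _) (coefE a b)).
rewrite /nabla_along /frame_nabla Xy (spin_conn_upper j Vy) -scalemxAl -sumE.
by rewrite /alpha scalerDl addrA.
Qed.

(** At [s y] the operator is built from the section and frame of that point; [spin_nabla_sec_at]
    replaces the section and [nabla_along_frame] the frame. The outcome is a function of [y] in
    fixed smooth data, ready to be differentiated. *)
Lemma dirac_local y : V y ->
  dirac_op AB gam psi (s y) = \sum_k gam k *m nab k (fun z => psi (s z)) y.
Proof.
move=> Vy; rewrite /dirac_op; apply: eq_bigr => k _; rewrite clifford_frame.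
set q := s y; have qy : proj q = y := projs Vy.
have smooth_q : exists U, [/\ open U, U y & smooth_vf mM U (frame_at q k)].
  exists (ldom (triv_at P (proj q))); split; first exact: ldom_open.
    by rewrite -{1}qy; exact: triv_atP.
  exact: (smooth_frame_act_lsec k (transporter_spinT q)).
apply: (f_equal (fun u => gam k *m u)).
apply: (etrans (spin_nabla_sec_at AB psiP n0 Vy smooth_q)).
apply: nabla_along_frame => //.
by rewrite /frame_at -{1}qy sec_at_proj.
Qed.

Lemma curvature_form_frame (a : M -> 'rV[R[i]]_n) i j :
  dform mM a (e i) (e j) x = ctder mM x (e i x) (fun y => fapp a y (e j y))
  - ctder mM x (e j x) (fun y => fapp a y (e i y))
  - \sum_k (bracket_coef g e x i j k)%:C * fapp a x (e k x).
Proof. by rewrite /dform (lie_frame eo i j Vx) fapp_sum. Qed.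

(** The section [s] is the translate of the section of the trivialization by the constant [t0], so
    the two torus sections differ by a constant, whose logarithmic derivative is zero. The
    curvatures, defined from the trivialization, can thus be computed along [s]. *)
Lemma curvature_local y : V y ->
  locA AB sigma y = locA AB (fun y => spin_orbit (lsec (triv_at P x) y)) y /\
  locB AB sigma y = locB AB (fun y => spin_orbit (lsec (triv_at P x) y)) y.
Proof.
move=> Vy; have [_ z1 w1] := t0T.
have slsec : smooth_section V (lsec (triv_at P x)).
  have -> : lsec (triv_at P x) = fun y => act (lsec (triv_at P x) y) spinT_one.
    by apply/funext => z; rewrite act_one.
  exact: (smooth_section_act_lsec _ is_spinT_one).
have gauge z : V z -> [/\ `|(lT t0).1| = 1, `|(lT t0).2| = 1 &
    sigma z = torus_act (spin_orbit (lsec (triv_at P x) z)) ((lT t0).1, (lT t0).2)].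
  move=> Vz; split; first by rewrite normrX z1 expr1n.
    by rewrite normrM z1 w1 mulr1.
  exact: (spin_orbit_act n0).
have [-> ->] := loc_gauge AB (smooth_torus_section_orbit slsec)
  (smooth_torus_section_orbit ssec) (csmooth_on_cst V (lT t0).1)
  (csmooth_on_cst V (lT t0).2) gauge Vy.
by rewrite !dlog_cst !addr0.
Qed.

Lemma frame_curv_forms i j : frame_curv g e alpha x i j
  = 2^-1 * curvA AB (e i) (e j) x + curvB AB (e i) (e j) x.
Proof.
rewrite /curvA /curvB -(dform_eq _ _ oV Vx (fun y Vy => (curvature_local Vy).1)).
rewrite -(dform_eq _ _ oV Vx (fun y Vy => (curvature_local Vy).2)).
rewrite !curvature_form_frame /frame_curv.
have alphaE a b : ctder mM x (e a x) (alpha b)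
    = 2^-1 * ctder mM x (e a x) (A b) + ctder mM x (e a x) (B b).
  have s2 := csmooth_onM oV (csmooth_on_cst V 2^-1) (sA b).
  apply: (etrans (ctderD _ s2 (sB b) Vx)); apply: (f_equal (fun u => u + _)).
  apply: (etrans (ctderM _ oV (csmooth_on_cst V 2^-1) (sA b) Vx)).
  by rewrite ctder_cst mul0r add0r.
rewrite !alphaE.
have -> : \sum_k (bracket_coef g e x i j k)%:C * alpha k x
    = 2^-1 * (\sum_k (bracket_coef g e x i j k)%:C * A k x)
      + \sum_k (bracket_coef g e x i j k)%:C * B k x.
  rewrite mulr_sumr -big_split; apply: eq_bigr => k _ /=.
  by rewrite /alpha mulrDr mulrCA.
have expand (h a b c a' b' c' : R[i]) :
    (h * a + a') - (h * b + b') - (h * c + c') = h * (a - b - c) + (a' - b' - c') by ring.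
exact: expand.
Qed.

Lemma weitzenbock_pos :
  dirac_op AB gam (dirac_op AB gam psi) p
  = spinor_laplacian AB gam psi p
    + (scalar_curvature g (proj p) / 4%:R)%:C *: psi p
    + 2%:R^-1 *: form2_act gam (curvA AB) psi p
    + form2_act gam (curvB AB) psi p.
Proof.
have sm i : exists U, [/\ open U, U x & smooth_vf mM U (e i)] by exists V.
(* The section attached to [p] is [s] itself, so this holds for every function [Psi], such as a
   covariant derivative of [psi] or its Dirac image. *)
have at_p Psi i : spin_nabla AB gam (e i) Psi p = nab i (fun z => Psi (s z)) x.
  by apply: (etrans (spin_nablaE _ _ _ _ _)); apply: nabla_along_frame.
(* Away from [p] the attached section is a different one, and gauge invariance for the field [psi]
   is required. *)
have at_section i y : V y ->
    spin_nabla AB gam (e i) psi (s y) = nab i (fun z => psi (s z)) y.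
  move=> Vy; have smV : exists U, [/\ open U, U y & smooth_vf mM U (e i)] by exists V.
  apply: (etrans (spin_nabla_sec_at (X := e i) AB psiP n0 Vy smV)).
  exact: (nabla_along_frame psi Vy smV (erefl (e i y))).
have diracE : dirac_op AB gam (dirac_op AB gam psi) p
    = \sum_i gam i *m nab i (fun y => \sum_k gam k *m nab k (fun z => psi (s z)) y) x.
  rewrite {1}/dirac_op; apply: eq_bigr => i _; rewrite clifford_frame.
  apply: (f_equal (fun u => gam i *m u)); apply: (etrans (at_p _ i)).
  by apply: (frame_nabla_eq g e oV gam alpha Vx i) => y Vy; exact: dirac_local.
have lapE : spinor_laplacian AB gam psi p
    = - \sum_i (nab i (nab i (fun z => psi (s z))) x
               + (divergence g (e i) x)%:C *: nab i (fun z => psi (s z)) x).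
  apply: (f_equal -%R); apply: eq_bigr => i _.
  apply: (f_equal2 +%R); last exact: (f_equal _ (at_p psi i)).
  apply: (etrans (at_p _ i)).
  exact: (frame_nabla_eq g e oV gam alpha Vx i (@at_section i)).
have scale_combine h a b (u : 'cV[R[i]]_(spinor_dim n)) :
    h *: (a *: u) + b *: u = (h * a + b) *: u by rewrite scalerA scalerDl.
have formE : 2%:R^-1 *: form2_act gam (curvA AB) psi p + form2_act gam (curvB AB) psi p
    = \sum_(i < n) \sum_(j < n | (i < j)%N)
        frame_curv g e alpha x i j *: (gam i *m gam j *m psi (s x)).
  rewrite /form2_act scaler_sumr -big_split; apply: eq_bigr => i _.
  rewrite scaler_sumr -big_split; apply: eq_bigr => j _ /=.
  rewrite !clifford_frame frame_curv_forms sx; exact: scale_combine.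
rewrite -[RHS]addrA formE lapE diracE (local_weitzenbock oV se eo gamP salpha Vx spsi).
by rewrite sx.
Qed.

End Weitzenbock.

Theorem proposition11 (R : realType) (n : nat) (M : topologicalType)
  (mM : oriented_manifold R n M) (M_connected : connected [set: M])
  (g : riemannian_metric mM) (P : spinT_structure g)
  (AB : torus_connection P)
  (gam : 'I_n -> 'M[R[i]]_(spinor_dim n)) (gamP : clifford_module gam)
  (psi : total_space P -> 'cV[R[i]]_(spinor_dim n))
  (psiP : is_spinor_field gam psi) (p : total_space P) :
  dirac_op AB gam (dirac_op AB gam psi) p
  = spinor_laplacian AB gam psi p
    + (scalar_curvature g (proj p) / 4%:R)%:C *: psi p
    + 2%:R^-1 *: form2_act gam (curvA AB) psi p
    + form2_act gam (curvB AB) psi p.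
Proof.
(* For [n = 0] all sums over indices are empty and both sides vanish; this case escapes the general
   argument because there [-1] is not in Spin(n). *)
have [n_eq0|n_gt0] := posnP n; last exact: weitzenbock_pos.
have I0 (i : 'I_n) : False by move: (ltn_ord i); rewrite {2}n_eq0.
rewrite /dirac_op /spinor_laplacian /form2_act /scalar_curvature.
rewrite !big1 ?oppr0 ?mul0r ?scale0r ?scaler0 ?addr0 // => i; by case: (I0 i).
Qed.
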